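(* Let $k$ be a field, $R=k[x_1,\dots,x_n]$, let $I\subset R$ be a monomial ideal and let $X\subset\mathbb{A}^n_k$ be the arrangement defined by $I$. Then $$m_{r,\alpha}=\dim_k H^r_I(R)_{\alpha}\qquad\text{for all } r\ge 0,\ \alpha\in\Omega=\{-1,0\}^n .$$
   Context: $R$ is $\mathbb{Z}^n$-graded by $\deg(x_i)=\varepsilon_i$, the $i$-th canonical basis vector of $\mathbb{Z}^n$; since $I$ is monomial, the local cohomology modules $H^r_I(R)$ are naturally $\mathbb{Z}^n$-graded, and $H^r_I(R)_\alpha$ is the homogeneous component of degree $\alpha$. For $\alpha\in\Omega=\{-1,0\}^n$ put $\mathfrak{p}_\alpha=\langle x_i\mid \alpha_i=-1\rangle$. $P(X)$ is the poset whose elements $p$ correspond to the intersections $X_p$ of irreducible components of $X$, ordered by inclusion; $I_p$ is the radical ideal defining $X_p$ and $h(p)$ its height. For $p\in P(X)$, $K(>p)$ is the simplicial complex with vertices the $q\in P(X)$ with $q>p$ and simplices the chains $p_0<\dots<p_s$ of such elements. Define $$m_{r,p}=\dim_k\tilde H_{h(p)-r-1}(K(>p);k),$$ reduced simplicial homology, where the reduced homology of the empty complex is $k$ in degree $-1$ and zero otherwise (and that of a non-empty complex is zero in degree $-1$). (If $\mathrm{char}\,k=0$, $m_{r,p}$ is the multiplicity of the conormal $T^*_{X_p}\mathbb{A}^n_k$ in the characteristic cycle of $H^r_I(R)$.) For $\alpha\in\Omega$ set $m_{r,\alpha}:=m_{r,p}$ if there is $p\in P(X)$ with $\mathfrak{p}_\alpha=I_p$,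 and $m_{r,\alpha}:=0$ otherwise. *)

(* Defs.v *)
From HB Require Import structures.
From mathcomp Require Import all_boot all_order all_algebra.
From mathcomp Require Export boolp classical_sets.
From mathcomp Require Export mpoly.

Set Implicit Arguments.
Unset Strict Implicit.
Unset Printing Implicit Defensive.

Import Order.TTheory GRing.Theory.
Local Open Scope ring_scope.
Local Open Scope classical_set_scope.

(* Dimension of a possibly infinite-dimensional subquotient Z / B of an
   R-module, viewed over k through the constants of R = k[x_1, ..., x_n]:
   dim_k (Z / B) = d means that the classes of some e_0, ..., e_(d-1) in Z
   form a k-basis of Z / B. *)
Definition subquot_dim (k : fieldType) (n : nat) (M : lmodType {mpoly k[n]})
    (Z B : set M) (d : nat) : Prop :=
  exists e : 'I_d -> M, (forall i, Z (e i)) /\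
    forall z, Z z ->
      exists! c : 'rV[k]_d, B (z - \sum_(i < d) (c 0 i)%:MP *: e i).

Section Ideals.
Variables (k : fieldType) (n : nat).
Local Notation R := {mpoly k[n]}.

Definition is_ideal (J : set R) : Prop :=
  [/\ J 0, (forall f g, J f -> J g -> J (f + g))
         & (forall a f, J f -> J (a * f))].

Definition ideal_gen (S : set R) : set R := smallest is_ideal S.

Definition ideal_pow (J : set R) (j : nat) : set R :=
  ideal_gen [set f | exists2 g : 'I_j -> R,
                       (forall i, J (g i)) & f = \prod_(i < j) g i].

Definition monomial_ideal (J : set R) : Prop :=
  exists G : set 'X_{1..n}, J = ideal_gen [set 'X_[m] | m in G].

Definition prime_ideal (P : set R) : Prop :=
  [/\ is_ideal P, ~ P 1 & forall f g, P (f * g) -> P f \/ P g].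

Definition has_prime_chain (P : set R) (h : nat) : Prop :=
  exists Q : nat -> set R,
    [/\ (forall i, (i <= h)%N -> prime_ideal (Q i)),
        (forall i, (i < h)%N -> Q i `<` Q i.+1)
      & Q h = P].

Definition prime_height (P : set R) (h : nat) : Prop :=
  has_prime_chain P h /\ forall h', has_prime_chain P h' -> (h' <= h)%N.

(* Least height of a prime containing J; the default value 0 is only reached
   when no such prime (of finite height) exists. *)
Definition height (J : set R) : nat :=
  xget 0%N [set h |
    (exists P, [/\ prime_ideal P, J `<=` P & prime_height P h]) /\
    (forall P h', prime_ideal P -> J `<=` P -> prime_height P h' ->
                  (h <= h')%N)].

(* The affine space is the scheme Spec R (k need not be infinite): its points
   are the prime ideals, and subsets of it are sets of prime ideals. *)
Definition zero_locus (J : set R) : set (set R) :=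
  [set P | prime_ideal P /\ J `<=` P].

Definition zariski_closed (Y : set (set R)) : Prop :=
  exists J : set R, Y = zero_locus J.

Definition irreducible (Y : set (set R)) : Prop :=
  Y !=set0 /\
  forall Z1 Z2, zariski_closed Z1 -> zariski_closed Z2 ->
    Y `<=` Z1 `|` Z2 -> Y `<=` Z1 \/ Y `<=` Z2.

Definition irreducible_component (X C : set (set R)) : Prop :=
  [/\ C `<=` X, irreducible C
    & forall C', irreducible C' -> C' `<=` X -> C `<=` C' -> C' = C].

Definition component_intersection (X Y : set (set R)) : Prop :=
  exists F : set (set (set R)),
    [/\ F !=set0, F `<=` irreducible_component X & Y = \bigcap_(C in F) C].

(* P, with p standing for Xp p, is the poset of the intersections of
   irreducible components of X ordered by inclusion; the last condition
   forces Xp to be injective. *)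
Definition intersection_poset (X : set (set R)) (d : Order.disp_t)
    (P : finPOrderType d) (Xp : P -> set (set R)) : Prop :=
  [/\ (forall p, component_intersection X (Xp p)),
      (forall Y, component_intersection X Y -> exists p, Xp p = Y)
    & (forall p q, (p <= q)%O <-> Xp p `<=` Xp q)].

(* The radical ideal defining a closed subset Y of Spec R. *)
Definition vanishing_ideal (Y : set (set R)) : set R := \bigcap_(P in Y) P.

Definition coord_prime (alpha : 'rV[int]_n) : set R :=
  ideal_gen [set 'X_i | i in [set i | alpha 0 i = -1]].

End Ideals.

Section SimplicialHomology.
Variables (k : fieldType) (V : finType).

(* Chains are functions on all subsets of V; a face is oriented by the
   enumeration of V, so that {v_0 < ... < v_s} has boundary
   \sum_i (-1)^i {v_0, ..., v_s} \ {v_i}. *)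
Definition boundary (c : {ffun {set V} -> k^o}) : {ffun {set V} -> k^o} :=
  [ffun t : {set V} => \sum_(v | v \notin t)
     (-1) ^+ #|[set w in t | (enum_rank w < enum_rank v)%N]|
       * c (v |: t)%SET].

Definition face_chain (u : {set V}) : {ffun {set V} -> k^o} :=
  [ffun t : {set V} => (t == u)%:R : k^o].

(* The span of the faces with s vertices, i.e. of dimension s - 1; s = 0 is
   the augmentation. *)
Definition chain_space (K : {set {set V}}) (s : nat) :
    {vspace {ffun {set V} -> k^o}} :=
  <<[seq face_chain u | u <- enum [set u in K | #|u| == s]%SET]>>%VS.

Definition reduced_homology_dim (K : {set {set V}}) (j : int) : nat :=
  if (j + 1)%R is Posz s then
    (\dim (chain_space K s :&: lker (linfun boundary))%VS
     - \dim (linfun boundary @: chain_space K s.+1)%VS)%N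
  else 0%N.

End SimplicialHomology.

(* K(>p), including its empty simplex. *)
Definition upper_chains (d : Order.disp_t) (P : finPOrderType d) (p : P) :
    {set {set P}} :=
  [set s : {set P} | [forall q in s, (p < q)%O] &&
                     [forall q in s, forall q' in s, (q >=< q')%O]]%SET.

Section Multiplicities.
Variables (k : fieldType) (n : nat) (d : Order.disp_t) (P : finPOrderType d).
Variable Xp : P -> set (set {mpoly k[n]}).

Definition mult (r : nat) (p : P) : nat :=
  reduced_homology_dim k (upper_chains p)
    ((height (vanishing_ideal (Xp p)))%:Z - r%:Z - 1).

Definition mult_deg (r : nat) (alpha : 'rV[int]_n) : nat :=
  if [pick p : P | `[< coord_prime alpha = vanishing_ideal (Xp p) >]]
    is Some p then mult r p else 0%N.

End Multiplicities.

Section GradedModules.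
Variables (k : fieldType) (n : nat).
Local Notation R := {mpoly k[n]}.

Definition poly_comp (a : 'rV[int]_n) : set R :=
  [set f | forall m, m \in msupp f -> forall i, (m i)%:Z = a 0 i].

Record gmod := Gmod {
  gsort :> lmodType R;
  gcomp : 'rV[int]_n -> set gsort;
  gcomp0 : forall a, gcomp a 0;
  gcompD : forall a x y, gcomp a x -> gcomp a y -> gcomp a (x + y);
  gcompZ : forall a b f x, poly_comp a f -> gcomp b x -> gcomp (a + b) (f *: x);
  gcomp_gen : forall x, exists s : seq 'rV[int]_n, exists y,
    [/\ uniq s, (forall a, gcomp a (y a)) & x = \sum_(a <- s) y a];
  gcomp_indep : forall (s : seq 'rV[int]_n) (y : 'rV[int]_n -> gsort),
    uniq s -> (forall a, gcomp a (y a)) -> \sum_(a <- s) y a = 0 ->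
    forall a, a \in s -> y a = 0
}.

Definition graded_map (A B : gmod) (f : A -> B) : Prop :=
  forall a x, gcomp a x -> gcomp a (f x).

Definition graded_injective (E : gmod) : Prop :=
  forall (A B : gmod) (i : {linear A -> B}) (f : {linear A -> E}),
    graded_map i -> injective i -> graded_map f ->
    exists2 g : {linear B -> E}, graded_map g & forall x, g (i x) = f x.

Record injective_resolution (M : gmod) := InjectiveResolution {
  res_obj :> nat -> gmod;
  res_aug : {linear M -> res_obj 0};
  res_diff : forall t, {linear res_obj t -> res_obj t.+1};
  res_obj_injective : forall t, graded_injective (res_obj t);
  res_aug_graded : graded_map res_aug;
  res_diff_graded : forall t, graded_map (res_diff t);
  res_aug_injective : injective res_aug;
  res_exact0 : forall y, res_diff 0 y = 0 <-> exists x, y = res_aug x;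
  res_exact : forall t y,
    res_diff t.+1 y = 0 <-> exists x, y = res_diff t x
}.

Definition torsion (I : set R) (M : lmodType R) : set M :=
  [set x | exists j, forall f, ideal_pow I j f -> f *: x = 0].

Section LocalCohomology.
Variables (I : set R) (M : gmod) (E : injective_resolution M).

Definition lc_cocycles (r : nat) (a : 'rV[int]_n) : set (E r) :=
  [set x | [/\ torsion I x, gcomp a x & res_diff E r x = 0]].

Definition lc_coboundaries (r : nat) : set (E r) :=
  if r is t.+1 then [set res_diff E t y | y in torsion I (M := E t)]
  else [set 0].

(* dim_k H^r_I(M)_a = d, where H^r_I is the r-th right derived functor of the
   I-torsion functor on Z^n-graded modules, computed with the resolution E. *)
Definition local_cohomology_dim (r : nat) (a : 'rV[int]_n) (d : nat) : Prop :=
  subquot_dim (@lc_cocycles r a) (@lc_coboundaries r) d.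

End LocalCohomology.

Fact poly_comp0 a : poly_comp a 0.
Proof. by move=> m; rewrite msupp0. Qed.

Fact poly_compD a (f g : R) :
  poly_comp a f -> poly_comp a g -> poly_comp a (f + g).
Proof.
move=> hf hg m /msuppD_le; rewrite mem_cat => /orP[] hm; [exact: hf|exact: hg].
Qed.

Fact poly_compM a b (f g : R) :
  poly_comp a f -> poly_comp b g -> poly_comp (a + b) (f * g).
Proof.
move=> hf hg m /msuppM_le /allpairsP [[m1 m2] /= [h1 h2 ->]] i.
by rewrite mnmDE PoszD (hf _ h1) (hg _ h2) mxE.
Qed.

Definition mnm_deg (m : 'X_{1..n}) : 'rV[int]_n := \row_i (m i)%:Z.

Fact mnm_deg_inj : injective mnm_deg.
Proof.
by move=> m1 m2 /rowP h; apply/mnmP => i; have := h i; rewrite !mxE => -[].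
Qed.

Fact poly_comp_gen (f : R) : exists s : seq 'rV[int]_n, exists y,
  [/\ uniq s, (forall a, poly_comp a (y a)) & f = \sum_(a <- s) y a].
Proof.
exists (map mnm_deg (msupp f)).
exists (fun a => \sum_(m <- msupp f | mnm_deg m == a) f@_m *: 'X_[m]).
split; first by rewrite map_inj_uniq ?msupp_uniq //; exact: mnm_deg_inj.
- move=> a; apply: big_ind => [||m /eqP <-]; first exact: poly_comp0.
  + exact: poly_compD.
  + move=> m' /msuppZ_le; rewrite msuppX inE => /eqP -> i.
    by rewrite mxE.
- rewrite big_map [LHS]mpolyE; apply: eq_big_seq => m hm.
  rewrite (eq_bigl (pred1 m)); last by move=> m' /=; rewrite (inj_eq mnm_deg_inj).
  by rewrite -big_filter filter_pred1_uniq ?msupp_uniq // big_seq1.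
Qed.

Fact poly_comp_indep (s : seq 'rV[int]_n) (y : 'rV[int]_n -> R) :
  uniq s -> (forall a, poly_comp a (y a)) -> \sum_(a <- s) y a = 0 ->
  forall a, a \in s -> y a = 0.
Proof.
move=> us hy h0 a ha; apply/mpolyP => m; rewrite mcoeff0.
have [hm|/memN_msupp_eq0 //] := boolP (m \in msupp (y a)).
have := congr1 (mcoeff m) h0; rewrite mcoeff0 raddf_sum /=.
rewrite (bigD1_seq a) //= big1 ?addr0 // => b /eqP hb.
apply/memN_msupp_eq0/negP => hmb; case: hb; apply/rowP => i.
by rewrite -(hy _ _ hm) -(hy _ _ hmb).
Qed.

Definition poly_gmod : gmod :=
  @Gmod R^o poly_comp poly_comp0 poly_compD poly_compM
    poly_comp_gen poly_comp_indep.

End GradedModules.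

(* Main.v *)
(* The minimal graded injective resolution of R is the Cousin complex, whose
   r-th term is the sum over |F| = r of the modules with basis the Laurent
   monomials x^a such that a_i < 0 for all i in F. The I-torsion of the summand
   at F is everything if I is contained in the prime (x_i | i in F), that is if
   F is a cover, and 0 otherwise. Hence H^r_I(R)_alpha is the r-th cohomology of
   the complex spanned by the covers F contained in T = {i | alpha_i = -1}, and
   passing to the complements T \ F it is a reduced simplicial homology group.
   The intersections of components of X are the V(x_i | i in F) for F a nonempty
   union of minimal covers, and F |-> (union of the minimal covers inside F) is
   a closure operator retracting the poset of covers properly contained in T to
   K(>p); the comparison is carried out by collapsing a simplicial complex that
   contains both. If T is not itself such a union, the complex of complements is
   void or a cone. *)

From HB Require Import structures.
Require Import Defs.
From mathcomp Require Import all_boot all_order all_algebra.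
From mathcomp Require Import zify ring.

Set Implicit Arguments.
Unset Strict Implicit.
Unset Printing Implicit Defensive.

Import Order.TTheory GRing.Theory Num.Theory.
Local Open Scope ring_scope.


(** * Subquotients and their dimension *)

(** The statement allows any graded injective resolution [E], so a comparison has to come before any
    explicit computation: maps between resolutions of [R] are unique up to homotopy, and maps and
    homotopies, being [R]-linear, preserve [I]-torsion. The price is a proof that the Cousin modules
    are injective, a graded Baer criterion that adjoins one homogeneous generator at a time. The
    shift in the multiplicity comes from complements: F with r elements gives the face T \ F with
    |T| - r vertices, hence of dimension h(p) - r - 1 once h(p) = |T| is known. As [height] refers
    to chains of arbitrary primes, this requires the bound |F| on the height of (x_i | i in F),
    which is obtained by counting monomials. Collapses replace a fibre lemma for posets: removing a
    free pair of faces is an explicit operation on chains, valid over any field and also when the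
    smaller face is empty, so degree -1 needs no separate treatment. *)

Section SubquotientDimension.
Variable k : fieldType.

(** Predicates in an arbitrary [k]-module allow cocycles of an infinite-dimensional module and
    cycles of a finite complex to be measured by the same notion. *)
Definition subquotient_dim (U : lmodType k) (Z B : set U) (d : nat) : Prop :=
  exists e : 'I_d -> U, (forall i, Z (e i)) /\
    forall z, Z z ->
      exists! c : 'rV[k]_d, B (z - \sum_(i < d) c 0 i *: e i).

Definition subspace (U : lmodType k) (B : set U) : Prop :=
  B 0 /\ forall a x y, B x -> B y -> B (a *: x + y).

Section Subspace.
Variables (U : lmodType k) (B : set U).
Hypothesis hB : subspace B.

Lemma subspace0 : B 0.
Proof. by case: hB. Qed.

Lemma subspaceD x y : B x -> B y -> B (x + y).
Proof. by move=> hx hy; rewrite -[x]scale1r; apply: hB.2. Qed.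

Lemma subspaceZ a x : B x -> B (a *: x).
Proof. by move=> hx; rewrite -[_ *: _]addr0; apply: hB.2 => //; apply: hB.1. Qed.

Lemma subspaceB x y : B x -> B y -> B (x - y).
Proof. by move=> hx hy; rewrite -scaleN1r addrC; apply: hB.2. Qed.

Lemma subspace_sum (J : finType) (c : J -> k) (e : J -> U) :
  (forall i, B (e i)) -> B (\sum_i c i *: e i).
Proof.
move=> he; apply: big_ind => [||i _]; [exact: subspace0|exact: subspaceD|].
exact: subspaceZ.
Qed.

Lemma subspace_congr x y : B (x - y) -> B x <-> B y.
Proof.
move=> hxy; split=> h.
  by rewrite -[y](subKr x); apply: subspaceB.
by rewrite -[x](subrK y); apply: subspaceD.
Qed.
End Subspace.

Section Transfer.
Variables (U V : lmodType k) (Z B : set U) (Z' B' : set V) (f : U -> V).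
Hypotheses (f_lin : forall a x y, f (a *: x + y) = a *: f x + f y)
  (hZ : subspace Z) (hB' : subspace B')
  (fZ : forall z, Z z -> Z' (f z))
  (fB : forall z, Z z -> B z <-> B' (f z))
  (f_surj : forall z, Z' z -> exists2 y, Z y & B' (z - f y)).

Let g : {linear U -> V} := HB.pack f (GRing.isLinear.Build k U V _ f f_lin).

Let f_sum d (c : 'rV[k]_d) (e : 'I_d -> U) z :
  f (z - \sum_(i < d) c 0 i *: e i) = f z - \sum_(i < d) c 0 i *: f (e i).
Proof.
rewrite -[f]/(g : U -> V) raddfB raddf_sum /=; congr (_ - _).
by apply: eq_bigr => i _; exact: (linearZZ g).
Qed.

Let fB_comb d (c : 'rV[k]_d) (e : 'I_d -> U) (e' : 'I_d -> V) z z' :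
  (forall i, Z (e i)) -> Z z -> B' (z' - f z) ->
  (forall i, B' (e' i - f (e i))) ->
  B (z - \sum_(i < d) c 0 i *: e i) <->
  B' (z' - \sum_(i < d) c 0 i *: e' i).
Proof.
move=> he hz hzz hee.
rewrite fB; last by apply: subspaceB => //; apply: subspace_sum.
rewrite f_sum; apply: subspace_congr => //.
rewrite [X in B' X](_ : _ = \sum_(i < d) c 0 i *: (e' i - f (e i)) - (z' - f z)).
  by apply: subspaceB => //; apply: subspace_sum.
under [in RHS]eq_bigr do rewrite scalerBr.
by rewrite sumrB !opprB addrACA [RHS]addrACA [f z + _]addrC.
Qed.

(** The hypotheses make [f] induce an isomorphism of quotients: [fB] is injectivity, [f_surj] is
    surjectivity modulo [B']. All comparisons of complexes and of resolutions below go through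
    this. *)
Lemma subquotient_dim_transfer d : subquotient_dim Z B d <-> subquotient_dim Z' B' d.
Proof.
split=> -[e [he hc]].
  exists (f \o e); split=> [i|z hz]; first exact: fZ.
  have [y hy hzy] := f_surj hz; have [c [h1 h2]] := hc _ hy.
  have key c' := fB_comb c' (e' := f \o e) he hy hzy.
  exists c; split=> [|c' h]; [apply/key|apply/h2/key] => //= i;
    by rewrite subrr; apply: subspace0.
have /choice [e1 he1] : forall i, exists y, Z y /\ B' (e i - f y).
  by move=> i; have [y] := f_surj (he i); exists y.
exists e1; split=> [i|z hz]; first by case: (he1 i).
have [c [h1 h2]] := hc _ (fZ hz).
have key (c' : 'rV[k]_d) : B (z - \sum_(i < d) c' 0 i *: e1 i) <->
    B' (f z - \sum_(i < d) c' 0 i *: e i).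
  apply: fB_comb => // [i||i]; [by case: (he1 i)| |by case: (he1 i)].
  by rewrite subrr; apply: subspace0.
by exists c; split=> [|c' h]; [apply/key|apply: h2; apply/key].
Qed.
End Transfer.

(** A basis of a complement of [B] in [Z] represents a basis of the quotient. *)
Lemma subquotient_dim_vspace (U : vectType k) (Z B : {vspace U}) :
  (B <= Z)%VS ->
  subquotient_dim (fun x => x \in Z) (fun x => x \in B) (\dim Z - \dim B).
Proof.
move=> hBZ; pose W := (Z :\: B)%VS.
have hWB : (W + B)%VS = Z by rewrite addvC addvC addv_diff (addv_idPl hBZ).
have dW : (W :&: B = 0)%VS.
  exact: capv_diff.
have dimW : (\dim Z - \dim B)%N = \dim W.
  by rewrite -hWB dimv_disjoint_sum // addnK.
rewrite dimW; pose X := vbasis W.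
have bX : basis_of W X := vbasisP _.
have XW (i : 'I_(\dim W)) : X`_i \in W by rewrite vbasis_mem // mem_nth ?size_tuple.
exists (fun i => X`_i); split=> [i|z].
  exact: subvP (diffvSl Z B) _ (XW i).
rewrite -{1}hWB => /memv_addP [w hw [b hb ->]].
exists (\row_i coord X i w); split=> [|c].
  rewrite (eq_bigr (fun i => coord X i w *: X`_i)); last by move=> i; rewrite mxE.
  by rewrite -coord_vbasis // addrC addKr.
set s := \sum_(i < _) _ => hs.
have sW : s \in W by apply: memv_suml => i _; apply: memvZ.
have ws : w = s.
  apply/eqP; rewrite -subr_eq0 -memv0 -dW memv_cap memvB //=.
  by rewrite -[w - s](addrK b) memvB // addrAC.
apply/rowP => i; rewrite mxE ws coord_sum_free //; exact: basis_free bX.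
Qed.
End SubquotientDimension.

(** * Simplicial homology and collapses *)

Section Incidence.
Variables (k : fieldType) (V : finType) (rho : V -> nat).
Hypothesis rho_inj : injective rho.
Implicit Types (t : {set V}) (v w : V) (c : {set V} -> k).

(** The vertex order [rho] is a parameter because the Cousin complex will number the variables
    differently from the enumeration used in [boundary]. *)
Definition incidence t v : k := (-1) ^+ #|[set w in t | (rho w < rho v)%N]%SET|.

Lemma incidence_sq t v : incidence t v * incidence t v = 1.
Proof. by rewrite -expr2 sqrr_sign. Qed.

Lemma incidence_setU1 t v w : w \notin t ->
  incidence (w |: t)%SET v = (-1) ^+ (rho w < rho v)%N * incidence t v.
Proof.
move=> wt; rewrite /incidence -exprD; congr (_ ^+ _).
have [h|h] := boolP (rho w < rho v)%N.
  rewrite (_ : [set _ in _ | _]%SET = w |: [set w0 in t | (rho w0 < rho v)%N])%SET.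
    by rewrite cardsU1 !inE (negbTE wt) /=.
  by apply/setP => x; rewrite !inE; case: eqVneq => [->|] //=.
congr #|pred_of_set _|; apply/setP => x; rewrite !inE.
by case: eqVneq => [->|] //=; rewrite (negbTE h) (negbTE wt).
Qed.

(** Exactly one of [v], [w] precedes the other, so exactly one of the two signs changes when the
    other vertex is inserted first. *)
Lemma incidence_anticomm t v w : v != w -> v \notin t -> w \notin t ->
  incidence t v * incidence (v |: t)%SET w = - (incidence t w * incidence (w |: t)%SET v).
Proof.
move=> vw vt wt; rewrite !incidence_setU1 //.
have /orP : (rho v < rho w)%N || (rho w < rho v)%N.
  by rewrite -neq_ltn (inj_eq rho_inj).
case=> h; rewrite h ltnNge (ltnW h) /= expr1 expr0; ring.
Qed.

Definition set_boundary c t : k := \sum_(v | v \notin t) incidence t v * c (v |: t)%SET.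

Lemma set_boundary_boundary c t : set_boundary (set_boundary c) t = 0.
Proof.
pose X v w := incidence t v * incidence (v |: t)%SET w * c (w |: (v |: t))%SET.
transitivity (\sum_(v | v \notin t) \sum_(w | (w \notin t) && (w != v)) X v w).
  apply: eq_bigr => v vt; rewrite mulr_sumr; apply: eq_big => [w|w _].
    by rewrite !inE negb_or andbC.
  by rewrite mulrA.
pose L v w := \sum_(w | (w \notin t) && (rho v < rho w)%N) X v w.
have split v : \sum_(w | (w \notin t) && (w != v)) X v w =
   \sum_(w | (w \notin t) && (rho v < rho w)%N) X v w +
   \sum_(w | (w \notin t) && (rho w < rho v)%N) X v w.
  rewrite (bigID (fun w => rho v < rho w)%N) /=; congr (_ + _).
    apply: eq_bigl => w; rewrite -andbA; congr (_ && _).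
    by case: eqVneq => [->|] //=; rewrite ltnn.
  apply: eq_bigl => w; rewrite -andbA; congr (_ && _).
  rewrite -leqNgt ltn_neqAle (inj_eq rho_inj); by [].
rewrite (eq_bigr _ (fun v _ => split v)) big_split /=.
(* The half w < v becomes the half v < w with the two vertices swapped; the halves then cancel
   termwise. *)
rewrite [X in _ + X](exchange_big_dep (fun w => w \notin t)) /=; last by move=> ? ? _ /andP[].
rewrite -big_split big1 //= => v vt.
rewrite [X in _ + X](eq_bigl (fun w => (w \notin t) && (rho v < rho w)%N)).
  rewrite -big_split big1 //= => w /andP[wt vw].
  have nvw : v != w by apply: contraTneq vw => ->; rewrite ltnn.
  by rewrite /X setUCA (incidence_anticomm nvw vt wt) mulNr addNr.
by move=> w; rewrite vt.
Qed.

(** The join with [v0], written on coefficients: the contracting homotopy of a full simplex. *)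
Definition cone v0 c t : k :=
  if v0 \in t then incidence (t :\ v0)%SET v0 * c (t :\ v0)%SET else 0.

(** If [v0] is not in [t], only the term inserting [v0] survives, with sign squared to 1. If it is,
    that term sits in the second summand and the others cancel by anticommutation. *)
Lemma cone_homotopy v0 c t : set_boundary (cone v0 c) t + cone v0 (set_boundary c) t = c t.
Proof.
rewrite {2}/cone; case: ifPn => h; last first.
  rewrite addr0 /set_boundary (bigD1 v0) //= big1 ?addr0.
    by rewrite /cone setU11 setU1K // mulrA incidence_sq mul1r.
  move=> v /andP[vt vv0]; rewrite /cone !inE eq_sym (negbTE vv0) (negbTE h) mulr0 //.
pose s := (t :\ v0)%SET.
have v0s : v0 \notin s by rewrite !inE eqxx.
have ts : t = (v0 |: s)%SET by rewrite setD1K.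
rewrite -/s {2}/set_boundary (bigD1 v0) //= -ts mulrDr mulrA incidence_sq mul1r addrCA.
rewrite [X in _ + X](_ : _ = 0) ?addr0 //.
rewrite mulr_sumr /set_boundary (eq_bigl (fun v => (v \notin s) && (v != v0))); last first.
  by move=> v; rewrite ts !inE negb_or andbC.
rewrite -big_split big1 //= => v /andP[vs vv0].
rewrite /cone ts !inE eqxx orbT.
rewrite (_ : (_ :\ v0)%SET = (v |: s)%SET); last first.
  by rewrite setUCA setU1K // in_setU1 negb_or (negbTE v0s) eq_sym vv0.
have := incidence_anticomm vv0 vs v0s; set a := incidence _ _; set b := incidence _ _.
set a' := incidence _ _; set b' := incidence _ _ => e.
have a2 : a * a = 1 := incidence_sq _ _.
have b2 : b' * b' = 1 := incidence_sq _ _.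
have -> : b' * (b * c (v |: s)%SET) = b' * (a * (a * b)) * c (v |: s)%SET.
  by rewrite [a * (a * b)]mulrA a2 mul1r mulrA.
rewrite e mulrN mulrN mulNr.
have -> : b' * (a * (a' * b')) = b' * b' * (a' * a) by ring.
rewrite b2; ring.
Qed.
End Incidence.

Section Simplicial.
Variables (k : fieldType) (V : finType).
Implicit Types (K : {set {set V}}) (c : {ffun {set V} -> k^o}) (t u : {set V}).

Definition vrank (v : V) : nat := enum_rank v.

Lemma vrank_inj : injective vrank.
Proof. by move=> v w /val_inj /enum_rank_inj. Qed.

Lemma boundaryE c t : boundary c t = @set_boundary k V vrank c t.
Proof. by rewrite ffunE. Qed.

Lemma boundary_linear : linear (@boundary k V).
Proof.
move=> a x y; apply/ffunP => t; rewrite !ffunE.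
rewrite scaler_sumr -big_split /=; apply: eq_bigr => v _.
by rewrite !ffunE mulrDr; congr (_ + _); apply: mulrCA.
Qed.

HB.instance Definition _ :=
  GRing.isLinear.Build k _ _ _ (@boundary k V) boundary_linear.

Lemma boundary_boundary c : boundary (boundary c) = 0.
Proof.
apply/ffunP => t; rewrite boundaryE [RHS]ffunE -(set_boundary_boundary vrank_inj c t).
by apply: eq_bigr => v _; rewrite boundaryE.
Qed.

Definition chains K s : set {ffun {set V} -> k^o} :=
  fun c => forall t, c t != 0 -> t \in K /\ #|t| = s.

Lemma chains_subspace K s : subspace (chains K s).
Proof.
split=> [t|a x y hx hy t]; first by rewrite ffunE eqxx.
rewrite !ffunE => h; have [hx0|/hx //] := eqVneq (x t) 0.
by apply: hy; apply: contraNneq h => hy0; rewrite hx0 hy0 scaler0 addr0.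
Qed.

Lemma chain_spaceP K s c : c \in chain_space k K s <-> chains K s c.
Proof.
split=> [/coord_span -> | hc].
  apply: subspace_sum => [|i t]; first exact: chains_subspace.
  set X := map_tuple _ _; rewrite -tnth_nth; have := mem_tnth i X.
  case/mapP => u; rewrite mem_enum inE => /andP[uK /eqP us] ->.
  by rewrite ffunE; case: (eqVneq t u) => [->|]; rewrite ?eqxx.
have -> : c = \sum_(u in [set u in K | #|u| == s]%SET) c u *: face_chain k u.
  apply/ffunP => t; rewrite sum_ffunE.
  have [ct|/hc[tK ts]] := eqVneq (c t) 0.
    rewrite ct big1 // => u _; rewrite !ffunE.
    by case: (eqVneq t u) => [<-|]; rewrite ?ct ?scale0r ?scaler0.
  rewrite (bigD1 t) /= ?inE ?tK ?ts ?eqxx // big1 => [|u /andP[_ ut]].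
    by rewrite !ffunE eqxx addr0 [_ *: _]mulr1.
  by rewrite !ffunE eq_sym (negbTE ut) scaler0.
apply: memv_suml => u hu; apply: memvZ; apply: memv_span.
by apply: map_f; rewrite mem_enum.
Qed.

(** The void family qualifies and differs from [[set set0]]: the former has no homology, the latter
    has [k] in degree -1. *)
Definition complex K := forall t u, t \in K -> u \subset t -> u \in K.

Definition cycles K s : set {ffun {set V} -> k^o} :=
  fun c => chains K s c /\ boundary c = 0.

Definition boundaries K s : set {ffun {set V} -> k^o} :=
  fun c => exists2 b, chains K s.+1 b & c = boundary b.

Definition homology_dim K s d := subquotient_dim (cycles K s) (boundaries K s) d.

Lemma cycles_subspace K s : subspace (cycles K s).
Proof.
have [h0 h] := chains_subspace K s; split; first by split=> //; rewrite raddf0.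
by move=> a x y [hx ex] [hy ey]; split; [exact: h|rewrite linearP /= ex ey scaler0 addr0].
Qed.

Lemma boundaries_subspace K s : subspace (boundaries K s).
Proof.
have [h0 h] := chains_subspace K s.+1; split; first by exists 0 => //; rewrite raddf0.
move=> a _ _ [x hx ->] [y hy ->]; exists (a *: x + y); first exact: h.
by rewrite linearP.
Qed.

Lemma boundary_chains K s c : complex K ->
  chains K s.+1 c -> chains K s (boundary c).
Proof.
move=> hK hc t; rewrite boundaryE => h.
have [v /andP[vt cv]|h0] := pickP (fun v => (v \notin t) && (c (v |: t)%SET != 0)).
  have [tK] := hc _ cv; rewrite cardsU1 vt => -[ts]; split=> //.
  by apply: hK tK _; apply: subsetUr.
case/eqP: h; apply: big1 => v vt; have := h0 v; rewrite vt /= => /negbFE/eqP ->.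
by rewrite mulr0.
Qed.

Lemma reduced_homology_dimP K (j : int) (s : nat) : complex K -> j + 1 = s%:Z ->
  homology_dim K s (reduced_homology_dim k K j).
Proof.
move=> hK js; rewrite /homology_dim /reduced_homology_dim js.
set Z := (_ :&: _)%VS; set B := (_ @: _)%VS.
have ZE c : c \in Z <-> cycles K s c.
  rewrite memv_cap memv_ker lfunE /=; split.
    by move=> /andP[/chain_spaceP h /eqP].
  by move=> [/chain_spaceP -> ->] /=.
have BE c : c \in B <-> boundaries K s c.
  split=> [/memv_imgP[b /chain_spaceP hb ->]|[b /chain_spaceP hb ->]].
    by exists b => //; rewrite lfunE.
  by rewrite -[boundary b]lfunE memv_img.
have BZ : (B <= Z)%VS.
  apply/subvP => c /BE [b hb ->]; apply/ZE; split; last exact: boundary_boundary.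
  exact: boundary_chains.
rewrite (_ : cycles K s = fun x => x \in Z).
  rewrite (_ : boundaries K s = fun x => x \in B); first exact: subquotient_dim_vspace.
  by apply/funext => c; apply/propext; rewrite BE.
by apply/funext => c; apply/propext; rewrite ZE.
Qed.

End Simplicial.

Arguments vrank {V} v.

Section Collapse.
Variables (k : fieldType) (V : finType).
Implicit Types (K L : {set {set V}}) (c : {ffun {set V} -> k^o}) (t u : {set V}).

Section ElementaryCollapse.
Variables (K : {set {set V}}) (t : {set V}) (v : V).
Hypotheses (hK : complex K) (vt : v \notin t) (vtK : (v |: t)%SET \in K)
  (t_free : forall u, u \in K -> t \subset u -> u = t \/ u = (v |: t)%SET).

Let K' := (K :\ t :\ (v |: t))%SET.

Lemma elementary_collapse_complex : complex K'.
Proof.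
move=> u w; rewrite !inE => /and3P[uvt ut uK] wu.
rewrite (hK uK wu) andbT; apply/andP; split.
  apply: contraNneq uvt => wE.
  have tu : t \subset u by apply: subset_trans wu; rewrite wE subsetUr.
  by case: (t_free uK tu) => [ue|->//]; case/eqP: ut.
apply/eqP => wE; move: wu; rewrite wE => tu.
by case: (t_free uK tu) => ue; [case/eqP: ut|case/eqP: uvt].
Qed.

Let chains_sub s c : chains K' s c -> chains K s c.
Proof. by move=> h u /h; rewrite !inE => -[/and3P[]]. Qed.

(** As [t] is free, [v |: t] is the only face of [K] that can contribute to the boundary at [t]. *)
Let boundary_t s c : chains K s c ->
  boundary c t = incidence k (@vrank V) t v * c (v |: t)%SET.
Proof.
move=> hc; rewrite boundaryE /set_boundary (bigD1 v) //= big1 ?addr0 // => u /andP[ut uv].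
have [->|/hc[uK _]] := eqVneq (c (u |: t)%SET) 0; first by rewrite mulr0.
case: (t_free uK (subsetUr _ _)) => /setP/(_ u); rewrite !inE eqxx.
  by rewrite (negbTE ut).
by rewrite (negbTE uv) (negbTE ut).
Qed.

Let chains_correct s c : chains K s c -> c (v |: t)%SET = 0 ->
  exists2 b, chains K s.+1 b & chains K' s (c - boundary b).
Proof.
move=> hc c0.
have [ct|ct] := eqVneq (c t) 0.
  exists 0 => [|u]; first exact: subspace0 (chains_subspace _ _ _).
  rewrite raddf0 subr0 => cu; case: (hc _ cu) => uK us; split=> //.
  rewrite !inE uK andbT; apply/andP; split.
    by apply: contra_neq cu => ->.
  by apply: contra_neq cu => ->.
have [_ ts] := hc _ ct.
pose e : {ffun {set V} -> k^o} := face_chain k (v |: t)%SET.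
have he : chains K s.+1 e.
  move=> u; rewrite ffunE; case: (eqVneq u _) => [->|_]; last by rewrite eqxx.
  by rewrite cardsU1 vt ts.
pose b := (c t * incidence k (@vrank V) t v) *: e.
have hb : chains K s.+1 b by apply: subspaceZ he; exact: chains_subspace.
exists b => // u; have hdb := boundary_chains hK hb.
move=> hu; have := subspaceB (chains_subspace k K s) hc hdb.
move=> /(_ u hu) [uK us]; split=> //; rewrite !inE uK andbT.
rewrite !ffunE in hu; apply/andP; split; apply: contra_neq hu => ->.
  rewrite c0 big1 ?oppr0 ?addr0 // => w wt; rewrite !ffunE.
  case: (eqVneq (w |: (v |: t))%SET) => [/setP/(_ w)|_]; last by rewrite scaler0 mulr0.
  by rewrite setU11 (negbTE wt).
have := boundary_t hb; rewrite !ffunE eqxx => ->.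
by rewrite [_ *: _]mulr1 mulrCA incidence_sq mulr1 subrr.
Qed.

(** A cycle of [K] has coefficient 0 at [v |: t], since its boundary at [t] vanishes; its
    coefficient at [t] is then removed by the boundary of a multiple of [v |: t]. The same
    correction, applied to a bounding chain, gives injectivity. *)
Lemma elementary_collapse s d :
  homology_dim k K' s d <-> homology_dim k K s d.
Proof.
apply: (subquotient_dim_transfer (f := id)) => //.
- exact: cycles_subspace.
- exact: boundaries_subspace.
- by move=> z [/chains_sub].
- move=> z [hz z0]; split=> [[b /chains_sub hb ->]|[b hb zb]]; first by exists b.
  have bvt : b (v |: t)%SET = 0.
    have zt : z t = 0 by apply/eqP; apply: contraT => /hz [/=]; rewrite !inE eqxx andbF.
    move: zt; rewrite zb (boundary_t hb) => /(congr1 ( *%R (incidence k (@vrank V) t v))).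
    by rewrite mulrA incidence_sq mul1r mulr0.
  have [b' hb' hbb] := chains_correct hb bvt.
  by exists (b - boundary b') => //; rewrite raddfB /= boundary_boundary subr0.
- move=> z [hz z0].
  have zvt : z (v |: t)%SET = 0.
    have := boundary_t hz; rewrite z0 ffunE => /(congr1 ( *%R (incidence k (@vrank V) t v))).
    by rewrite mulrA incidence_sq mul1r mulr0.
  have [b hb hzb] := chains_correct hz zvt.
  exists (z - boundary b).
    by split=> //; rewrite raddfB /= boundary_boundary z0 subr0.
  by rewrite opprB addrC subrK; exists b.
Qed.
End ElementaryCollapse.

(* Each pair [{t, pivot t |: t}] of faces of [K] outside [L] can be collapsed
   once the faces outside [L] of larger rank are gone. *)
Lemma matching_collapse K L (pivot : {set V} -> V) (rank : {set V} -> nat) :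
  complex K -> L \subset K ->
  (forall t, t \in K :\: L -> [/\
    (pivot t |: t)%SET \in K :\: L, (t :\ pivot t)%SET \in K :\: L,
    pivot (pivot t |: t)%SET = pivot t & pivot (t :\ pivot t)%SET = pivot t]) ->
  (forall t, t \in K :\: L -> rank (t :\ pivot t)%SET = rank t) ->
  (forall t u, t \in K :\: L -> u \in K -> pivot t \notin t ->
    t \proper u -> u = (pivot t |: t)%SET \/ u \notin L /\ (rank t < rank u)%N) ->
  forall s d,
  homology_dim k L s d <-> homology_dim k K s d.
Proof.
have [m] := ubnP #|K|; elim: m K => // m IH K Km hK LK hpiv hrank hfree s d.
have [KL|[t1 t1KL]] := set_0Vmem (K :\: L).
  suff -> : K = L by [].
  by apply/eqP; rewrite eqEsubset LK andbT -setD_eq0 KL.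
(* At maximal rank the lower face of the pair is free: by [hfree], any further coface would lie
   outside [L] with larger rank. *)
case: (@arg_maxnP _ t1 (mem (K :\: L)) rank t1KL) => t0 t0KL t0max {t1 t1KL}.
have [_ tKL _ tpiv] := hpiv _ t0KL; have rt := hrank _ t0KL.
set t := (t0 :\ pivot t0)%SET in tKL tpiv rt; set v := pivot t0 in tpiv.
have vt : v \notin t by rewrite !inE eqxx.
have [] := hpiv _ tKL; rewrite tpiv => vtKL _ vtpiv _.
have /setDP[tK tL] := tKL; have /setDP[vtK vtL] := vtKL.
have t_free u : u \in K -> t \subset u -> u = t \/ u = (v |: t)%SET.
  move=> uK; rewrite subEproper => /predU1P[->|tu]; first by left.
  case: (hfree t u tKL uK _ tu); rewrite ?tpiv //; first by right.
  case=> uL; have uKL : u \in K :\: L by rewrite inE uL uK.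
  have h : (rank u <= rank t0)%N := t0max u uKL.
  by rewrite rt ltnNge h.
rewrite -(elementary_collapse hK vt vtK t_free).
set K' := (_ :\ _ :\ _)%SET.
have K'E u : u \in K' :\: L = [&& u != t, u != (v |: t)%SET & u \in K :\: L].
  by rewrite !inE; do !case: (_ \in _); rewrite ?andbF ?andbT //= andbC.
have cK' : complex K' by apply: elementary_collapse_complex.
have inK' u : u \in K' :\: L -> u \in K :\: L by rewrite K'E => /and3P[].
apply: IH => //.
- rewrite ltnS in Km; apply: leq_trans Km; apply: proper_card.
  rewrite properE (subset_trans (subsetDl _ _) (subsetDl _ _)) /=.
  by apply/subsetPn; exists t => //; rewrite !inE eqxx andbF.
- apply/subsetP => u uL; rewrite !inE (subsetP LK) // andbT.
  by apply/andP; split; [apply: contraNneq vtL => <-|apply: contraNneq tL => <-].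
(* The matching survives: a face whose partner has been removed is itself one of the two removed
   faces. *)
- move=> u; rewrite K'E => /and3P[ut uvt uKL].
  have [h1 h2 h3 h4] := hpiv _ uKL; split=> //; rewrite K'E ?h1 ?h2 andbT.
    apply/andP; split; apply/eqP => e.
      by move: vt; rewrite -tpiv -e h3 setU11.
    have pu : pivot u = v by rewrite -h3 e.
    have [uu|uu] := boolP (pivot u \in u).
      by case/eqP: uvt; rewrite -e (setUidPr _) // sub1set.
    by case/eqP: ut; rewrite -(setU1K uu) e pu setU1K.
  apply/andP; split; apply/eqP => e.
    have pu : pivot u = v by rewrite -h4 e.
    have [uu|uu] := boolP (pivot u \in u).
      by case/eqP: uvt; rewrite -(setD1K uu) e pu.
    case/eqP: ut; rewrite -e; apply/setP => x; rewrite !inE.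
    by case: eqVneq => // ->; rewrite (negbTE uu).
  have pu : pivot u = v by rewrite -h4 e.
  by have /setP/(_ v) := e; rewrite !inE pu eqxx.
- by move=> u /inK'; apply: hrank.
- move=> u w /inK' uKL; rewrite !inE => /and3P[_ _ wK]; exact: hfree.
Qed.
End Collapse.

Section Relabel.
Variables (k : fieldType) (V W : finType) (i : V -> W).
Hypotheses (i_inj : injective i)
  (i_mono : forall v w, (vrank (i v) < vrank (i w))%N = (vrank v < vrank w)%N).
Variable K : {set {set V}}.

Let K' := [set i @: t | t : {set V} in K]%SET.

Let f (c : {ffun {set V} -> k^o}) : {ffun {set W} -> k^o} :=
  [ffun u : {set W} => if u \subset i @: [set: V]%SET then c (i @^-1: u)%SET else 0].

Let g (c : {ffun {set W} -> k^o}) : {ffun {set V} -> k^o} :=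
  [ffun t : {set V} => c (i @: t)%SET].

Let imK (t : {set V}) : (i @^-1: (i @: t))%SET = t.
Proof. by apply/setP => v; rewrite inE mem_imset. Qed.

Let Kim (u : {set W}) : u \subset i @: [set: V]%SET -> (i @: (i @^-1: u))%SET = u.
Proof.
move=> /subsetP hu; apply/setP => w; apply/imsetP/idP => [[v]|wu].
  by rewrite inE => h ->.
by have /imsetP [v _ wv] := hu _ wu; exists v => //; rewrite inE -wv.
Qed.

Let f_im c (t : {set V}) : f c (i @: t)%SET = c t.
Proof. by rewrite ffunE imsetS ?subsetT // imK. Qed.

Let f_linear a x y : f (a *: x + y) = a *: f x + f y.
Proof.
apply/ffunP => u; rewrite !ffunE; case: ifP => // _; by rewrite scaler0 addr0.
Qed.

Let gfK : cancel f g.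
Proof. by move=> c; apply/ffunP => t; rewrite ffunE f_im. Qed.

Let incidence_im (t : {set V}) v : incidence k vrank (i @: t)%SET (i v) = incidence k vrank t v.
Proof.
rewrite /incidence -(card_imset [set _ in t | _]%SET i_inj); congr (_ ^+ #|pred_of_set _|).
apply/setP => w; rewrite !inE; apply/andP/imsetP => [[/imsetP [x xt ->]]|[x]].
  by rewrite i_mono => h; exists x => //; rewrite inE xt.
by rewrite inE => /andP[xt h] ->; rewrite mem_imset // i_mono.
Qed.

Let boundary_f c : boundary (f c) = f (boundary c).
Proof.
apply/ffunP => u; have [hu|hu] := boolP (u \subset i @: [set: V]%SET); last first.
  rewrite boundaryE [RHS]ffunE (negbTE hu) /set_boundary big1 // => w wu.
  rewrite ffunE ifN ?mulr0 //.
  by apply: contra hu; apply: subset_trans (subsetUr _ _).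
rewrite -(Kim hu); move: (i @^-1: u)%SET => t {u hu}; rewrite f_im !boundaryE /set_boundary.
rewrite (bigID (fun w => w \in i @: [set: V]%SET)) /= [X in _ + X]big1 ?addr0.
  rewrite big_andbC big_imset_cond /=; last by move=> ? ? _ _ /i_inj.
  apply: eq_big => [v|v /andP[_ h]]; first by rewrite inE mem_imset.
  by rewrite incidence_im -imsetU1 f_im.
move=> w /andP[wt wi]; rewrite ffunE ifN ?mulr0 //.
by apply: contra wi => /subsetP; apply; rewrite setU11.
Qed.

Let chains_f s c : chains K' s (f c) <-> chains K s c.
Proof.
split=> h t.
  rewrite -f_im => /h[/imsetP [u uK]]; rewrite card_imset // => e; split=> //.
  by rewrite -(imK t) e imK.
rewrite ffunE; case: ifPn => [ht|]; last by rewrite eqxx.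
move=> /h[tK ts]; rewrite -(Kim ht) card_imset //; split=> //.
by apply/imsetP; exists (i @^-1: t)%SET.
Qed.

Let fgK s c : chains K' s c -> f (g c) = c.
Proof.
move=> hc; apply/ffunP => u; rewrite ffunE; case: ifPn => [/Kim hu|hu].
  by rewrite ffunE hu.
apply/esym/eqP; apply: contraNT hu => /hc[/imsetP[t _ ->] _].
by rewrite imsetS ?subsetT.
Qed.

(** Extension by zero along [i] commutes with the boundary because [i] preserves the vertex order,
    hence the signs. This places two complexes inside one vertex set. *)
Lemma homology_dim_relabel s d : homology_dim k K s d <-> homology_dim k K' s d.
Proof.
have f_inj := can_inj gfK.
have f0 : f 0 = 0 by apply/ffunP => u; rewrite !ffunE; case: ifP => //; rewrite ffunE.
apply: (subquotient_dim_transfer (f := f)) => //.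
- exact: cycles_subspace.
- exact: boundaries_subspace.
- by move=> z [hz z0]; split; [apply/chains_f|rewrite boundary_f z0].
- move=> z [hz z0]; split=> [[b hb ->]|[b hb]].
    by exists (f b); [apply/chains_f|rewrite boundary_f].
  rewrite -(fgK hb) boundary_f => /f_inj ->; exists (g b) => //.
  by apply/chains_f; rewrite (fgK hb).
- move=> z [hz z0]; exists (g z).
    split; first by apply/chains_f; rewrite (fgK hz).
    by apply: f_inj; rewrite -boundary_f (fgK hz) z0 f0.
  rewrite (fgK hz) subrr; exact: subspace0 (boundaries_subspace _ _ _).
Qed.
End Relabel.

Section SumRank.
Variables V W : finType.

Let enum_sum : enum {: V + W} = map inl (enum V) ++ map inr (enum W).
Proof. by rewrite !enumT [in LHS]unlock. Qed.

Let vrank_index (T : finType) (x : T) : vrank x = index x (enum T).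
Proof.
rewrite -[X in index X _](enum_rankK x) (enum_val_nth x) index_uniq ?enum_uniq //.
by rewrite -cardE ltn_ord.
Qed.

(** The enumeration of a sum lists the left summand first, so both injections are monotone and can
    serve as relabellings. *)
Lemma vrank_inl (v : V) : vrank (inl v : V + W)%type = vrank v.
Proof.
rewrite !vrank_index enum_sum index_cat index_map; last by move=> ? ? [].
by rewrite map_f // mem_enum.
Qed.

Lemma vrank_inr (w : W) : vrank (inr w : V + W)%type = (#|V| + vrank w)%N.
Proof.
rewrite !vrank_index enum_sum index_cat index_map; last by move=> ? ? [].
rewrite size_map -cardE ifN //; by apply/mapP => -[].
Qed.
End SumRank.

(** * Covers and chains of intersections *)

Lemma homology_dim_void (k : fieldType) (V : finType) s :
  homology_dim k (set0 : {set {set V}}) s 0.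
Proof.
exists (fun _ => 0); split=> [[]//|z [hz _]].
have -> : z = 0 by apply/ffunP => t; rewrite [RHS]ffunE; apply: contraTeq isT => /hz[]; rewrite inE.
exists 0; split=> [|c _]; last by apply/rowP => -[].
rewrite big_ord0 subrr; exact: subspace0 (boundaries_subspace _ _ _).
Qed.

Lemma upper_chains_complex (d : Order.disp_t) (P : finPOrderType d) (p : P) :
  complex (upper_chains p).
Proof.
move=> t u; rewrite !inE => /andP[/forall_inP h1 /forall_inP h2] /subsetP ut.
apply/andP; split; apply/forall_inP => q qu; first exact/h1/ut.
by apply/forall_inP => r ru; apply: (forall_inP (h2 _ (ut _ qu))); apply: ut.
Qed.

Section SumSets.
Variables V W : finType.
Implicit Types s u : {set V + W}.

Definition lpart s : {set V} := (inl @^-1: s)%SET.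
Definition rpart s : {set W} := (inr @^-1: s)%SET.

Lemma lpartUl v s : lpart (inl v |: s)%SET = (v |: lpart s)%SET.
Proof. by apply/setP => x; rewrite !inE. Qed.
Lemma rpartUl v s : rpart (inl v |: s)%SET = rpart s.
Proof. by apply/setP => x; rewrite !inE. Qed.
Lemma lpartUr w s : lpart (inr w |: s)%SET = lpart s.
Proof. by apply/setP => x; rewrite !inE. Qed.
Lemma rpartUr w s : rpart (inr w |: s)%SET = (w |: rpart s)%SET.
Proof. by apply/setP => x; rewrite !inE. Qed.
Lemma lpartDl v s : lpart (s :\ inl v)%SET = (lpart s :\ v)%SET.
Proof. by apply/setP => x; rewrite !inE. Qed.
Lemma rpartDl v s : rpart (s :\ inl v)%SET = rpart s.
Proof. by apply/setP => x; rewrite !inE. Qed.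
Lemma lpartDr w s : lpart (s :\ inr w)%SET = lpart s.
Proof. by apply/setP => x; rewrite !inE. Qed.
Lemma rpartDr w s : rpart (s :\ inr w)%SET = (rpart s :\ w)%SET.
Proof. by apply/setP => x; rewrite !inE. Qed.

Definition partE := (lpartUl, rpartUl, lpartUr, rpartUr, lpartDl, rpartDl, lpartDr, rpartDr).

Lemma part_inj s u : lpart s = lpart u -> rpart s = rpart u -> s = u.
Proof.
by move=> /setP h1 /setP h2; apply/setP => -[x|x]; [have := h1 x|have := h2 x]; rewrite !inE.
Qed.

Lemma lpartS s u : s \subset u -> lpart s \subset lpart u.
Proof. exact: preimsetS. Qed.
Lemma rpartS s u : s \subset u -> rpart s \subset rpart u.
Proof. exact: preimsetS. Qed.

Lemma imset_inl_parts (K : {set {set V}}) s :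
  (s \in [set inl @: t | t : {set V} in K]%SET) =
  (lpart s \in K) && (rpart s == set0).
Proof.
apply/imsetP/andP => [[t tK ->]|[sK /eqP s0]].
  have -> : lpart (inl @: t)%SET = t.
    by apply/setP => x; rewrite inE mem_imset // => ? ? [].
  split=> //; apply/eqP/setP => x; rewrite !inE; apply/negbTE/imsetP => -[]//.
exists (lpart s) => //; apply: part_inj.
  by apply/setP => x; rewrite [RHS]inE mem_imset // => ? ? [].
by rewrite s0; apply/setP => x; rewrite !inE; apply/esym/negbTE/imsetP => -[].
Qed.

Lemma imset_inr_parts (K : {set {set W}}) s :
  (s \in [set inr @: t | t : {set W} in K]%SET) =
  (rpart s \in K) && (lpart s == set0).
Proof.
apply/imsetP/andP => [[t tK ->]|[sK /eqP s0]].
  have -> : rpart (inr @: t)%SET = t.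
    by apply/setP => x; rewrite inE mem_imset // => ? ? [].
  split=> //; apply/eqP/setP => x; rewrite !inE; apply/negbTE/imsetP => -[]//.
exists (rpart s) => //; apply: part_inj.
  by rewrite s0; apply/setP => x; rewrite !inE; apply/esym/negbTE/imsetP => -[].
by apply/setP => x; rewrite [RHS]inE mem_imset // => ? ? [].
Qed.
End SumSets.

Section Covers.
Variables (k : fieldType) (n : nat) (d : Order.disp_t) (P : finPOrderType d).
Variables (cov : pred {set 'I_n}) (Tp : P -> {set 'I_n}).
Hypotheses (cov_up : forall S F : {set 'I_n}, cov S -> S \subset F -> cov F)
  (Tp_cov : forall p, cov (Tp p))
  (Tp_le : forall p q, (p <= q)%O = (Tp q \subset Tp p))
  (cov_core : forall F, cov F -> exists2 p, Tp p \subset F &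
     forall q, Tp q \subset F -> Tp q \subset Tp p).

(** The Alexander dual, inside [T], of the complex of non-covers. *)
Definition cover_complex (T : {set 'I_n}) : {set {set 'I_n}} :=
  [set G : {set 'I_n} | (G \subset T) && cov (T :\: G)]%SET.

Lemma cover_complexP T : complex (cover_complex T).
Proof.
move=> t u; rewrite !inE => /andP[tT ct] ut; rewrite (subset_trans ut tT) /=.
by apply: cov_up ct _; apply: setDS.
Qed.

(** If [T] is a cover, its core misses some [i] in [T]. The core of any cover inside [T] lies in
    that of [T], so removing [i] from a cover leaves a cover, and [i] is the apex of a cone. Pairing
    faces through [i], the empty one included, collapses everything. *)
Lemma cover_complex_acyclic T s : (forall p, Tp p != T) ->
  homology_dim k (cover_complex T) s 0.
Proof.
move=> hT; have [cT|cT] := boolP (cov T); last first.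
  rewrite (_ : cover_complex T = set0); first exact: homology_dim_void.
  apply/setP => G; rewrite !inE; apply/negbTE; apply: contra cT => /andP[_ h].
  by apply: cov_up h _; apply: subsetDl.
have [p pT pmax] := cov_core cT.
have /properP[_ [i iT ip]] : Tp p \proper T by rewrite properEneq hT.
have covD (F : {set 'I_n}) : cov F -> F \subset T -> cov (F :\ i)%SET.
  move=> cF FT; have [q qF _] := cov_core cF.
  apply: (cov_up (Tp_cov q)); rewrite subsetD1 qF /=.
  by apply: contra ip; apply: (subsetP (pmax _ (subset_trans qF FT))).
have M := matching_collapse k (K := cover_complex T) (L := set0)
  (pivot := fun=> i) (rank := fun t => #|(t :\ i)%SET|).
apply/M.
- exact: cover_complexP.
- exact: sub0set.
- move=> t; rewrite setD0 !inE => /andP[tT ct]; split=> //.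
    rewrite subUset sub1set iT tT /= setUC setDUr.
    rewrite (_ : _ :&: _ = (T :\: t) :\ i)%SET; first by apply: covD ct (subsetDl _ _).
    by apply/setP => x; rewrite !inE; do !case: (_ \in _); rewrite ?andbF ?andbT.
  rewrite (subset_trans (subsetDl _ _) tT) /=; apply: cov_up ct _.
  by apply: setDS; apply: subsetDl.
- by move=> t _; rewrite setDDl setUid.
- move=> t u _ _ it tu; rewrite in_set0.
  have tui : t \subset (u :\ i)%SET.
    by rewrite subsetD1 it (proper_sub tu).
  rewrite (_ : t :\ i = t)%SET; last by apply/setDidPl; rewrite disjoint_sym disjoints1.
  move: tui; rewrite subEproper => /predU1P[e|h]; [left|by right; split=> //; apply: proper_card].
  rewrite e setD1K //; apply: contraT => iu; move: tu.
  by rewrite e properE subsetD1 subxx iu andbF.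
- exact: homology_dim_void.
Qed.

Section UpperChains.
Variables (p : P).
Local Notation T := (Tp p).
Local Notation V := ('I_n + P)%type.

(* The join-like complex containing both [cover_complex T] (faces without
   vertices in P) and [upper_chains p] (faces without vertices in 'I_n). *)
Let D : {set {set V}} := [set s : {set V} |
  [&& lpart s \in cover_complex T, rpart s \in upper_chains p &
      [forall q in rpart s, Tp q \subset T :\: lpart s]]]%SET.

Let D_complex : complex D.
Proof.
move=> t u; rewrite 2![_ \in D]inE => /and3P[h1 h2 /forall_inP h3] ut.
rewrite (cover_complexP h1 (lpartS ut)) (upper_chains_complex h2 (rpartS ut)).
apply/forall_inP => q qu; apply: subset_trans (setDS _ (lpartS ut)).
by apply/h3/(subsetP (rpartS ut)).
Qed.

(** Along a chain the sets [Tp q] are nested, and the largest of them is still a proper subset of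
    [T]. *)
Let chain_avoid (c : {set P}) : c \in upper_chains p -> c != set0 ->
  exists i, (i \in T) && [forall q in c, i \notin Tp q].
Proof.
rewrite inE => /andP[/forall_inP c1 /forall_inP c2] /set0Pn[q1 q1c].
case: (@arg_maxnP _ q1 (mem c) (fun q => #|Tp q|) q1c) => q0 q0c q0max.
have /subsetPn[i iT iq0] : ~~ (T \subset Tp q0) by rewrite -Tp_le lt_geF ?c1.
exists i; rewrite iT; apply/forall_inP => q qc; apply: contra iq0.
have /orP[] := forall_inP (c2 _ qc) _ q0c; rewrite Tp_le => h; last exact/subsetP.
have /eqP -> // : Tp q0 == Tp q by rewrite eqEcard h; exact: q0max.
Qed.

(** The choice depends on the right part only, so inserting or deleting the pivot does not change
    it. *)
Let pivotl (s : {set V}) : V :=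
  if [pick i | (i \in T) && [forall q in rpart s, i \notin Tp q]] is Some i
  then inl i else inr p.

Let pivotlP s : s \in D -> rpart s != set0 -> exists i,
  [/\ pivotl s = inl i, i \in T & forall q, q \in rpart s -> i \notin Tp q].
Proof.
rewrite inE => /and3P[_ h2 _] s0; rewrite /pivotl; case: pickP => [i|h].
  by move=> /andP[iT /forall_inP h]; exists i.
by have [i] := chain_avoid h2 s0; rewrite h.
Qed.

Let pivotl_rpart s u : rpart s = rpart u -> pivotl s = pivotl u.
Proof. by rewrite /pivotl => ->. Qed.

(** The pivot avoids every [Tp q] of the chain, so moving it into the left part keeps each [Tp q]
    inside the complement. *)
Let collapse_left s m :
  homology_dim k (cover_complex T) s m <-> homology_dim k D s m.
Proof.
rewrite (homology_dim_relabel k (i := inl : 'I_n -> V)); first last.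
- by move=> v w; rewrite !vrank_inl.
- by move=> ? ? [].
set L := [set _ | _ in _]%SET.
have LE t : (t \in L) = (lpart t \in cover_complex T) && (rpart t == set0).
  exact: imset_inl_parts.
have DL t : (t \in D :\: L) = (t \in D) && (rpart t != set0).
  rewrite inE LE andbC; have [|//] := boolP (t \in D).
  by rewrite inE => /and3P[-> _ _].
(* A lexicographic rank: the chain counts first, then the left part without the pivot; [n.+1]
   exceeds the size of any subset of ['I_n]. *)
have M := matching_collapse k (K := D) (L := L) (pivot := pivotl)
  (rank := fun t => (#|rpart t| * n.+1 + #|lpart (t :\ pivotl t)%SET|)%N).
apply/M.
- exact: D_complex.
- apply/subsetP => t; rewrite LE [t \in D]inE => /andP[-> /eqP ->] /=.
  apply/andP; split; last by apply/forall_inP => q; rewrite inE.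
  by rewrite inE; apply/andP; split; apply/forall_inP => q; rewrite inE.
- move=> t; rewrite DL => /andP[tD t0]; rewrite !DL.
  have [i [pt iT it]] := pivotlP tD t0; rewrite pt !partE t0 !andbT.
  split; try by rewrite -pt; apply: pivotl_rpart; rewrite pt partE.
    move: (tD); rewrite !inE !partE => /and3P[/andP[h1 _] h2 /forall_inP h3].
    have h q : q \in rpart t -> Tp q \subset T :\: (i |: lpart t)%SET.
      move=> qt; rewrite setUC setDUr subsetI h3 //=.
      by rewrite subsetD1 it // (subset_trans (h3 _ qt)) ?subsetDl.
    rewrite h2 subUset sub1set iT h1 /=; apply/andP; split; last exact/forall_inP.
    (* The complement remains a cover because it contains [Tp q] for some [q] in the nonempty right
       part. *)
    by have /set0Pn[q qt] := t0; apply: cov_up (Tp_cov q) (h q qt).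
  by apply: D_complex tD _; apply: subsetDl.
- move=> t; rewrite DL => /andP[tD t0].
  have [i [pt iT it]] := pivotlP tD t0.
  rewrite (pivotl_rpart (u := t)) pt !partE //; by rewrite setDDl setUid.
- move=> t u; rewrite DL => /andP[tD t0] uD; have [i [pt iT it]] := pivotlP tD t0.
  move=> itn tu; have [/lpartS tul /rpartS tur] := (proper_sub tu, proper_sub tu).
  have u0 : rpart u != set0 by apply: contraNneq t0 => e; rewrite -subset0 -e.
  move: tur; rewrite subEproper => /predU1P[e|lt].
    have pu : pivotl u = inl i by rewrite -pt; apply/esym/pivotl_rpart.
    rewrite pt in itn *; rewrite pu !partE e.
    have il : i \notin lpart t by rewrite inE.
    have : lpart t \subset (lpart u :\ i)%SET by rewrite subsetD1 il tul.
    rewrite subEproper => /predU1P[e'|lt]; [left|right].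
      apply: part_inj; rewrite !partE // e' setD1K //.
      apply: contraT => iu; move: tu; rewrite properE => /andP[_ /negP[]].
      suff -> : u = t by [].
      by apply: part_inj => //; rewrite e'; apply/esym/setDidPl; rewrite disjoint_sym disjoints1.
    split; first by rewrite LE negb_and u0 orbT.
    rewrite ltn_add2l; apply: proper_card.
    by rewrite (_ : lpart t :\ i = lpart t)%SET //; apply/setDidPl;
      rewrite disjoint_sym disjoints1.
  right; split; first by rewrite LE negb_and u0 orbT.
  have := proper_card lt; have := max_card (lpart (t :\ pivotl t)); rewrite card_ord => hn hc.
  apply: (@leq_trans (#|rpart t|.+1 * n.+1)%N); first by rewrite mulSn addnC ltn_add2r ltnS.
  by apply: leq_trans (leq_addr _ _); rewrite leq_mul2r hc.
Qed.

Let core_fun : exists core : {set 'I_n} -> P, forall F : {set 'I_n}, cov F ->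
  Tp (core F) \subset F /\ forall q, Tp q \subset F -> Tp q \subset Tp (core F).
Proof.
have /choice[core h] : forall F : {set 'I_n}, exists q, cov F ->
  Tp q \subset F /\ forall r, Tp r \subset F -> Tp r \subset Tp q.
  by move=> F; have [/cov_core[q h1 h2]|_] := boolP (cov F); [exists q|exists p].
by exists core.
Qed.

(** The pivot is the core of the complement of the left part. It contains every [Tp q] of the chain,
    so it lies below the whole chain; it is strictly above [p] because a nonempty left part removes
    a point of [T]. *)
Let collapse_right s m :
  homology_dim k (upper_chains p) s m <-> homology_dim k D s m.
Proof.
rewrite (homology_dim_relabel k (i := inr : P -> V)); first last.
- by move=> v w; rewrite !vrank_inr ltn_add2l.
- by move=> ? ? [].
set L := [set _ | _ in _]%SET.
have LE t : (t \in L) = (rpart t \in upper_chains p) && (lpart t == set0).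
  exact: imset_inr_parts.
have DL t : (t \in D :\: L) = (t \in D) && (lpart t != set0).
  rewrite inE LE andbC; have [|//] := boolP (t \in D).
  by rewrite [_ \in D]inE => /and3P[_ -> _].
have [core coreP] := core_fun.
pose pivot (t : {set V}) := core (T :\: lpart t)%SET.
have pivotP t : t \in D -> lpart t != set0 -> [/\ Tp (pivot t) \subset T :\: lpart t,
    (p < pivot t)%O & forall q, q \in rpart t -> (q >=< pivot t)%O].
  rewrite !inE => /and3P[/andP[tT ct] /andP[/forall_inP c1 /forall_inP c2] /forall_inP c3] t0.
  have [h1 h2] := coreP _ ct; split=> // [|q qt].
    rewrite lt_neqAle Tp_le (subset_trans h1 (subsetDl _ _)) andbT.
    apply: contraNneq t0 => e; move: h1; rewrite -/(pivot t) -e => h1.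
    rewrite -subset0; apply/subsetP => i it; have iT := subsetP tT _ it.
    by have := subsetP h1 _ iT; rewrite in_setD it.
  by rewrite /Order.comparable [X in _ || X]Tp_le h2 ?orbT // c3.
have M := matching_collapse k (K := D) (L := L) (pivot := inr \o pivot)
  (rank := fun t => (#|lpart t| * #|P|.+1 + #|rpart (t :\ inr (pivot t))%SET|)%N).
apply/M.
- exact: D_complex.
- apply/subsetP => t; rewrite LE [t \in D]inE => /andP[h /eqP ->].
  rewrite h inE sub0set setD0 Tp_cov /=; apply/forall_inP => q qt.
  by move: h; rewrite inE => /andP[/forall_inP/(_ q qt)/ltW]; rewrite Tp_le.
- move=> t; rewrite DL => /andP[tD t0]; rewrite !DL /=.
  have [pt pp pc] := pivotP t tD t0; rewrite !partE t0 !andbT.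
  split; try by rewrite /pivot !partE.
    move: (tD); rewrite ![_ \in D]inE !partE => /and3P[-> h2 /forall_inP h3] /=.
    apply/andP; split; last first.
      by apply/forall_inP => q; rewrite in_setU1 => /predU1P[->|/h3].
    move: h2; rewrite 2![_ \in upper_chains p]inE => /andP[/forall_inP c1 /forall_inP c2].
    apply/andP; split; first by apply/forall_inP => q; rewrite in_setU1 => /predU1P[->|/c1].
    apply/forall_inP => q; rewrite in_setU1 => /predU1P[->|qt]; apply/forall_inP => r;
      rewrite in_setU1 => /predU1P[->|rt].
    - exact: comparablexx.
    - by rewrite comparable_sym pc.
    - exact: pc.
    - exact: forall_inP (c2 _ qt) _ rt.
  by apply: D_complex tD _; apply: subsetDl.
- move=> t; rewrite DL => /andP[tD t0] /=; rewrite /pivot !partE.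
  by rewrite setDDl setUid.
- move=> t u; rewrite DL => /andP[tD t0] uD /= itn tu.
  have [/lpartS tul /rpartS tur] := (proper_sub tu, proper_sub tu).
  have u0 : lpart u != set0 by apply: contraNneq t0 => e; rewrite -subset0 -e.
  have uL : u \notin L by rewrite LE negb_and u0 orbT.
  move: tul; rewrite subEproper => /predU1P[e|lt].
    have pu : pivot u = pivot t by rewrite /pivot e.
    rewrite pu !partE e.
    have il : pivot t \notin rpart t by rewrite inE.
    have : rpart t \subset (rpart u :\ pivot t)%SET by rewrite subsetD1 il tur.
    rewrite subEproper => /predU1P[e'|lt]; [left|right].
      apply: part_inj; rewrite !partE // e' setD1K //.
      apply: contraT => iu; move: tu; rewrite properE => /andP[_ /negP[]].
      suff -> : u = t by [].
      by apply: part_inj => //; rewrite e'; apply/esym/setDidPl; rewrite disjoint_sym disjoints1.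
    split=> //; rewrite ltn_add2l; apply: proper_card.
    by rewrite (_ : rpart t :\ pivot t = rpart t)%SET //; apply/setDidPl;
      rewrite disjoint_sym disjoints1.
  right; split=> //.
  have := proper_card lt; have := max_card (rpart (t :\ inr (pivot t))) => hn hc.
  apply: (@leq_trans (#|lpart t|.+1 * #|P|.+1)%N); first by rewrite mulSn addnC ltn_add2r ltnS.
  by apply: leq_trans (leq_addr _ _); rewrite leq_mul2r hc.
Qed.

Lemma homology_dim_upper_chains s m :
  homology_dim k (upper_chains p) s m <-> homology_dim k (cover_complex T) s m.
Proof. by rewrite collapse_left collapse_right. Qed.
End UpperChains.
End Covers.

(** * Graded modules and injective resolutions *)

Section GradedComponents.
Variables (k : fieldType) (n : nat).
Local Notation R := {mpoly k[n]}.
Local Notation deg := 'rV[int]_n.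

Section Decomposition.
Variable A : gmod k n.
Implicit Types (x : A) (y : deg -> A) (s : seq deg) (a b : deg).

Lemma gcompN a x : gcomp a x -> gcomp a (- x).
Proof.
move=> hx; rewrite -scaleN1r -[a]add0r; apply: gcompZ hx => m.
by rewrite -mpolyC1 -mpolyCN msuppC; case: ifP => // _; rewrite inE => /eqP -> i; rewrite mnm0E mxE.
Qed.

(** Vanishing off [s] makes the family [y] unique although [s] is not. *)
Definition decomposes x y s :=
  [/\ uniq s, forall a, gcomp a (y a), forall a, a \notin s -> y a = 0
    & x = \sum_(a <- s) y a].

Lemma decomposes_sub x y s s' : uniq s' -> {subset s <= s'} ->
  decomposes x y s -> decomposes x y s'.
Proof.
move=> us' ss' [us hy y0 ->]; split=> // [a as'|].
  by apply: y0; apply: contra as' => /ss'.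
rewrite [RHS](bigID (mem s)) /= [X in _ + X]big1 ?addr0 //.
rewrite -[RHS]big_filter; apply/perm_big/uniq_perm => //.
  by rewrite filter_uniq.
by move=> a; rewrite mem_filter andb_idr // => /ss'.
Qed.

Lemma decomposes_ex x : exists y s, decomposes x y s.
Proof.
have [s [y [us hy ->]]] := gcomp_gen x.
exists (fun a => if a \in s then y a else 0), s; split=> // [a|a /negbTE -> //|].
  by case: ifP => // _; exact: gcomp0.
by rewrite big_seq [RHS]big_seq; apply: eq_bigr => a ->.
Qed.

Lemma decomposes_uniq x y s y' s' a :
  decomposes x y s -> decomposes x y' s' -> y a = y' a.
Proof.
pose t := undup (a :: s ++ s') => h h'.
have ut : uniq t by apply: undup_uniq.
have [b bs|_ hy y0 xE] := @decomposes_sub x y s t ut _ h.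
  by rewrite mem_undup inE mem_cat bs orbT.
have [b bs|_ hy' y0' xE'] := @decomposes_sub x y' s' t ut _ h'.
  by rewrite mem_undup inE mem_cat bs !orbT.
apply/eqP; rewrite -subr_eq0; apply/eqP.
apply: (@gcomp_indep _ _ A t (fun b => y b - y' b)) => //.
- by move=> b; apply: gcompD => //; apply: gcompN.
- by rewrite sumrB -xE -xE' subrr.
- by rewrite mem_undup inE eqxx.
Qed.

Definition gproj a x : A :=
  projT1 (cid (decomposes_ex x)) a.

Lemma gprojP x : exists s, decomposes x (gproj^~ x) s.
Proof. by rewrite /gproj; case: cid. Qed.

Lemma gproj_unique x y s a : decomposes x y s -> gproj a x = y a.
Proof. by have [s' h'] := gprojP x => h; apply: decomposes_uniq h' h. Qed.

Lemma gproj_comp a x : gcomp a (gproj a x).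
Proof. by have [s []] := gprojP x. Qed.

Lemma gproj_homog a b x : gcomp a x -> gproj b x = if b == a then x else 0.
Proof.
move=> hx; apply: (gproj_unique (y := fun b => if b == a then x else 0) (s := [:: a])).
split=> // [c|c|]; first by case: eqP => [->|_] //; exact: gcomp0.
  by rewrite inE => /negbTE ->.
by rewrite big_seq1 eqxx.
Qed.

Lemma gproj_pair x x' : exists s,
  decomposes x (gproj^~ x) s /\ decomposes x' (gproj^~ x') s.
Proof.
have [[s hs] [s' hs']] := (gprojP x, gprojP x').
exists (undup (s ++ s')); split.
  by apply: (decomposes_sub (undup_uniq _) _ hs) => a h; rewrite mem_undup mem_cat h.
by apply: (decomposes_sub (undup_uniq _) _ hs') => a h; rewrite mem_undup mem_cat h orbT.
Qed.

Lemma gprojD a x x' : gproj a (x + x') = gproj a x + gproj a x'.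
Proof.
have [s [[us h1 h2 h3] [_ h1' h2' h3']]] := gproj_pair x x'.
apply: (gproj_unique (y := fun a => gproj a x + gproj a x') (s := s)); split=> //.
- by move=> b; apply: gcompD.
- by move=> b bs; rewrite h2 // h2' // addr0.
- by rewrite big_split -h3 -h3'.
Qed.

Lemma gproj0 a : gproj a 0 = 0.
Proof. by rewrite (gproj_homog (a := a)) ?eqxx //; apply: gcomp0. Qed.

Lemma poly_comp_monom (c : k) (m : 'X_{1..n}) : poly_comp (mnm_deg m) (c *: 'X_[m]).
Proof. by move=> m' /msuppZ_le; rewrite msuppX inE => /eqP -> i; rewrite mxE. Qed.

Lemma gprojZ a (c : k) (m : 'X_{1..n}) x :
  gproj (mnm_deg m + a) ((c *: 'X_[m]) *: x) = (c *: 'X_[m]) *: gproj a x.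
Proof.
have [s [us h1 h2 h3]] := gprojP x.
rewrite (gproj_unique (s := [seq mnm_deg m + a | a <- s])
   (y := fun b => (c *: 'X_[m]) *: gproj (b - mnm_deg m) x)).
  by rewrite addrC addKr.
split.
- by rewrite map_inj_uniq //; apply: addrI.
- move=> b; rewrite -{1}[b](subrK (mnm_deg m)) addrC.
  by apply: gcompZ (h1 _); apply: poly_comp_monom.
- move=> b hb; rewrite h2 ?scaler0 //; apply: contra hb => hb.
  by apply/mapP; exists (b - mnm_deg m) => //; rewrite addrC subrK.
- rewrite big_map {1}h3 scaler_sumr; apply: eq_bigr => b _.
  by rewrite addrAC subrr add0r.
Qed.
End Decomposition.

Lemma gproj_map (A B : gmod k n) (f : {linear A -> B}) a x :
  graded_map f -> gproj a (f x) = f (gproj a x).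
Proof.
move=> hf; have [s [us h1 h2 h3]] := gprojP x.
apply: (gproj_unique (s := s) (y := fun a => f (gproj a x))); split=> //.
- by move=> b; apply/hf/h1.
- by move=> b /h2 ->; rewrite raddf0.
- by rewrite {1}h3 raddf_sum.
Qed.
End GradedComponents.

Section ImageModule.
Variables (k : fieldType) (n : nat) (A B : gmod k n) (h : {linear A -> B}).
Hypothesis h_graded : graded_map h.

Definition im_pred : {pred B} := fun y => `[< exists x, y = h x >].

Fact im_pred_closed : submod_closed im_pred.
Proof.
split=> [|a x y /asboolP[u ->] /asboolP[v ->]]; apply/asboolP.
  by exists 0; rewrite raddf0.
by exists (a *: u + v); rewrite linearP.
Qed.

HB.instance Definition _ := GRing.isSubmodClosed.Build _ B im_pred im_pred_closed.

Record im_type := ImType { im_val : B; _ : im_val \in im_pred }.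
HB.instance Definition _ := [isSub for im_val].
HB.instance Definition _ := [Choice of im_type by <:].
HB.instance Definition _ := [SubChoice_isSubLmodule of im_type by <:].

Definition im_comp a : set im_type := fun y => gcomp a (val y).

Fact im_comp0 a : im_comp a 0.
Proof. exact: gcomp0. Qed.
Fact im_compD a x y : im_comp a x -> im_comp a y -> im_comp a (x + y).
Proof. exact: gcompD. Qed.
Fact im_compZ a b f x : poly_comp a f -> im_comp b x -> im_comp (a + b) (f *: x).
Proof. exact: gcompZ. Qed.

Fact im_mem x : h x \in im_pred.
Proof. by apply/asboolP; exists x. Qed.
Definition to_im x : im_type := ImType (im_mem x).

Fact to_im_linear : linear to_im.
Proof. by move=> a x y; apply: val_inj; rewrite /= linearP. Qed.
HB.instance Definition _ := GRing.isLinear.Build _ _ _ _ to_im to_im_linear.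

Lemma im_surj (y : im_type) : exists x, y = to_im x.
Proof. by case: y => y /[dup] /asboolP[x ->] hy; exists x; apply: val_inj. Qed.

Fact im_comp_gen y : exists s : seq 'rV[int]_n, exists z,
  [/\ uniq s, (forall a, im_comp a (z a)) & y = \sum_(a <- s) z a].
Proof.
have [x ->] := im_surj y; have [s [z [us hz ->]]] := gcomp_gen x.
exists s, (to_im \o z); split=> // [a|]; last by rewrite raddf_sum.
exact/h_graded/hz.
Qed.

Fact im_comp_indep (s : seq 'rV[int]_n) (y : 'rV[int]_n -> im_type) :
  uniq s -> (forall a, im_comp a (y a)) -> \sum_(a <- s) y a = 0 ->
  forall a, a \in s -> y a = 0.
Proof.
move=> us hy /(congr1 val); rewrite raddf_sum /= => y0 a sa.
by apply: val_inj; apply: (gcomp_indep us hy y0 sa).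
Qed.

Definition im_gmod : gmod k n :=
  @Gmod k n im_type im_comp im_comp0 im_compD im_compZ im_comp_gen im_comp_indep.

(** [graded_injective] extends along injective maps only: [phi] first descends to the image of [h],
    a graded submodule of [B], and is then extended along the inclusion. *)
Lemma graded_extend (E : gmod k n) (phi : {linear A -> E}) :
  graded_injective E -> graded_map phi -> (forall x, h x = 0 -> phi x = 0) ->
  exists2 g : {linear B -> E}, graded_map g & forall x, g (h x) = phi x.
Proof.
move=> injE phi_graded h_phi.
have /choice[lift hlift] := im_surj.
pose psi y := phi (lift y).
have psiE x : psi (to_im x) = phi x.
  apply/eqP; rewrite -subr_eq0 -raddfB; apply/eqP/h_phi.
  rewrite raddfB /=; apply/eqP; rewrite subr_eq0; apply/eqP.
  by have := hlift (to_im x) => /(congr1 im_val) /= ->.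
have psi_lin : linear psi.
  move=> a x y; have [u ->] := im_surj x; have [v ->] := im_surj y.
  by rewrite -linearP !psiE linearP.
pose psi' : {linear im_gmod -> E} := HB.pack psi (GRing.isLinear.Build _ _ _ _ psi psi_lin).
have val_lin : linear (val : im_gmod -> B) by [].
pose val' : {linear im_gmod -> B} := HB.pack (val : im_gmod -> B)
  (GRing.isLinear.Build _ _ _ _ (val : im_gmod -> B) val_lin).
have [//|//|a y ya|g gg gE] := injE im_gmod B val' psi'.
- exact: val_inj.
- move: ya; have [x ->] := im_surj y; rewrite -[psi' _]/(psi _) psiE => ya.
  have hxa : gcomp a (h x) := ya.
  (* A preimage of a homogeneous element can be replaced by its component of that degree, the
     difference being in the kernel of [h]. *)
  have -> : phi x = phi (gproj a x); last exact/phi_graded/gproj_comp.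
  apply/eqP; rewrite -subr_eq0 -raddfB; apply/eqP/h_phi.
  by rewrite raddfB /= -gproj_map // (gproj_homog _ hxa) eqxx subrr.
by exists g => // x; rewrite -psiE -[h x]/(val' (to_im x)) gE.
Qed.
End ImageModule.

(** * Comparison of injective resolutions *)

Section Comparison.
Variables (k : fieldType) (n : nat) (M : gmod k n).
Implicit Types E : injective_resolution M.

Lemma res_diff_aug E x : res_diff E 0 (res_aug E x) = 0.
Proof. by apply/res_exact0; exists x. Qed.

Lemma res_diff_diff E t x : res_diff E t.+1 (res_diff E t x) = 0.
Proof. by apply/res_exact; exists x. Qed.

Definition chain_map E E' (f : forall t, {linear E t -> E' t}) :=
  [/\ forall t, graded_map (f t), forall x, f 0 (res_aug E x) = res_aug E' x
    & forall t x, f t.+1 (res_diff E t x) = res_diff E' t (f t x)].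

Section Lift.
Variables E E' : injective_resolution M.

(** The recursion carries a whole commuting square: commutation makes the differential after the
    second map vanish on the image of the incoming differential, which is the kernel of the outgoing
    one, and [graded_extend] applies. Successive squares share a map. *)
Let square t := {p : {linear E t -> E' t} * {linear E t.+1 -> E' t.+1} |
  [/\ graded_map p.1, graded_map p.2
    & forall x, p.2 (res_diff E t x) = res_diff E' t (p.1 x)]}.

Let square0 : {p : square 0 | forall x, (projT1 p).1 (res_aug E x) = res_aug E' x}.
Proof.
apply: cid.
have [|f0 f0_graded f0E] := graded_extend (@res_aug_graded _ _ _ E)
  (@res_obj_injective _ _ _ E' 0) (@res_aug_graded _ _ _ E').
  move=> x hx; suff -> : x = 0 by rewrite raddf0.
  by apply: (@res_aug_injective _ _ _ E); rewrite hx raddf0.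
have [||f1 f1_graded f1E] := graded_extend (@res_diff_graded _ _ _ E 0) (phi := res_diff E' 0 \o f0)
  (@res_obj_injective _ _ _ E' 1).
- by move=> a x hx; apply/res_diff_graded/f0_graded.
- by move=> y /res_exact0[x ->] /=; rewrite f0E res_diff_aug.
have h : [/\ graded_map f0, graded_map f1
    & forall x, f1 (res_diff E 0 x) = res_diff E' 0 (f0 x)] by [].
by exists (exist _ (f0, f1) h) => x; rewrite /= f0E.
Qed.

Let square_next t (p : square t) : {q : square t.+1 | (projT1 q).1 = (projT1 p).2}.
Proof.
apply: cid; case: p => -[f g] /= [f_graded g_graded fg].
have [||h h_graded hE] := graded_extend (@res_diff_graded _ _ _ E t.+1)
  (phi := res_diff E' t.+1 \o g) (@res_obj_injective _ _ _ E' t.+2).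
- by move=> a x hx; apply/res_diff_graded/g_graded.
- by move=> y /res_exact[x ->] /=; rewrite fg res_diff_diff.
by exists (exist _ (g, h) (And3 g_graded h_graded hE)).
Qed.

Let squares := fix squares t : square t :=
  if t is u.+1 then projT1 (square_next (squares u)) else projT1 square0.

Lemma chain_map_exists : exists f, @chain_map E E' f.
Proof.
exists (fun t => (projT1 (squares t)).1); split.
- by move=> t; case: (squares t) => ? [].
- exact: projT2 square0.
- move=> t x; rewrite [(projT1 (squares t.+1)).1](projT2 (square_next (squares t))).
  by case: (squares t) => ? [].
Qed.
End Lift.

Section Homotopy.
Variables (E E' : injective_resolution M) (phi : forall t, {linear E t -> E' t}).
Hypotheses (phi_graded : forall t, graded_map (phi t))
  (phi_aug : forall x, phi 0 (res_aug E x) = 0)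
  (phi_diff : forall t x, phi t.+1 (res_diff E t x) = res_diff E' t (phi t x)).

(** The recorded identity says that phi - d h vanishes on the image of d_t, so it factors through
    d_(t+1); the factor is the next component of the homotopy. *)
Let diag t := {h : {linear E t.+1 -> E' t} | graded_map h /\
  forall x, phi t.+1 (res_diff E t x) = res_diff E' t (h (res_diff E t x))}.

Let diag0 : {h : diag 0 | forall x, phi 0 x = projT1 h (res_diff E 0 x)}.
Proof.
apply: cid.
have [|h h_graded hE] := graded_extend (@res_diff_graded _ _ _ E 0)
  (@res_obj_injective _ _ _ E' 0) (@phi_graded 0).
  by move=> y /res_exact0[x ->].
have P x : phi 1 (res_diff E 0 x) = res_diff E' 0 (h (res_diff E 0 x)).
  by rewrite hE phi_diff.
by exists (exist _ h (conj h_graded P)) => x /=.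
Qed.

Let diag_next t (h : diag t) : {h' : diag t.+1 | forall x,
  phi t.+1 x = res_diff E' t (projT1 h x) + projT1 h' (res_diff E t.+1 x)}.
Proof.
apply: cid; case: h => h [/= h_graded hE].
have [||h' h'_graded h'E] := graded_extend (@res_diff_graded _ _ _ E t.+1)
  (phi := phi t.+1 \- (res_diff E' t \o h)) (@res_obj_injective _ _ _ E' t.+1).
- move=> a x xa /=; apply: gcompD; first exact: phi_graded.
  by apply: gcompN; apply/res_diff_graded/h_graded.
- by move=> y /res_exact[x ->] /=; rewrite hE subrr.
have P x : phi t.+2 (res_diff E t.+1 x) = res_diff E' t.+1 (h' (res_diff E t.+1 x)).
  by rewrite h'E /= raddfB /= res_diff_diff subr0 phi_diff.
exists (exist _ h' (conj h'_graded P)) => x /=.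
by rewrite h'E /= addrC subrK.
Qed.

Let diags := fix diags t : diag t :=
  if t is u.+1 then projT1 (diag_next (diags u)) else projT1 diag0.

Lemma null_homotopy : exists h : forall t, {linear E t.+1 -> E' t},
  (forall x, phi 0 x = h 0 (res_diff E 0 x)) /\
  forall t x, phi t.+1 x = res_diff E' t (h t x) + h t.+1 (res_diff E t.+1 x).
Proof.
exists (fun t => projT1 (diags t)); split; first exact: projT2 diag0.
by move=> t x; exact: projT2 (diag_next (diags t)) x.
Qed.
End Homotopy.

End Comparison.

(** * Torsion, restriction of scalars, independence of the resolution *)

Section Torsion.
Variables (k : fieldType) (n : nat).
Local Notation R := {mpoly k[n]}.
Implicit Types (S J : set R) (A B : lmodType R).

Lemma ideal_gen_is_ideal S : is_ideal (ideal_gen S).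
Proof.
split=> [J [[]]//|f g hf hg J hJ|a f hf J hJ]; case: (hJ) => -[_ hD hM] _.
  by apply: hD; [apply: hf|apply: hg].
by apply: hM; apply: hf.
Qed.

Lemma sub_ideal_gen S f : S f -> ideal_gen S f.
Proof. by move=> hf J [_]; apply. Qed.

Lemma ideal_gen_min S J : is_ideal J -> (S `<=` J)%classic -> (ideal_gen S `<=` J)%classic.
Proof. by move=> hJ SJ f; apply. Qed.

Lemma ideal_pow_le J i j f : (i <= j)%N -> ideal_pow J j f -> ideal_pow J i f.
Proof.
move=> /subnKC <-; apply: ideal_gen_min; first exact: ideal_gen_is_ideal.
move=> _ [g hg ->]; rewrite big_split_ord /= mulrC.
have [_ _ hM] : is_ideal (ideal_pow J i) := ideal_gen_is_ideal _.
apply: hM; apply: sub_ideal_gen.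
by exists (fun l => g (lshift (j - i) l)) => // l; exact: hg.
Qed.

Lemma torsion_map J A B (f : {linear A -> B}) x : torsion J x -> torsion J (f x).
Proof. by move=> [j hj]; exists j => g /hj; rewrite -linearZ => ->; rewrite raddf0. Qed.

Lemma torsion0 J A : torsion J (0 : A).
Proof. by exists 0 => f _; rewrite scaler0. Qed.

Lemma torsionD J A (x y : A) : torsion J x -> torsion J y -> torsion J (x + y).
Proof.
move=> [i hi] [j hj]; exists (maxn i j) => f hf; rewrite scalerDr.
rewrite hi ?hj ?addr0 //; first exact: ideal_pow_le (leq_maxr i j) hf.
exact: ideal_pow_le (leq_maxl i j) hf.
Qed.

Lemma torsionZ J A a (x : A) : torsion J x -> torsion J (a *: x).
Proof. move=> [j hj]; exists j => f /hj fx.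
by rewrite scalerA (mulrC f a) -scalerA fx scaler0. Qed.
End Torsion.

Section Restriction.
Variables (k : fieldType) (n : nat).

(** A synonym that carries the [k]-structure through constants, so that it does not compete with the
    [R]-structure. *)
Definition restrict_scalars (A : lmodType {mpoly k[n]}) : Type := A.

Section Module.
Variable A : lmodType {mpoly k[n]}.
HB.instance Definition _ := GRing.Zmodule.on (restrict_scalars A).

Definition scale_const (c : k) (x : restrict_scalars A) : restrict_scalars A :=
  c%:MP *: (x : A).

Fact scale_constA a b x : scale_const a (scale_const b x) =
  scale_const (a * b) x.
Proof. by rewrite /scale_const scalerA mpolyCM. Qed.
Fact scale_const1 : left_id 1 scale_const.
Proof. by move=> x; rewrite /scale_const mpolyC1 scale1r. Qed.
Fact scale_constDr : right_distributive scale_const +%R.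
Proof. by move=> a x y; rewrite /scale_const scalerDr. Qed.
Fact scale_constDl x : {morph scale_const^~ x : a b / a + b}.
Proof. by move=> a b; rewrite /scale_const mpolyCD scalerDl. Qed.

HB.instance Definition _ := GRing.Zmodule_isLmodule.Build k (restrict_scalars A)
  scale_constA scale_const1 scale_constDr scale_constDl.
End Module.

Lemma subquot_dimE (A : lmodType {mpoly k[n]}) (Z B : set A) d :
  subquot_dim Z B d = @subquotient_dim k (restrict_scalars A) Z B d.
Proof. by []. Qed.

Variables (M : gmod k n) (E : injective_resolution M) (I : set {mpoly k[n]}).

Lemma lc_cocycles_subspace r a :
  @subspace k (restrict_scalars (E r)) (@lc_cocycles _ _ I _ E r a).
Proof.
split; first by split; [exact: torsion0|exact: gcomp0|rewrite raddf0].
move=> c x y [tx gx dx] [ty gy dy]; split.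
- by apply: torsionD ty; apply: torsionZ.
- apply: gcompD gy; rewrite -[a]add0r; apply: gcompZ gx => m.
  by rewrite msuppC; case: ifP => // _; rewrite inE => /eqP -> i; rewrite mnm0E mxE.
- by rewrite [LHS]linearP dx dy scaler0 addr0.
Qed.

Lemma lc_coboundaries_subspace r :
  @subspace k (restrict_scalars (E r)) (@lc_coboundaries _ _ I _ E r).
Proof.
case: r => [|r]; split => /=.
- by [].
- by move=> c _ _ -> ->; rewrite scaler0 addr0.
- by exists 0; [exact: torsion0|rewrite raddf0].
- move=> c _ _ [x hx <-] [y hy <-]; exists (c%:MP *: x + y); last by rewrite linearP.
  by apply: torsionD hy; apply: torsionZ.
Qed.
End Restriction.

(** The composite of comparison maps differs from the identity by d h + h d, and [h] preserves
    torsion; on a torsion cocycle the difference is therefore the differential of a torsion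
    element. *)
Lemma local_cohomology_dim_unique (k : fieldType) (n : nat) (M : gmod k n)
    (E E' : injective_resolution M) I r a d :
  local_cohomology_dim I E r a d -> local_cohomology_dim I E' r a d.
Proof.
have [f [f_graded f_aug f_diff]] := chain_map_exists E E'.
have [g [g_graded g_aug g_diff]] := chain_map_exists E' E.
have homotopy (F F' : injective_resolution M) (u : forall t, {linear F t -> F' t})
    (v : forall t, {linear F' t -> F t}) :
  chain_map u -> chain_map v -> forall t z, torsion I z -> res_diff F t z = 0 ->
  @lc_coboundaries _ _ I _ F t (v t (u t z) - z).
  move=> [ug ua ud] [vg va vd].
  have [||t x|h [h0 hS]] := @null_homotopy _ _ _ F F (fun t => (v t \o u t) \- idfun).
  - by move=> t b x xb /=; apply: gcompD; [apply/vg/ug|apply: gcompN].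
  - by move=> x; rewrite /= ua va subrr.
  - by rewrite /= ud vd raddfB.
  case=> [|t] z zI dz /=.
    by have := h0 z; rewrite /= dz raddf0.
  by exists (h t z); [exact: torsion_map|have := hS t z; rewrite /= dz raddf0 addr0].
have coboundary_map (F F' : injective_resolution M) (u : forall t, {linear F t -> F' t}) :
  chain_map u -> forall t y, @lc_coboundaries _ _ I _ F t y ->
  @lc_coboundaries _ _ I _ F' t (u t y).
  move=> [ug ua ud] [|t] y /=; first by move->; rewrite raddf0.
  by move=> [x xI <-]; exists (u t x); [exact: torsion_map|rewrite ud].
rewrite /local_cohomology_dim !subquot_dimE.
suff H : @subquotient_dim k (restrict_scalars (E r)) (@lc_cocycles _ _ I _ E r a)
    (@lc_coboundaries _ _ I _ E r) d <->
  @subquotient_dim k (restrict_scalars (E' r)) (@lc_cocycles _ _ I _ E' r a)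
    (@lc_coboundaries _ _ I _ E' r) d.
  by move/H.
apply: (subquotient_dim_transfer (f := f r : restrict_scalars (E r) -> restrict_scalars (E' r))).
- by move=> c x y; rewrite [LHS]linearP.
- exact: lc_cocycles_subspace.
- exact: lc_coboundaries_subspace.
- move=> z [zI za dz]; split; [exact: torsion_map|exact: f_graded|].
  by rewrite -f_diff dz raddf0.
- move=> z [zI za dz]; split=> [|h]; first exact: coboundary_map.
  have := coboundary_map _ _ g _ _ _ h.
  rewrite (subspace_congr (lc_coboundaries_subspace E I r) (y := z)); first by apply.
  exact: homotopy.
- move=> z [zI za dz]; exists (g r z).
    split; [exact: torsion_map|exact: g_graded|by rewrite -g_diff dz raddf0].
  rewrite -opprB -scaleN1r; apply: subspaceZ (lc_coboundaries_subspace E' I r) _ _ _.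
  exact: homotopy.
Qed.

(** * The Cousin complex *)

Section Pairing.
Variables (k : fieldType) (n : nat).
Local Notation R := {mpoly k[n]}.
Implicit Types (w : 'X_{1..n} -> k) (f g : R) (m : 'X_{1..n}).

(** The linear form on [R] with values [w m] on monomials. A coefficient of f times a Laurent
    element is such a form, which reduces the module axioms to monomials. *)
Definition pairing w f : k := \sum_(m <- msupp f) f@_m * w m.

Lemma pairing_seq s w f : uniq s -> {subset msupp f <= s} ->
  pairing w f = \sum_(m <- s) f@_m * w m.
Proof.
move=> us fs; rewrite [RHS](bigID (mem (msupp f))) /= [X in _ + X]big1 ?addr0.
  rewrite -big_filter; apply/perm_big/uniq_perm; rewrite ?filter_uniq ?msupp_uniq //.
  by move=> m; rewrite mem_filter andb_idr // => /fs.
by move=> m /memN_msupp_eq0 ->; rewrite mul0r.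
Qed.

Fact pairing_is_linear w : linear_for *%R (pairing w).
Proof.
move=> c f g; pose s := undup (msupp (c *: f + g) ++ msupp f ++ msupp g).
have us : uniq s by apply: undup_uniq.
rewrite !(@pairing_seq s) => [|//|m h|//|m h|//|m h]; last 3 first.
- by rewrite mem_undup !mem_cat h !orbT.
- by rewrite mem_undup !mem_cat h !orbT.
- by rewrite mem_undup !mem_cat h.
rewrite mulr_sumr -big_split; apply: eq_bigr => m _ /=.
by rewrite mcoeffD mcoeffZ mulrDl mulrA.
Qed.

HB.instance Definition _ w :=
  GRing.isLinear.Build k R k *%R (pairing w) (pairing_is_linear w).

Lemma pairingX w m : pairing w 'X_[m] = w m.
Proof. by rewrite /pairing msuppX big_seq1 mcoeffX eqxx mul1r. Qed.

Lemma pairingC w c : pairing w c%:MP = c * w 0%MM.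
Proof. by rewrite -[c%:MP]alg_mpolyC linearZ /= -[1]mpolyX0 pairingX. Qed.

Lemma pairing_ext f (F G : R -> k) :
  (forall c x y, F (c *: x + y) = c * F x + F y) ->
  (forall c x y, G (c *: x + y) = c * G x + G y) ->
  (forall m, F 'X_[m] = G 'X_[m]) -> F f = G f.
Proof.
move=> hF hG FG.
have z (H : R -> k) : (forall c x y, H (c *: x + y) = c * H x + H y) -> H 0 = 0.
  by move=> hH; have := hH (-1) 0 0; rewrite scaler0 addr0 mulN1r addNr.
elim/mpolyind: f => [|c m f _ _ IH]; first by rewrite !z.
by rewrite hF hG FG IH.
Qed.

Lemma eq_pairing w w' f : w =1 w' -> pairing w f = pairing w' f.
Proof. by move=> e; apply: eq_bigr => m _; rewrite e. Qed.

Lemma pairing_comb (L : finType) (Q : pred L) (c : L -> k) (w : L -> 'X_{1..n} -> k) f :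
  pairing (fun m => \sum_(j | Q j) c j * w j m) f = \sum_(j | Q j) c j * pairing (w j) f.
Proof.
rewrite /pairing; under eq_bigr do rewrite mulr_sumr.
rewrite exchange_big /=; apply: eq_bigr => j _; rewrite mulr_sumr.
by apply: eq_bigr => m _; rewrite mulrCA.
Qed.

Lemma pairingM w f g :
  pairing w (f * g) = pairing (fun m => pairing (fun m' => w (m + m')%MM) g) f.
Proof.
apply: (@pairing_ext f (fun f => pairing w (f * g))
  (fun f => pairing (fun m => pairing (fun m' => w (m + m')%MM) g) f)).
- by move=> c x y; rewrite mulrDl -scalerAl linearP.
- by move=> c x y; rewrite linearP.
move=> m; rewrite pairingX.
apply: (@pairing_ext g (fun g => pairing w ('X_[m] * g))
  (fun g => pairing (fun m' => w (m + m')%MM) g)).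
- by move=> c x y; rewrite mulrDr -scalerAr linearP.
- by move=> c x y; rewrite linearP.
by move=> m'; rewrite -mpolyXD !pairingX.
Qed.
End Pairing.

Section Laurent.
Variables (k : fieldType) (n : nat).
Local Notation R := {mpoly k[n]}.
Local Notation deg := 'rV[int]_n.
Implicit Types (a b : deg) (G : {set 'I_n}).

(** [G] stands for the complement of F: this says that x^a occurs in the summand at F. *)
Definition neg_off a G := [forall i, (i \notin G) ==> (a 0 i < 0)%R].

Lemma neg_off_sub a G m : neg_off a G -> neg_off (a - mnm_deg m) G.
Proof.
move=> /forallP h; apply/forallP => i; apply/implyP => iG.
have := implyP (h i) iG; rewrite !mxE => ai; apply: le_lt_trans ai.
by rewrite gerBl.
Qed.

Lemma neg_offU1 a v G : neg_off a G -> neg_off a (v |: G)%SET.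
Proof.
move=> /forallP h; apply/forallP => i; apply/implyP; rewrite !inE negb_or => /andP[_ iG].
exact: (implyP (h i) iG).
Qed.

(* The coefficient of x^a in the summand of the Cousin complex at F is indexed
   by (a, G) with G = ~: F: the differential F |-> F + i becomes G |-> G - i and
   is the simplicial boundary in the variable G. *)
Definition laurent : Type := deg -> {set 'I_n} -> k.

HB.instance Definition _ := gen_eqMixin laurent.
HB.instance Definition _ := gen_choiceMixin laurent.

Definition laurent_add (u v : laurent) : laurent := fun a G => u a G + v a G.
Definition laurent_opp (u : laurent) : laurent := fun a G => - u a G.
Definition laurent_zero : laurent := fun _ _ => 0.
Lemma laurent_ext (u v : laurent) : (forall a G, u a G = v a G) -> u = v.
Proof. by move=> h; apply/funext => a; apply/funext => G. Qed.
Fact laurent_addA : associative laurent_add.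
Proof. by move=> u v w; apply: laurent_ext => a G; apply: addrA. Qed.
Fact laurent_addC : commutative laurent_add.
Proof. by move=> u v; apply: laurent_ext => a G; apply: addrC. Qed.
Fact laurent_add0 : left_id laurent_zero laurent_add.
Proof. by move=> u; apply: laurent_ext => a G; apply: add0r. Qed.
Fact laurent_addN : left_inverse laurent_zero laurent_opp laurent_add.
Proof. by move=> u; apply: laurent_ext => a G; apply: addNr. Qed.
HB.instance Definition _ := GRing.isZmodule.Build laurent
  laurent_addA laurent_addC laurent_add0 laurent_addN.

Variable t : nat.

(** The finite list of degrees makes this a direct sum, not a product, as the decomposition into
    homogeneous components requires. *)
Definition cousin_pred : {pred laurent} := fun u => `[<
  (exists s : seq deg, forall a G, u a G != 0 -> a \in s) /\
  forall a G, u a G != 0 -> neg_off a G /\ #|~: G| = t >].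

Fact cousin_pred_closed : zmod_closed cousin_pred.
Proof.
split=> [|u v /asboolP[[s hs] hu] /asboolP[[s' hs'] hv]]; apply/asboolP.
  by split=> [|a G]; [exists [::] => a G|]; rewrite eqxx.
have h a G : (u - v) a G != 0 -> u a G != 0 \/ v a G != 0.
  rewrite -[(u - v) a G]/(u a G - v a G).
  by have [->|] := eqVneq (u a G) 0; [rewrite sub0r oppr_eq0; right|left].
split; first exists (s ++ s'); move=> a G /h[]; [..|exact: hu|exact: hv].
  by move=> /hs; rewrite mem_cat => ->.
by move=> /hs'; rewrite mem_cat orbC => ->.
Qed.

HB.instance Definition _ := GRing.isZmodClosed.Build laurent cousin_pred cousin_pred_closed.

Record cousin := Cousin { cousin_val : laurent; _ : cousin_val \in cousin_pred }.
HB.instance Definition _ := [isSub for cousin_val].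
HB.instance Definition _ := [Choice of cousin by <:].
HB.instance Definition _ := [SubChoice_isSubZmodule of cousin by <:].

Definition cousin_fun (u : cousin) : deg -> {set 'I_n} -> k := cousin_val u.
Coercion cousin_fun : cousin >-> Funclass.
Arguments cousin_fun : simpl never.

Lemma cousin_ext (u v : cousin) : (forall a G, u a G = v a G) -> u = v.
Proof. by move=> h; apply: val_inj; apply: laurent_ext. Qed.

Lemma cousin_finite (u : cousin) : exists s : seq deg, forall a G, u a G != 0 -> a \in s.
Proof. by rewrite /cousin_fun; case: u => u /= /asboolP[]. Qed.

Lemma cousin_supp (u : cousin) a G : u a G != 0 -> neg_off a G /\ #|~: G| = t.
Proof. by rewrite /cousin_fun; case: u => u /= /asboolP[_ h]; apply: h. Qed.

Lemma cousin_add (u v : cousin) a G : (u + v) a G = u a G + v a G.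
Proof. by []. Qed.
Lemma cousin_opp (u : cousin) a G : (- u) a G = - u a G.
Proof. by []. Qed.
Lemma cousin_zero a G : (0 : cousin) a G = 0.
Proof. by []. Qed.
Lemma cousin_sum (I : Type) (s : seq I) (F : I -> cousin) a G :
  (\sum_(i <- s) F i) a G = \sum_(i <- s) F i a G.
Proof. by elim/big_rec2: _ => // i x y _ <-. Qed.

(* The summand at F is a quotient of the Laurent polynomials: monomials with
   a_i >= 0 for some i in F are set to 0. *)
Definition act_fun (f : R) (u : cousin) : laurent := fun a G =>
  if neg_off a G then pairing (fun m => u (a - mnm_deg m) G) f else 0.

Fact act_closed f (u : cousin) : act_fun f u \in cousin_pred.
Proof.
apply/asboolP; have [s hs] := cousin_finite u; split; last first.
  move=> a G; rewrite /act_fun; case: ifP => [da h|_]; last by rewrite eqxx.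
  split=> //; apply/eqP; apply: contraNT h => tG; apply/eqP.
  rewrite /pairing big1 // => m _; have [->|/cousin_supp[_ e]] := eqVneq (u (a - mnm_deg m) G) 0.
    by rewrite mulr0.
  by rewrite e eqxx in tG.
exists [seq a + mnm_deg m | a <- s, m <- msupp f] => a G.
rewrite /act_fun; case: ifP => [da|_]; last by rewrite eqxx.
apply: contraNT => has; rewrite /pairing big_seq big1 // => m mf.
have [->|/hs as_] := eqVneq (u (a - mnm_deg m) G) 0; first by rewrite mulr0.
case/negP: has; apply/allpairsP; exists (a - mnm_deg m, m); split=> //=.
by rewrite subrK.
Qed.

Definition act f (u : cousin) : cousin := Cousin (act_closed f u).

Lemma actE f (u : cousin) a G : act f u a G =
  if neg_off a G then pairing (fun m => u (a - mnm_deg m) G) f else 0.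
Proof. by []. Qed.

Fact actA f g u : act f (act g u) = act (f * g) u.
Proof.
apply: cousin_ext => a G; rewrite !actE; case: ifP => // da; rewrite pairingM.
(* If x^a survives the truncation, so does x^(a - m), hence the inner truncation never
   interferes. *)
apply: eq_pairing => m; rewrite actE neg_off_sub //; apply: eq_pairing => m'.
by congr (u _ G); apply/rowP => i; rewrite !mxE mnmDE PoszD opprD addrA.
Qed.

Fact act1 : left_id 1 act.
Proof.
move=> u; apply: cousin_ext => a G; rewrite actE -[1]mpolyX0 pairingX.
rewrite (_ : a - mnm_deg 0 = a); last by apply/rowP => i; rewrite !mxE mnm0E subr0.
by case: ifP => // da; apply/esym/eqP; apply: contraFT da => /cousin_supp[].
Qed.

Fact actDr : right_distributive act +%R.
Proof.
move=> f u v; apply: cousin_ext => a G; rewrite cousin_add !actE; case: ifP; rewrite ?addr0 // => _.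
by rewrite /pairing -big_split; apply: eq_bigr => m _; rewrite /= mulrDr.
Qed.

Fact actDl u : {morph act^~ u : f g / f + g}.
Proof.
move=> f g; apply: cousin_ext => a G; rewrite cousin_add !actE; case: ifP; rewrite ?addr0 // => _.
by rewrite raddfD.
Qed.

HB.instance Definition _ := GRing.Zmodule_isLmodule.Build R cousin actA act1 actDr actDl.

Lemma cousin_scale f (u : cousin) a G : (f *: u) a G =
  if neg_off a G then pairing (fun m => u (a - mnm_deg m) G) f else 0.
Proof. by []. Qed.

Lemma cousin_scaleX c m (u : cousin) a G : (c *: 'X_[m] *: u) a G =
  if neg_off a G then c * u (a - mnm_deg m) G else 0.
Proof. by rewrite cousin_scale; case: ifP => // _; rewrite linearZ /= pairingX. Qed.

Definition cousin_comp a : set cousin := fun u => forall b G, u b G != 0 -> b = a.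

Fact cousin_comp0 a : cousin_comp a 0.
Proof. by move=> b G; rewrite eqxx. Qed.

Fact cousin_compD a u v : cousin_comp a u -> cousin_comp a v -> cousin_comp a (u + v).
Proof.
move=> hu hv b G; rewrite cousin_add; have [->|/hu //] := eqVneq (u b G) 0.
by rewrite add0r => /hv.
Qed.

Fact cousin_compZ a b f u : poly_comp a f -> cousin_comp b u -> cousin_comp (a + b) (f *: u).
Proof.
move=> hf hu c G; rewrite cousin_scale; case: ifP => [_|]; last by rewrite eqxx.
apply: contraNeq => cab; rewrite /pairing big_seq big1 // => m mf.
have [->|/hu e] := eqVneq (u (c - mnm_deg m) G) 0; first by rewrite mulr0.
case/eqP: cab; rewrite -e [_ + _]addrC; apply/rowP => i.
by rewrite !mxE (hf _ mf) subrK.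
Qed.

Definition cousin_part_fun a (u : cousin) : laurent := fun b G => if b == a then u b G else 0.
Fact cousin_part_closed a (u : cousin) : cousin_part_fun a u \in cousin_pred.
Proof.
have [s hs] := cousin_finite u; apply/asboolP; split; first exists s;
  move=> b G; rewrite /cousin_part_fun; case: ifP; rewrite ?eqxx // => _.
  exact: hs.
exact: cousin_supp.
Qed.
Definition cousin_part a u : cousin := Cousin (cousin_part_closed a u).
Lemma cousin_partE a u b G : cousin_part a u b G = if b == a then u b G else 0.
Proof. by []. Qed.

Fact cousin_comp_gen (u : cousin) : exists s : seq deg, exists y,
  [/\ uniq s, (forall a, cousin_comp a (y a)) & u = \sum_(a <- s) y a].
Proof.
have [s hs] := cousin_finite u; exists (undup s), (cousin_part^~ u); split.
- exact: undup_uniq.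
- by move=> a b G; rewrite cousin_partE; case: (eqVneq b a); rewrite ?eqxx.
- apply: cousin_ext => a G; rewrite cousin_sum.
  rewrite [RHS](eq_bigr (fun b => if a == b then u a G else 0)) //.
  have [u0|/hs as_] := eqVneq (u a G) 0.
    by rewrite u0 big1 // => b _; rewrite if_same.
  rewrite (bigD1_seq a) ?undup_uniq ?mem_undup //= eqxx big1 ?addr0 // => b.
  by rewrite eq_sym => /negbTE ->.
Qed.

Fact cousin_comp_indep (s : seq deg) (y : deg -> cousin) :
  uniq s -> (forall a, cousin_comp a (y a)) -> \sum_(a <- s) y a = 0 ->
  forall a, a \in s -> y a = 0.
Proof.
move=> us hy y0 a as_; apply: cousin_ext => b G; rewrite cousin_zero.
apply/eqP; apply: contraT => h; have ba := hy a _ _ h; subst b; case/eqP: h.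
have := congr1 (fun u : cousin => u a G) y0; rewrite cousin_sum (bigD1_seq a) //= big1 ?addr0 //.
by move=> c ca; apply/eqP; apply: contraT => /hy e; rewrite e eqxx in ca.
Qed.

Definition cousin_gmod : gmod k n :=
  @Gmod k n cousin cousin_comp cousin_comp0 cousin_compD cousin_compZ
    cousin_comp_gen cousin_comp_indep.
End Laurent.

Arguments cousin_fun : simpl never.

Section BoundaryExtra.
Variables (k : fieldType) (V : finType) (rho : V -> nat).

Lemma set_boundary_neq0 (c : {set V} -> k) (t : {set V}) :
  set_boundary rho c t != 0 -> exists2 v, v \notin t & c (v |: t)%SET != 0.
Proof.
move=> h; have [v /andP[vt cv]|h0] := pickP (fun v => (v \notin t) && (c (v |: t)%SET != 0)).
  by exists v.
case/eqP: h; apply: big1 => v vt; have := h0 v; rewrite vt /= => /negbFE/eqP ->.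
by rewrite mulr0.
Qed.

Lemma eq_set_boundary (c c' : {set V} -> k) (t : {set V}) :
  (forall v, v \notin t -> c (v |: t)%SET = c' (v |: t)%SET) ->
  set_boundary rho c t = set_boundary rho c' t.
Proof. by move=> h; apply: eq_bigr => v vt; rewrite h. Qed.
End BoundaryExtra.

Section JComplex.
Variables (k : fieldType) (n : nat) (rho : 'I_n -> nat).
Hypothesis rho_inj : injective rho.
Local Notation R := {mpoly k[n]}.
Local Notation deg := 'rV[int]_n.
Implicit Types (a b : deg) (G : {set 'I_n}).

Section Differential.
Variable t : nat.

Definition cousin_diff_fun (u : cousin k n t) : laurent k n := fun a G =>
  if neg_off a G then set_boundary rho (u a) G else 0.

Fact cousin_diff_closed u : cousin_diff_fun u \in cousin_pred t.+1.
Proof.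
apply/asboolP; split.
  have [s hs] := cousin_finite u; exists s => a G; rewrite /cousin_diff_fun.
  by case: ifP => [_ /set_boundary_neq0[v _ /hs]|]; rewrite ?eqxx.
move=> a G; rewrite /cousin_diff_fun; case: ifP => [da|]; last by rewrite eqxx.
move=> /set_boundary_neq0[v vG /cousin_supp[_ <-]]; split=> //.
rewrite [LHS](cardsD1 v) inE vG add1n; congr (#|pred_of_set _|.+1).
by apply/setP => x; rewrite !inE negb_or.
Qed.

Definition cousin_diff u : cousin k n t.+1 := Cousin (cousin_diff_closed u).

Lemma cousin_diffE u a G : cousin_diff u a G = if neg_off a G then set_boundary rho (u a) G else 0.
Proof. by []. Qed.

Fact cousin_diff_linear : linear cousin_diff.
Proof.
move=> f u v; apply: cousin_ext => a G; rewrite cousin_add cousin_scale !cousin_diffE.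
case: ifP => da; last by rewrite addr0.
transitivity (set_boundary rho ((f *: u) a) G + set_boundary rho (v a) G).
  by rewrite /set_boundary -big_split; apply: eq_bigr => w _; rewrite [LHS]mulrDr.
congr (_ + _); rewrite [RHS](eq_pairing (w' := fun m =>
    \sum_(w | w \notin G) incidence k rho G w * u (a - mnm_deg m) (w |: G)%SET)).
  rewrite pairing_comb; apply: eq_bigr => w wG.
  by rewrite cousin_scale neg_offU1.
by move=> m; rewrite cousin_diffE neg_off_sub.
Qed.
HB.instance Definition _ :=
  GRing.isLinear.Build R (cousin k n t) (cousin k n t.+1) _ cousin_diff cousin_diff_linear.

Lemma cousin_diff_graded :
  graded_map (A := cousin_gmod k n t) (B := cousin_gmod k n t.+1) cousin_diff.
Proof.
move=> a u hu b G; rewrite -[cousin_fun _ b G]/(cousin_diff u b G) cousin_diffE.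
case: ifP => [_|]; last by rewrite eqxx.
by case/set_boundary_neq0 => v _ /hu.
Qed.
End Differential.

Lemma cousin_diff_diff t (u : cousin k n t) : cousin_diff (cousin_diff u) = 0.
Proof.
apply: cousin_ext => a G; rewrite cousin_diffE cousin_zero; case: ifP => // da.
rewrite -[RHS](set_boundary_boundary rho_inj (u a) G); apply: eq_set_boundary => v vG.
by rewrite cousin_diffE neg_offU1.
Qed.

Definition neg_pick a : option 'I_n := [pick i | a 0 i < 0].

(** If a_i < 0, [neg_off] does not constrain whether i belongs to [G], so coning at i stays inside
    the part of degree a and contracts it. *)
Definition cousin_cone_fun t (u : cousin k n t.+1) : laurent k n := fun a G =>
  if neg_pick a is Some i then cone rho i (u a) G else 0.

Lemma neg_off_setD1 a i G : a 0 i < 0 -> neg_off a (G :\ i)%SET = neg_off a G.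
Proof.
move=> ai; apply/forallP/forallP => h j; apply/implyP => jG.
  by apply: (implyP (h j)); rewrite inE negb_and jG orbT.
by move: jG; rewrite !inE negb_and negbK => /predU1P[->//|]; apply: (implyP (h j)).
Qed.

Fact cousin_cone_closed t (u : cousin k n t.+1) : cousin_cone_fun u \in cousin_pred t.
Proof.
have [s hs] := cousin_finite u.
have supp a G : cousin_cone_fun u a G != 0 ->
    exists i, [/\ a 0 i < 0, i \in G & u a (G :\ i)%SET != 0].
  rewrite /cousin_cone_fun /neg_pick; case: pickP => [i ai|_]; last by rewrite eqxx.
  rewrite /cone; case: ifP => [iG|_]; last by rewrite eqxx.
  rewrite mulf_eq0 negb_or => /andP[_ h]; by exists i.
apply/asboolP; split; first by exists s => a G /supp[i [_ _ /hs]].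
move=> a G /supp[i [ai iG /cousin_supp[]]]; rewrite neg_off_setD1 // => da e; split=> //.
move: e; rewrite (cardsD1 i) !inE eqxx add1n => -[<-]; congr (#|pred_of_set _|).
by apply/setP => x; rewrite !inE; case: eqVneq => [->|]; rewrite ?iG.
Qed.

Definition cousin_cone t u : cousin k n t := Cousin (cousin_cone_closed u).

Lemma cousin_exact t (u : cousin k n t.+1) :
  cousin_diff u = 0 <-> exists v : cousin k n t, u = cousin_diff v.
Proof.
split=> [du|[v ->]]; last exact: cousin_diff_diff.
exists (cousin_cone u); apply: cousin_ext => a G; rewrite cousin_diffE.
case: ifPn => [da|da]; last first.
  by apply/eqP; apply: contraNT da => /cousin_supp[].
rewrite -[cousin_fun (cousin_cone u) a]/(cousin_cone_fun u a) /cousin_cone_fun /neg_pick.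
case: pickP => [i ai|h].
  rewrite -[LHS](cone_homotopy rho_inj i) [X in _ + X](_ : _ = 0) ?addr0 //.
  rewrite /cone; case: ifP => // iG.
  have := congr1 (fun v : cousin k n t.+2 => v a (G :\ i)%SET) du.
  by rewrite cousin_diffE neg_off_setD1 // da => ->; rewrite mulr0.
rewrite [RHS]big1 => [|v _]; last by rewrite mulr0.
(* Without negative exponents F must be empty, which happens in cohomological degree 0 only. *)
apply/eqP; apply: contraT => /cousin_supp[_].
suff -> : G = [set: 'I_n]%SET by rewrite setCT cards0.
apply/setP => i; rewrite inE; apply: contraT => iG.
by have := implyP (forallP da i) iG; rewrite h.
Qed.

Definition mnm_of a : 'X_{1..n} := [multinom `|a 0%R i|%N | i < n].

Definition cousin_aug_fun (f : R) : laurent k n := fun a G =>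
  if (G == [set: 'I_n]%SET) && [forall i, 0 <= a 0 i] then f@_(mnm_of a) else 0.

Lemma mnm_ofK m : mnm_of (mnm_deg m) = m.
Proof. by apply/mnmP => i; rewrite mnmE mxE. Qed.

Lemma mnm_degK a : (forall i, 0 <= a 0 i) -> mnm_deg (mnm_of a) = a.
Proof. by move=> h; apply/rowP => i; rewrite mxE mnmE gez0_abs. Qed.

Lemma neg_offT a : neg_off a [set: 'I_n]%SET.
Proof. by apply/forallP => i; rewrite inE. Qed.

Fact cousin_aug_closed f : cousin_aug_fun f \in cousin_pred 0.
Proof.
apply/asboolP; split; first exists [seq mnm_deg m | m <- msupp f]; move=> a G;
  rewrite /cousin_aug_fun; case: ifP; rewrite ?eqxx // => /andP[/eqP GT /forallP a0].
  by rewrite -mcoeff_msupp => h; apply/mapP; exists (mnm_of a) => //; rewrite mnm_degK.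
by rewrite GT setCT cards0; split=> //; apply: neg_offT.
Qed.

Definition cousin_aug (f : R^o) : cousin k n 0 := Cousin (cousin_aug_closed f).

Lemma cousin_augE f a G : cousin_aug f a G =
  if (G == [set: 'I_n]%SET) && [forall i, 0 <= a 0 i] then f@_(mnm_of a) else 0.
Proof. by []. Qed.

Fact cousin_aug_linear : linear cousin_aug.
Proof.
move=> f g h; apply: cousin_ext => a G; rewrite cousin_add cousin_scale !cousin_augE.
have [->|GT] /= := eqVneq G [set: 'I_n]%SET; last first.
  rewrite addr0; case: ifP => // _; rewrite /pairing big1 //= => m _.
  by rewrite cousin_augE (negbTE GT) mulr0.
rewrite neg_offT; transitivity ((if [forall i, 0 <= a 0 i] then (f * g)@_(mnm_of a) else 0) +
    (if [forall i, 0 <= a 0 i] then h@_(mnm_of a) else 0)).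
  by case: ifP; rewrite ?addr0 // mcoeffD.
congr (_ + _).
apply: (@pairing_ext k n f (fun f => if [forall i, 0 <= a 0 i] then (f * g)@_(mnm_of a) else 0)
   (pairing (fun m => cousin_aug g (a - mnm_deg m) [set: 'I_n]%SET))).
- move=> c x y; case: ifP; rewrite ?mulr0 ?addr0 // => _.
  by rewrite mulrDl -scalerAl mcoeffD mcoeffZ.
- by move=> c x y; rewrite linearP.
move=> m; rewrite pairingX cousin_augE eqxx /=.
case: (boolP [forall i, 0 <= (a - mnm_deg m) 0 i]) => [/forallP am|am].
  have a0 i : 0 <= a 0 i by have := am i; rewrite !mxE subr_ge0; apply: le_trans.
  rewrite ifT; last exact/forallP.
  rewrite (_ : mnm_of a = (m + mnm_of (a - mnm_deg m))%MM) 1?mulrC ?mcoeffMX //.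
  apply: mnm_deg_inj; apply/rowP => i; rewrite [LHS]mxE mxE mnmDE !mnmE PoszD.
  by rewrite !gez0_abs // [X in _ + X]mxE [X in _ + (_ + X)]mxE mxE addrC subrK.
case: ifP => // /forallP a0; apply/eqP; apply: contraNT am; rewrite mulrC => hm.
have : mnm_of a \in msupp (g * 'X_[m]) by rewrite mcoeff_msupp.
rewrite (perm_mem (msuppMX _ _)) => /mapP[m' _ e]; apply/forallP => i.
by rewrite -(mnm_degK a0) e !mxE mnmDE PoszD addrAC subrr add0r.
Qed.
HB.instance Definition _ :=
  GRing.isLinear.Build R R^o (cousin k n 0) _ cousin_aug cousin_aug_linear.

Lemma cousin_aug_graded : graded_map (A := poly_gmod k n) (B := cousin_gmod k n 0) cousin_aug.
Proof.
move=> a f hf b G; rewrite cousin_augE; case: ifP => [|_]; last by rewrite eqxx.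
move=> /andP[_ /forallP b0]; rewrite -mcoeff_msupp => /hf h.
by apply/rowP => i; rewrite -(mnm_degK b0) mxE h.
Qed.

Lemma cousin_aug_inj : injective cousin_aug.
Proof.
move=> f g e; apply/mpolyP => m.
have := congr1 (fun u : cousin k n 0 => u (mnm_deg m) [set: 'I_n]%SET) e.
rewrite !cousin_augE eqxx /=.
have -> : [forall i, 0 <= mnm_deg m 0 i] by apply/forallP => i; rewrite mxE.
by rewrite !mnm_ofK.
Qed.

(** Degree 0 lives on F empty. A term with a_i < 0 would be visible in the differential at F = {i},
    so the cocycles are the polynomials. *)
Lemma cousin_exact0 (u : cousin k n 0) :
  cousin_diff u = 0 <-> exists f : poly_gmod k n, u = cousin_aug f.
Proof.
split=> [du|[f ->]]; last first.
  apply: cousin_ext => a G; rewrite cousin_diffE cousin_zero; case: ifP => // da.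
  apply: big1 => v vG; rewrite cousin_augE.
  case: ifP => [/andP[_ /forallP/(_ v)]|_]; last by rewrite mulr0.
  by rewrite leNgt (implyP (forallP da v) vG).
have uT a G : u a G != 0 -> G = [set: 'I_n]%SET.
  by move=> /cousin_supp[_ /cards0_eq e]; rewrite -[G]setCK e setC0.
have upos a : u a [set: 'I_n]%SET != 0 -> forall i, 0 <= a 0 i.
  move=> ua i; rewrite leNgt; apply: contra ua => ai; apply/eqP.
  have := congr1 (fun v : cousin k n 1 => v a ([set: 'I_n] :\ i)%SET) du.
  rewrite cousin_diffE neg_off_setD1 // neg_offT cousin_zero.
  rewrite /set_boundary (bigD1 i) ?inE ?eqxx //= big1 => [|v].
    rewrite addr0 setD1K ?inE // => /(congr1 ( *%R (incidence k rho ([set: 'I_n] :\ i)%SET i))).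
    by rewrite mulrA incidence_sq mul1r mulr0.
  by rewrite !inE andbT negbK => /andP[-> ].
have [s hs] := cousin_finite u.
pose ms := undup [seq mnm_of a | a <- s].
pose f : R := \sum_(m <- ms) u (mnm_deg m) [set: 'I_n]%SET *: 'X_[m].
have fE m : f@_m = u (mnm_deg m) [set: 'I_n]%SET.
  rewrite raddf_sum /= (eq_bigr (fun m' => if m' == m then u (mnm_deg m) [set: 'I_n]%SET else 0)).
    rewrite -big_mkcond; have [mms|mms] := boolP (m \in ms).
      by rewrite -big_filter filter_pred1_uniq ?undup_uniq // big_seq1.
    rewrite big_seq_cond big1 => [|m' /andP[m'ms /eqP e]]; last by rewrite -e m'ms in mms.
    apply/esym/eqP; apply: contraNT mms => /hs h; rewrite mem_undup.
    by apply/mapP; exists (mnm_deg m) => //; rewrite mnm_ofK.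
  by move=> m' _; rewrite mcoeffZ mcoeffX; case: eqP => [->|_]; rewrite ?mulr1 ?mulr0.
exists f; apply: cousin_ext => a G; rewrite cousin_augE; case: ifP => [/andP[/eqP -> /forallP a0]|].
  by rewrite fE mnm_degK.
move=> h; apply/eqP; apply: contraFT h => ua; have GT := uT _ _ ua; rewrite GT eqxx /=.
by apply/forallP/upos; rewrite -GT.
Qed.
End JComplex.

(** * Injectivity of the Cousin modules *)

Section Injectivity.
Variables (k : fieldType) (n t : nat).
Local Notation R := {mpoly k[n]}.
Local Notation deg := 'rV[int]_n.
Local Notation Ct := (cousin_gmod k n t).
Variables (A B : gmod k n) (i : {linear A -> B}) (f : {linear A -> Ct}).
Hypotheses (i_graded : graded_map i) (i_inj : injective i) (f_graded : graded_map f).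
Implicit Types (a : deg) (m : 'X_{1..n}) (c : k).

Local Notation mono c m := ((c : k) *: ('X_[m] : R)).

(** The graph of a partial extension of [f], recorded on homogeneous elements with their degree; the
    fourth clause is single-valuedness, by additivity. *)
Definition partial_map (S : set (deg * B * Ct)) := [/\
  forall a b e, S (a, b, e) -> gcomp a b /\ gcomp a e,
  forall a b e b' e', S (a, b, e) -> S (a, b', e') -> S (a, b + b', e + e'),
  forall a b e c m, S (a, b, e) -> S (mnm_deg m + a, mono c m *: b, mono c m *: e),
  forall a e, S (a, 0, e) -> e = 0
  & forall a x, gcomp a x -> S (a, i x, f x)].

Lemma partial_map0 : partial_map
  (fun p => exists x, [/\ gcomp p.1.1 x, p.1.2 = i x & p.2 = f x]).
Proof.
split=> /=.
- by move=> a b e [x [xa -> ->]]; split; [apply: i_graded|apply: f_graded].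
- move=> a b e b' e' [x [xa -> ->]] [y [ya -> ->]]; exists (x + y).
  by rewrite !raddfD; split=> //; apply: gcompD.
- move=> a b e c m [x [xa -> ->]]; exists (mono c m *: x); rewrite !linearZ.
  by split=> //; apply: gcompZ => //; apply: poly_comp_monom.
- move=> a e [x [_ ix ->]]; suff -> : x = 0 by rewrite raddf0.
  by apply: i_inj; rewrite -ix raddf0.
- by move=> a x xa; exists x.
Qed.

Lemma partial_map_max : exists S, partial_map S /\
  forall S', partial_map S' -> (S `<=` S')%classic -> (S' `<=` S)%classic.
Proof.
(* The empty chain has empty union, which is not a partial map; hence the extra alternative,
   excluded later by comparison with [partial_map0]. *)
have [|S [hS Smax]] := @Zorn_bigcup (deg * B * Ct)
    (fun S => S = @classical_sets.set0 _ \/ partial_map S).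
  move=> F Fgood Ftot; have [|F0] := pselect (exists2 S, F S & partial_map S); last first.
    left; apply/seteqP; split=> // x [S FS Sx].
    have [S0|Sp] := Fgood _ FS; first by rewrite S0 in Sx.
    by case: F0; exists S.
  move=> [S0 FS0 PS0]; right.
  have nz S x : F S -> S x -> partial_map S.
    by move=> FS Sx; have [S0'|//] := Fgood _ FS; rewrite S0' in Sx.
  split.
  - by move=> a b e [S FS Sx]; have [h _ _ _ _] := nz _ _ FS Sx; apply: h.
  - move=> a b e b' e' [S FS Sx] [S' FS' Sx'].
    have [SS'|SS'] := Ftot _ _ FS FS'.
      have [_ h _ _ _] := nz _ _ FS' Sx'; exists S' => //; apply: h => //; exact: SS'.
    have [_ h _ _ _] := nz _ _ FS Sx; exists S => //; apply: h => //; exact: SS'.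
  - move=> a b e c m [S FS Sx]; have [_ _ h _ _] := nz _ _ FS Sx.
    by exists S => //; apply: h.
  - by move=> a e [S FS Sx]; have [_ _ _ h _] := nz _ _ FS Sx; apply: h Sx.
  - by move=> a x xa; have [_ _ _ _ h] := PS0; exists S0 => //; apply: h.
have PS : partial_map S.
  case: hS => // S0; case: (Smax _ _ (or_intror partial_map0)).
  rewrite S0; split=> [x []|/(_ (0, 0, 0))] //; apply.
  exists 0; rewrite !raddf0; split=> //; exact: gcomp0.
exists S; split=> // S' PS' SS'; have [//|nSS'] := pselect (S' `<=` S)%classic.
by case: (Smax S' _ (or_intror PS')); split.
Qed.

Section Maximal.
Variable S : set (deg * B * Ct).
Hypothesis PS : partial_map S.

Let S_scale0 a b e c : S (a, b, e) -> S (a, c%:MP *: b, c%:MP *: e).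
Proof.
have [_ _ hZ _ _] := PS => /(hZ _ _ _ c 0%MM).
rewrite mpolyX0 -mul_mpolyC mulr1 (_ : mnm_deg 0 + a = a) //.
by apply/rowP => j; rewrite !mxE mnm0E add0r.
Qed.

Let S_lin a b e b' e' c : S (a, b, e) -> S (a, b', e') ->
  S (a, b + c%:MP *: b', e + c%:MP *: e').
Proof. by have [_ hD _ _ _] := PS => h h'; apply: hD => //; apply: S_scale0. Qed.

Let S_uniq a b e e' : S (a, b, e) -> S (a, b, e') -> e = e'.
Proof.
move=> h h'; have [_ _ _ h0 _] := PS; apply/eqP; rewrite -subr_eq0; apply/eqP/(h0 a).
by have := S_lin (-1) h h'; rewrite mpolyCN mpolyC1 !scaleN1r subrr.
Qed.

Let S_zero a : S (a, 0, 0).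
Proof.
have [_ _ _ _ h] := PS; rewrite -(raddf0 i) -(raddf0 f).
by apply: h; apply: gcomp0.
Qed.

Let cousin_shift (e : Ct) m a G : neg_off (mnm_deg m + a) G ->
  (('X_[m] : R) *: e : Ct) (mnm_deg m + a) G = (e : cousin k n t) a G.
Proof. by move=> da; rewrite -[X in X *: e]scale1r cousin_scaleX da mul1r addrAC subrr add0r. Qed.

Let S_monom a b e m : S (a, b, e) -> S (mnm_deg m + a, ('X_[m] : R) *: b, ('X_[m] : R) *: e).
Proof. by have [_ _ h _ _] := PS => hS; have := h _ _ _ 1 m hS; rewrite !scale1r. Qed.

Let neg_offDl a m G : neg_off (mnm_deg m + a) G -> neg_off a G.
Proof. by move=> /(neg_off_sub m); rewrite addrAC subrr add0r. Qed.

Section Extend.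
Variables (a0 : deg) (b0 : B).

Let S_coef m m' (e e' : cousin k n t) G :
  S (mnm_deg m + a0, ('X_[m] : R) *: b0, e) -> S (mnm_deg m' + a0, ('X_[m'] : R) *: b0, e') ->
  neg_off (mnm_deg m + a0) G -> neg_off (mnm_deg m' + a0) G ->
  e (mnm_deg m + a0) G = e' (mnm_deg m' + a0) G.
Proof.
move=> h h' d d'.
have degD u v : mnm_deg (u + v) = mnm_deg u + mnm_deg v :> deg.
  by apply/rowP => j; rewrite !mxE mnmDE PoszD.
pose l := mlcm m m'.
have lE : l = ((l - m) + m)%MM by rewrite submK ?lem_mlcml.
have lE' : l = ((l - m') + m')%MM by rewrite submK ?lem_mlcmr.
have := S_monom (l - m) h; have := S_monom (l - m') h'.
rewrite !addrA -!degD !scalerA -!mpolyXD -lE -lE' => hl' hl.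
(* Each exponent of the least common multiple is one of [m] or of [m'], so the coefficient at [G] is
   still visible there. *)
have dl : neg_off (mnm_deg l + a0) G.
  apply/forallP => j; apply/implyP => jG.
  have := implyP (forallP d j) jG; have := implyP (forallP d' j) jG.
  rewrite !mxE mnmE; case: (leqP (m j) (m' j)) => _; by [].
have e1 := cousin_shift e (m := (l - m)%MM) (a := mnm_deg m + a0) (G := G).
have e2 := cousin_shift e' (m := (l - m')%MM) (a := mnm_deg m' + a0) (G := G).
rewrite !addrA -!degD -lE -?lE' in e1 e2.
by rewrite -e1 // -e2 // (S_uniq hl hl').
Qed.

Let value_spec G (g : k) := forall m (e : cousin k n t),
  S (mnm_deg m + a0, ('X_[m] : R) *: b0, e) -> neg_off (mnm_deg m + a0) G ->
  e (mnm_deg m + a0) G = g.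

Let value_ex G : exists g, value_spec G g.
Proof.
have [[m [e [h d]]]|no] := pselect (exists m (e : cousin k n t),
   S (mnm_deg m + a0, ('X_[m] : R) *: b0, e) /\ neg_off (mnm_deg m + a0) G).
  by exists (e (mnm_deg m + a0) G) => m' e' h' d'; apply: S_coef.
by exists 0 => m e h d; case: no; exists m, e.
Qed.

(* Baer's criterion in one degree: the coefficient of [e0] at [G] is forced by
   any monomial multiple of [b0] in the domain on which it is visible, and two
   such multiples are compared at their least common multiple. *)
Lemma socle_value : exists2 e0 : Ct, gcomp a0 e0 &
  forall m (e : Ct), S (mnm_deg m + a0, ('X_[m] : R) *: b0, e) -> ('X_[m] : R) *: e0 = e.
Proof.
have /choice[g hg] := value_ex.
pose v : laurent k n := fun a G =>
  if [&& a == a0, neg_off a0 G & #|~: G| == t] then g G else 0.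
have vP : v \in cousin_pred t.
  apply/asboolP; split; first exists [:: a0]; move=> a G; rewrite /v;
    case: ifP; rewrite ?eqxx // => /and3P[/eqP -> d /eqP c] _ //.
  by rewrite inE.
exists (Cousin vP).
  move=> a G; rewrite -[cousin_fun _ a G]/(v a G) /v.
  by case: ifP; rewrite ?eqxx // => /and3P[/eqP ->].
move=> m e Se; apply: cousin_ext => a G; rewrite -[X in X *: _]scale1r cousin_scaleX.
rewrite -[cousin_fun (Cousin vP) _ _]/(v _ _) /v mul1r.
have [_ ec] : gcomp (mnm_deg m + a0) (('X_[m] : R) *: b0) /\ gcomp (mnm_deg m + a0) e.
  by have [h _ _ _ _] := PS; apply: h.
case: ifPn => da; last by apply/esym/eqP; apply: contraNT da => /cousin_supp[].
have [aE|na] := eqVneq a (mnm_deg m + a0); last first.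
  rewrite subr_eq [a0 + _]addrC (negbTE na) /=; apply/esym/eqP.
  by apply: contraNT na => /ec ->.
rewrite aE in da *; rewrite addrAC subrr add0r eqxx (neg_offDl da) /=.
case: eqP => [_|nt]; first by rewrite (hg G m e).
by apply/esym/eqP; apply/negP => /negP/cousin_supp[_ /nt].
Qed.

Hypothesis b0_comp : gcomp a0 b0.

(** In a given degree at most one monomial multiple of [b0] occurs, so a single term is adjoined;
    [c = 0] covers the degrees that contain none. *)
Lemma partial_map_extend : exists S', [/\ partial_map S', (S `<=` S')%classic &
  exists e0, S' (a0, b0, e0)].
Proof.
have [e0 e0_comp e0P] := socle_value.
have [hc hD hZ h0 hf] := PS.
have degD u v : mnm_deg (u + v) = mnm_deg u + mnm_deg v :> deg.
  by apply/rowP => j; rewrite !mxE mnmDE PoszD.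
exists (fun p => exists c m b1 e1, [/\ S (p.1.1, b1, e1),
  c != 0 -> p.1.1 = mnm_deg m + a0,
  p.1.2 = b1 + mono c m *: b0 & p.2 = e1 + mono c m *: e0]).
split; last first.
- exists e0, 1, 0%MM, 0, 0; rewrite /= mpolyX0 !add0r !scale1r; split=> // _.
  by apply/rowP => j; rewrite !mxE mnm0E add0r.
- move=> [[a b] e] Sp; exists 0, 0%MM, b, e; rewrite /= !scale0r !addr0; split=> //.
  by rewrite eqxx.
split=> /=.
- move=> a b e [c [m [b1 [e1 [S1 ca -> ->]]]]]; have := hc _ _ _ S1.
  have [->|/ca -> [b1c e1c]] := eqVneq c 0; first by rewrite !scale0r !addr0.
  split; first by apply: gcompD => //; apply: gcompZ => //; apply: poly_comp_monom.
  by apply: cousin_compD => //; apply: cousin_compZ => //; apply: poly_comp_monom.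
- move=> a b e b' e' [c [m [b1 [e1 [S1 ca -> ->]]]]] [c' [m' [b2 [e2 [S2 ca' -> ->]]]]].
  have S12 := hD _ _ _ _ _ S1 S2.
  have [c0|c0] := eqVneq c 0.
    exists c', m', (b1 + b2), (e1 + e2); rewrite c0 !scale0r !addr0.
    by split=> //; rewrite addrA.
  have [c'0|c'0] := eqVneq c' 0.
    exists c, m, (b1 + b2), (e1 + e2); rewrite c'0 !scale0r !addr0.
    by split=> //; rewrite addrAC.
  have mm : m = m' by apply: mnm_deg_inj; apply: (addIr a0); rewrite -(ca c0) (ca' c'0).
  exists (c + c'), m, (b1 + b2), (e1 + e2); rewrite -mm !scalerDl.
  by split=> //; [move=> _; apply: ca|rewrite addrACA|rewrite addrACA].
- move=> a b e c' m' [c [m [b1 [e1 [S1 ca -> ->]]]]].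
  exists (c' * c), (m' + m)%MM, (mono c' m' *: b1), (mono c' m' *: e1).
  have cE : mono (c' * c) (m' + m)%MM = mono c' m' * mono c m.
    by rewrite mpolyXD -scalerAl -scalerAr scalerA.
  rewrite !scalerDr !scalerA cE; split=> //; first exact: hZ.
  by rewrite mulf_eq0 negb_or => /andP[_ /ca ->]; rewrite degD addrA.
- move=> a e [c [m [b1 [e1 [S1 ca be ->]]]]].
  have [c0|c0] := eqVneq c 0.
    move: be S1; rewrite c0 !scale0r !addr0 => <-; exact: h0.
  (* If the sum vanishes, the multiple of [b0] already lies in the domain, where [e0] was chosen to
     be compatible. *)
  have {be} bE : ('X_[m] : R) *: b0 = (- c^-1)%:MP *: b1.
    have -> : b1 = - (mono c m *: b0) by apply/eqP; rewrite -addr_eq0 -be.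
    rewrite scalerN mpolyCN scaleNr opprK scalerA mul_mpolyC scalerA mulVf //.
    by rewrite scale1r.
  have := S_scale0 (- c^-1) S1; rewrite -bE (ca c0) => /e0P eE.
  have -> : mono c m *: e0 = c%:MP *: (('X_[m] : R) *: e0) by rewrite scalerA mul_mpolyC.
  rewrite eE scalerA -mpolyCM mulrN mulfV // mpolyCN mpolyC1 scaleN1r subrr //.
- move=> a x xa; exists 0, 0%MM, (i x), (f x); rewrite !scale0r !addr0; split=> //.
    exact: hf.
  by rewrite eqxx.
Qed.
End Extend.

Hypothesis S_max : forall S', partial_map S' -> (S `<=` S')%classic -> (S' `<=` S)%classic.

Let S_total a b : gcomp a b -> exists e, S (a, b, e).
Proof.
move=> ab; have [S' [PS' SS' [e0 Se]]] := partial_map_extend ab.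
by exists e0; apply: S_max Se.
Qed.

(** A maximal partial map is defined on all homogeneous elements. Only finitely many components of
    an element are nonzero, so their values add up to an element of the direct sum. *)
Lemma maximal_extension : exists2 g : {linear B -> Ct}, graded_map g & forall x, g (i x) = f x.
Proof.
have [hc hD hZ h0 hf] := PS.
have /choice[v hv] : forall p : deg * B, exists e, gcomp p.1 p.2 -> S (p.1, p.2, e).
  move=> [a b]; have [/S_total[e he]|no] := pselect (gcomp a b); first by exists e.
  by exists 0.
have vP a b : S (a, gproj a b, v (a, gproj a b)) := hv (a, _) (gproj_comp a b).
have v0 a : v (a, 0) = 0 by apply: (h0 a); apply: (hv (a, 0)); apply: gcomp0.
pose g (b : B) : laurent k n := fun a G => (v (a, gproj a b) : cousin k n t) a G.
have gP b : g b \in cousin_pred t.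
  apply/asboolP; split; last by move=> a G /cousin_supp.
  have [s [_ _ gs _]] := gprojP b; exists s => a G; rewrite /g.
  by apply: contraNT => /gs ->; rewrite v0.
pose h b : Ct := Cousin (gP b).
have hE b a G : (h b : cousin k n t) a G = (v (a, gproj a b) : cousin k n t) a G by [].
have hadd b b' : h (b + b') = h b + h b'.
  apply: cousin_ext => a G; rewrite cousin_add !hE gprojD.
  have -> : v (a, gproj a b + gproj a b') = v (a, gproj a b) + v (a, gproj a b') => //.
  apply: S_uniq (hD _ _ _ _ _ (vP a b) (vP a b')).
  by apply: (hv (a, _)); apply: gcompD; apply: gproj_comp.
have hmono c m b : h (mono c m *: b) = mono c m *: h b.
  apply: cousin_ext => a G; rewrite cousin_scaleX !hE.
  pose a' := a - mnm_deg m; have aE : a = mnm_deg m + a' by rewrite addrC subrK.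
  rewrite {1 2}aE gprojZ.
  have -> : v (mnm_deg m + a', mono c m *: gproj a' b) = mono c m *: v (a', gproj a' b).
    apply: S_uniq (hZ _ _ _ c m (vP a' b)).
    apply: (hv (_, _)); apply: gcompZ; [exact: poly_comp_monom|exact: gproj_comp].
  by rewrite cousin_scaleX.
have h_lin : linear h.
  move=> r b b'; rewrite hadd; congr (_ + _).
  elim/mpolyind: r => [|c m p _ _ IH].
    by rewrite !scale0r; apply: cousin_ext => a G; rewrite hE gproj0 v0.
  by rewrite !scalerDl hadd hmono IH.
pose h' : {linear B -> Ct} := HB.pack h (GRing.isLinear.Build _ _ _ _ h h_lin).
exists h' => [a b ab a' G|x].
  rewrite -[cousin_fun _ _ _]/((v (a', gproj a' b) : cousin k n t) a' G) (gproj_homog _ ab).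
  by case: (eqVneq a' a) => [//|_]; rewrite v0 eqxx.
apply: cousin_ext => a G; rewrite -[LHS]/((v (a, gproj a (i x)) : cousin k n t) a G).
rewrite gproj_map //.
have -> : v (a, i (gproj a x)) = f (gproj a x).
  apply: S_uniq (hf _ _ (gproj_comp a x)).
  by apply: (hv (a, _)); apply/i_graded/gproj_comp.
rewrite -gproj_map //; have [s [us sc s0 fE]] := gprojP (f x).
rewrite [in RHS]fE cousin_sum; have [as_|as_] := boolP (a \in s); last first.
  rewrite s0 // cousin_zero big_seq big1 // => b bs; apply/eqP; apply: contraT.
  by move=> /(sc b) ab; rewrite ab bs in as_.
rewrite (bigD1_seq a) //= big1 ?addr0 // => b ba.
by apply/eqP; apply: contraNT ba => /(sc b) ->.
Qed.
End Maximal.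
End Injectivity.

(** Each summand is, up to a shift, the graded injective hull of R / (x_i | i in F); the whole
    direct sum is treated at once. *)
Theorem cousin_injective (k : fieldType) (n t : nat) : graded_injective (cousin_gmod k n t).
Proof.
move=> A B i f i_graded i_inj f_graded.
have [S [PS S_max]] := partial_map_max i_graded i_inj f_graded.
exact: maximal_extension PS S_max.
Qed.

(** * Torsion in the Cousin complex *)

Section OrderIdeals.
Variables (k : fieldType) (n : nat).
Local Notation R := {mpoly k[n]}.
Implicit Types (F S : {set 'I_n}) (f g : R) (m : 'X_{1..n}).

Definition part_deg F m : nat := (\sum_(i in F) m i)%N.

Lemma part_degD F m m' : part_deg F (m + m')%MM = (part_deg F m + part_deg F m')%N.
Proof. by rewrite /part_deg -big_split; apply: eq_bigr => i _; rewrite mnmDE. Qed.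

(** The N-th power of the prime (x_i | i in F), described by monomials; [N = 1] is the prime
    itself. *)
Definition ord_ideal F N : set R :=
  fun f => forall m, m \in msupp f -> (N <= part_deg F m)%N.

Lemma ord_idealM F N N' f g :
  ord_ideal F N f -> ord_ideal F N' g -> ord_ideal F (N + N') (f * g).
Proof.
move=> hf hg m /msuppM_le /allpairsP[[m1 m2] /= [h1 h2 ->]].
by rewrite part_degD leq_add ?hf ?hg.
Qed.

Lemma ord_ideal_is_ideal F N : is_ideal (ord_ideal F N).
Proof.
split=> [m|f g hf hg m|a f hf]; first by rewrite msupp0.
  by move=> /msuppD_le; rewrite mem_cat => /orP[/hf|/hg].
by rewrite -[N]add0n; apply: ord_idealM => // m _.
Qed.

Lemma ord_ideal_pow F (I : set R) N : (I `<=` ord_ideal F 1)%classic ->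
  (ideal_pow I N `<=` ord_ideal F N)%classic.
Proof.
move=> IF; apply: ideal_gen_min; first exact: ord_ideal_is_ideal.
move=> _ [g hg ->]; elim: N g hg => [|N IH] g hg; first by move=> m _.
rewrite big_ord_recl; apply: (@ord_idealM F 1 N); first exact/IF/hg.
by apply: IH => i; apply: hg.
Qed.

Lemma ord_ideal_X F m : ord_ideal F 1 'X_[m] <-> exists2 i, i \in F & m i != 0.
Proof.
rewrite /ord_ideal; split=> [/(_ m)|[i iF mi] m'].
  rewrite msuppX inE eqxx => /(_ isT); rewrite lt0n /part_deg sum_nat_eq0.
  by case/forall_inPn => i iF mi; exists i.
by rewrite msuppX inE => /eqP ->; rewrite lt0n sum_nat_eq0; apply/forall_inPn; exists i.
Qed.

Definition covers (I : set R) F : bool := `[< (I `<=` ord_ideal F 1)%classic >].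

Lemma part_degS F S m : F \subset S -> (part_deg F m <= part_deg S m)%N.
Proof.
move=> /subsetP FS; rewrite /part_deg [leqRHS](bigID (mem F)) /=.
apply: leq_trans (leq_addr _ _); rewrite leq_eqVlt; apply/orP; left; apply/eqP.
by apply: eq_bigl => i; rewrite andb_idl // => /FS.
Qed.

Lemma ord_idealS F S N : F \subset S -> (ord_ideal F N `<=` ord_ideal S N)%classic.
Proof. by move=> FS f hf m /hf h; apply: leq_trans h (part_degS _ FS). Qed.

Lemma coversS (I : set R) F S : covers I F -> F \subset S -> covers I S.
Proof. by move=> /asboolP h FS; apply/asboolP => f /h; apply: ord_idealS. Qed.

Lemma coversPn (I : set R) F : monomial_ideal I -> ~~ covers I F ->
  exists2 m, I 'X_[m] & forall i, i \in F -> m i = 0.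
Proof.
move=> [Gs ->] /asboolP nc; apply: contrapT => no; apply: nc.
apply: ideal_gen_min; first exact: ord_ideal_is_ideal.
move=> _ [m hm <-]; apply/ord_ideal_X; apply: contrapT => no'; apply: no.
exists m; first by apply: sub_ideal_gen; exists m.
by move=> i iF; apply/eqP; apply: contrapT => /negP mi; apply: no'; exists i.
Qed.

Section Torsion.
Variables (I : set R) (I_monomial : monomial_ideal I) (t : nat).

(** If F is not a cover, some monomial of [I] avoids its variables. Its powers leave the exponents
    on F unchanged, so they move the coefficient without killing it. *)
Lemma cousin_torsion_covers (u : cousin k n t) a G : torsion I u -> u a G != 0 -> covers I (~: G).
Proof.
move=> [j hj] ua; apply: contraT => /(coversPn I_monomial)[m Im m0].
have /hj Xu : ideal_pow I j ('X_[m] ^+ j).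
  apply: sub_ideal_gen; exists (fun=> 'X_[m]) => //.
  by rewrite prodr_const card_ord.
have := congr1 (fun v : cousin k n t => v (a + mnm_deg (m *+ j)) G) Xu.
rewrite mpolyXn -[X in X *: u]scale1r cousin_scaleX cousin_zero addrK mul1r.
have [da _] := cousin_supp ua; rewrite ifT => [/eqP|]; first by rewrite (negbTE ua).
apply/forallP => i; apply/implyP => iG; rewrite !mxE mulmnE m0 ?inE // mul0n addr0.
exact: (implyP (forallP da i) iG).
Qed.

Lemma cousin_covers_torsion (u : cousin k n t) :
  (forall a G, u a G != 0 -> covers I (~: G)) -> torsion I u.
Proof.
move=> hu; have [s hs] := cousin_finite u.
pose C := (\max_(a <- s) \max_i `|a 0%R i|)%N.
have hC a i : a \in s -> (`|a 0%R i| <= C)%N.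
  move=> as_; apply: leq_trans (leq_bigmax_seq _ as_ _) => //.
  exact: (leq_bigmax i).
(* A contributing monomial m starts from a - m in the support while a is negative on F, so m_i <=
   |a_i - m_i| <= C there. Its F-degree is at most n C, too small for this power of [I]. *)
exists (n * C).+1 => f fI; apply: cousin_ext => a G; rewrite cousin_scale cousin_zero.
case: ifP => // da; rewrite /pairing big_seq big1 // => m mf.
have [->|um] := eqVneq (u (a - mnm_deg m) G) 0; first by rewrite mulr0.
have /asboolP /ord_ideal_pow/(_ _ fI m mf) := hu _ _ um.
rewrite ltnNge => /negP[]; rewrite /part_deg.
apply: (@leq_trans (\sum_(i < n) C)%N); last by rewrite sum_nat_const card_ord.
rewrite big_mkcond /=; apply: leq_sum => i _; case: ifP => // iG; rewrite inE in iG.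
apply: leq_trans (hC _ i (hs _ _ um)); rewrite !mxE.
have := implyP (forallP da i) iG; move: (a 0 i) (m i) => x y x0.
rewrite -lez_nat abszE ler0_norm; last first.
  by rewrite subr_le0 (le_trans (ltW x0)).
by rewrite opprB lerBrDr gerDl ltW.
Qed.
End Torsion.
End OrderIdeals.

Section Resolution.
Variables (k : fieldType) (n : nat) (rho : 'I_n -> nat).
Hypothesis rho_inj : injective rho.

Definition cousin_resolution : injective_resolution (poly_gmod k n) :=
  @InjectiveResolution k n (poly_gmod k n) (cousin_gmod k n)
    (@cousin_aug k n : {linear poly_gmod k n -> cousin_gmod k n 0})
    (fun t => @cousin_diff k n rho t : {linear cousin_gmod k n t -> cousin_gmod k n t.+1})
    (@cousin_injective k n) (@cousin_aug_graded k n) (@cousin_diff_graded k n rho)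
    (@cousin_aug_inj k n) (@cousin_exact0 k n rho) (@cousin_exact k n rho rho_inj).
End Resolution.

(** * Local cohomology in one degree *)

Section LocalCohomologyDegree.
Variables (k : fieldType) (n : nat) (I : set {mpoly k[n]}) (alpha : 'rV[int]_n).
Hypothesis I_monomial : monomial_ideal I.

Let T : {set 'I_n} := [set i | alpha 0 i < 0]%SET.

(* The vertices of [T] come first, so that the faces [G] of the complement
   complex and [T :&: G] carry the same signs. *)
Definition neg_first (i : 'I_n) : nat := (vrank i + (i \notin T) * n)%N.

Lemma vrank_lt (i : 'I_n) : (vrank i < n)%N.
Proof. by rewrite /vrank -[X in (_ < X)%N](card_ord n). Qed.

Lemma neg_first_inj : injective neg_first.
Proof.
move=> i j; have := vrank_lt i; have := vrank_lt j; rewrite /neg_first => hj hi e.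
apply: vrank_inj; move: e; do 2!case: (_ \in T); rewrite /= ?mul1n ?mul0n; lia.
Qed.

Let E := cousin_resolution k neg_first_inj.

(** In degree [alpha] the admissible [G] are exactly those containing [~: T], hence correspond to
    their traces on [T]. *)
Let lift (H : {set 'I_n}) := (H :|: ~: T)%SET.

Let neg_off_lift H : neg_off alpha (lift H).
Proof.
apply/forallP => i; apply/implyP; rewrite !inE negb_or negbK => /andP[_ //].
Qed.

Let liftC (H : {set 'I_n}) : (~: lift H = T :\: H)%SET.
Proof. by rewrite setCU setCK setIC setDE. Qed.

Let lift_inv G : neg_off alpha G -> lift (T :&: G)%SET = G.
Proof.
move=> /forallP d; apply/setP => i; rewrite !inE.
by have := d i; case: (i \in G); case: (alpha 0 i < 0) => //=.
Qed.

Let restrict r (y : cousin k n r) : {ffun {set 'I_n} -> k^o} :=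
  [ffun H : {set 'I_n} => if H \subset T then y alpha (lift H) else 0].

Let incidence_lift (H : {set 'I_n}) v : H \subset T -> v \in T ->
  incidence k neg_first (lift H) v = incidence k vrank H v.
Proof.
move=> HT vT; congr (_ ^+ #|pred_of_set _|); apply/setP => w.
rewrite [LHS]inE [RHS]inE /neg_first vT addn0 in_setU in_setC.
have [wT|wT] := boolP (w \in T); first by rewrite /= orbF addn0.
rewrite (contraNF (subsetP HT w) wT) /= mul1n; apply/negbTE; rewrite -leqNgt.
by apply: leq_trans (ltnW (vrank_lt v)) (leq_addl _ _).
Qed.

Let set_boundary_lift r (y : cousin k n r) (H : {set 'I_n}) : H \subset T ->
  set_boundary neg_first (y alpha) (lift H) = \sum_(v | (v \notin H) && (v \in T))
    incidence k vrank H v * restrict y (v |: H)%SET.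
Proof.
move=> HT; apply: eq_big => [v|v].
  by rewrite in_setU in_setC negb_or negbK.
rewrite in_setU in_setC negb_or negbK => /andP[vH vT].
by rewrite incidence_lift // ffunE subUset sub1set vT HT /= /lift setUA.
Qed.

Let restrict0 r : restrict (0 : cousin k n r) = 0.
Proof. by apply/ffunP => H; rewrite !ffunE cousin_zero if_same. Qed.

Let restrictB r (x y : cousin k n r) : restrict (x - y) = restrict x - restrict y.
Proof.
apply/ffunP => H; rewrite !ffunE; case: ifP => _; last by rewrite subr0.
by rewrite cousin_add cousin_opp.
Qed.

Let restrict_diff r (y : cousin k n r) :
  boundary (restrict y) = restrict (cousin_diff neg_first y).
Proof.
apply/ffunP => H; rewrite boundaryE [RHS]ffunE; case: ifPn => HT; last first.
  apply: big1 => v vH; rewrite ffunE ifN ?mulr0 //.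
  by apply: contra HT; apply: subset_trans (subsetUr _ _).
rewrite cousin_diffE neg_off_lift set_boundary_lift //.
rewrite /set_boundary [LHS](bigID (mem T)) /= [X in _ + X]big1 ?addr0 //.
move=> v /andP[vH vT]; rewrite ffunE ifN ?mulr0 //.
by apply: contra vT => /subsetP; apply; rewrite setU11.
Qed.

Let K := cover_complex (covers I) T.

Let restrict_chains r (y : cousin k n r) : torsion I y -> chains K (#|T| - r) (restrict y).
Proof.
move=> yI H; rewrite ffunE; case: ifPn => HT; last by rewrite eqxx.
move=> yH; have := cousin_torsion_covers I_monomial yI yH; have [_] := cousin_supp yH.
rewrite liftC inE HT => cH ->; split=> //.
by rewrite -cH cardsD (setIidPr HT) subKn // subset_leq_card.
Qed.

Let restrict_inj r (y : cousin k n r) : cousin_comp alpha y -> restrict y = 0 -> y = 0.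
Proof.
move=> ya y0; apply: cousin_ext => a G; rewrite cousin_zero; apply/eqP; apply: contraT => yaG.
have e := ya _ _ yaG; rewrite {}e in yaG; have [d _] := cousin_supp yaG.
have := congr1 (fun c : {ffun {set 'I_n} -> k^o} => c (T :&: G)%SET) y0.
rewrite !ffunE subsetIl lift_inv // => e.
by rewrite e eqxx in yaG.
Qed.

Let extend_fun r (c : {ffun {set 'I_n} -> k^o}) : laurent k n := fun a G =>
  if [&& a == alpha, neg_off alpha G & #|~: G| == r] then c (T :&: G)%SET else 0.

Fact extend_closed r c : extend_fun r c \in cousin_pred r.
Proof.
apply/asboolP; split; first exists [:: alpha]; move=> a G; rewrite /extend_fun;
  case: ifP; rewrite ?eqxx // => /and3P[/eqP -> d /eqP cG] _ //.
by rewrite inE.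
Qed.

Let extend r c : cousin k n r := Cousin (extend_closed r c).

Let extendE r c a G : extend r c a G =
  if [&& a == alpha, neg_off alpha G & #|~: G| == r] then c (T :&: G)%SET else 0.
Proof. by []. Qed.

Let extend_comp r c : cousin_comp alpha (extend r c).
Proof. by move=> a G; rewrite extendE; case: ifP; rewrite ?eqxx // => /and3P[/eqP]. Qed.

Let extendK r c : (r <= #|T|)%N -> chains K (#|T| - r) c -> restrict (extend r c) = c.
Proof.
move=> rT hc; apply/ffunP => H; rewrite ffunE; case: ifPn => HT; last first.
  by apply/esym/eqP; apply: contraNT HT => /hc[]; rewrite inE => /andP[].
rewrite extendE eqxx neg_off_lift liftC /= setIUr setICr setU0 (setIidPr HT).
case: ifPn => // h; apply/esym/eqP; apply: contraNT h => /hc[_ cH].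
by rewrite cardsD (setIidPr HT) cH subKn.
Qed.

Let extend_torsion r c : (r <= #|T|)%N -> chains K (#|T| - r) c -> torsion I (extend r c).
Proof.
move=> rT hc; apply: cousin_covers_torsion => a G; rewrite extendE.
case: ifP => [/and3P[_ d _]|_]; last by rewrite eqxx.
move=> /hc[]; rewrite inE => /andP[_ h] _; apply: coversS h _.
by apply/subsetP => i; rewrite !inE => /andP[h1 h2]; rewrite h2 in h1.
Qed.

(** [restrict] identifies the torsion elements of degree [alpha] with the chains on [K], with
    inverse [extend]; the bound on [r] keeps [#|T| - r] exact. *)
Lemma local_cohomology_dim_cousin r d : (r <= #|T|)%N ->
  local_cohomology_dim I E r alpha d <-> homology_dim k K (#|T| - r) d.
Proof.
move=> rT; rewrite /local_cohomology_dim subquot_dimE.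
apply: (subquotient_dim_transfer (f := @restrict r : restrict_scalars (E r) -> _)).
- move=> a x y; apply/ffunP => H; rewrite !ffunE; case: ifP => _; last by rewrite scaler0 addr0.
  rewrite -[cousin_fun _ _ _]/((a%:MP *: (x : cousin k n r) + y) alpha (lift H)) cousin_add.
  congr (_ + _); rewrite cousin_scale neg_off_lift pairingC.
  by rewrite (_ : alpha - _ = alpha) //; apply/rowP => i; rewrite !mxE mnm0E subr0.
- exact: lc_cocycles_subspace.
- exact: boundaries_subspace.
- move=> z [zI za dz]; split; first exact: restrict_chains.
  rewrite restrict_diff -[cousin_diff _ _]/(res_diff E r z) dz.
  exact: restrict0.
(* For r = 0 there are no boundaries on either side: a face inside [T] cannot have |T| + 1
   vertices. *)
- move=> z [zI za dz]; case: r rT z zI za dz => [|r] rT z zI za dz.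
    split=> [->|[b hb zb]]; first rewrite restrict0;
      first exact: subspace0 (boundaries_subspace _ _ _).
    apply: (restrict_inj za); rewrite zb.
    have -> : b = 0; last by rewrite raddf0.
    apply/ffunP => H; rewrite [RHS]ffunE; apply/eqP; apply: contraT => /hb[].
    rewrite inE => /andP[/subset_leq_card HT _] cH.
    by rewrite cH subn0 ltnn in HT.
  split=> [[y yI <-]|[b hb zb]].
    exists (restrict y); last by rewrite restrict_diff.
    by rewrite subnSK //; apply: restrict_chains.
  rewrite subnSK // in hb; exists (extend r b).
    by apply: extend_torsion => //; apply: ltnW.
  apply/eqP; rewrite -subr_eq0; apply/eqP/restrict_inj.
    apply: cousin_compD; first by apply: cousin_diff_graded; apply: extend_comp.
    exact: (gcompN za).
  by rewrite restrictB -restrict_diff extendK // 1?ltnW // zb subrr.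
- move=> z [hz z0]; exists (extend r z); last first.
    by rewrite extendK // subrr; apply: subspace0 (boundaries_subspace _ _ _).
  split; [exact: extend_torsion|exact: extend_comp|].
  apply: (restrict_inj (r := r.+1)); first by apply: cousin_diff_graded; apply: extend_comp.
  by rewrite -restrict_diff extendK.
Qed.

Lemma local_cohomology_dim_cousin_large r : (#|T| < r)%N ->
  local_cohomology_dim I E r alpha 0.
Proof.
move=> Tr; exists (fun=> 0); split=> [[]//|z [zI za dz]].
have -> : z = 0.
  apply: (restrict_inj za); apply/ffunP => H; rewrite !ffunE; case: ifP => // HT.
  apply/eqP; apply: contraT => /cousin_supp[_]; rewrite liftC => cH.
  by have := subset_leq_card (subsetDl T H); rewrite cH leqNgt Tr.
exists 0; split=> [|c _]; last by apply/rowP => -[].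
rewrite big_ord0 subrr; exact: subspace0 (lc_coboundaries_subspace _ _ _).
Qed.
End LocalCohomologyDegree.

(** * Components of a monomial arrangement *)

Section CoordinatePrimes.
Variables (k : fieldType) (n : nat).
Local Notation R := {mpoly k[n]}.
Local Notation q S := (@ord_ideal k n S 1).
Implicit Types (S T : {set 'I_n}) (f g : R) (m : 'X_{1..n}) (Q J : set R).

Lemma coord_idealX S i : q S 'X_i <-> i \in S.
Proof.
split=> [/ord_ideal_X[j jS]|iS]; last first.
  by apply/ord_ideal_X; exists i => //; rewrite mnm1E eqxx.
by rewrite mnm1E; case: (eqVneq i j) => // ->.
Qed.

Lemma ideal_sum J (I : eqType) (s : seq I) (F : I -> R) :
  is_ideal J -> (forall i, i \in s -> J (F i)) -> J (\sum_(i <- s) F i).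
Proof.
by move=> [J0 JD _] h; rewrite big_seq; apply: big_ind => // i; apply: h.
Qed.

Lemma coord_ideal_min S J : is_ideal J -> (forall i, i \in S -> J 'X_i) ->
  (q S `<=` J)%classic.
Proof.
move=> hJ JX f hf; rewrite [f]mpolyE; apply: ideal_sum => // m mf.
have [_ _ JM] := hJ; rewrite -mul_mpolyC; apply: (JM).
have : q S 'X_[m] by move=> m'; rewrite msuppX inE => /eqP ->; apply: hf.
move=> /ord_ideal_X[i iS mi].
rewrite (_ : m = (m - U_(i) + U_(i))%MM); first by rewrite mpolyXD; apply/JM/JX.
by rewrite submK //; apply/mnm_lepP => j; rewrite mnm1E; case: eqP => // <-; rewrite lt0n.
Qed.

Lemma coord_primeE (alpha : 'rV[int]_n) :
  coord_prime alpha = q [set i | alpha 0 i == -1]%SET.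
Proof.
apply/seteqP; split.
  apply: ideal_gen_min; first exact: ord_ideal_is_ideal.
  by move=> _ [i /= ai <-]; apply/coord_idealX; rewrite inE ai.
apply: coord_ideal_min; first exact: ideal_gen_is_ideal.
by move=> i; rewrite inE => /eqP ai; apply: sub_ideal_gen; exists i.
Qed.

(** Substituting 0 for the variables in [S] is an endomorphism of the domain [R] with kernel [q S],
    which makes [q S] prime. *)
Let kill S : n.-tuple R := [tuple if i \in S then 0 else 'X_i | i < n].

Let killX S m : 'X_[m] \mPo kill S = if part_deg S m == 0%N then 'X_[m] else 0.
Proof.
rewrite comp_mpolyX; case: ifPn => [|h].
  rewrite /part_deg sum_nat_eq0 => /forall_inP h; rewrite [RHS]mpolyXE_id.
  apply: eq_bigr => i _; rewrite tnth_mktuple; case: ifP => // iS.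
  by rewrite (eqP (h i iS)) !expr0.
move: h; rewrite /part_deg sum_nat_eq0 => /forall_inPn[i iS mi].
by rewrite (bigD1 i) //= tnth_mktuple iS expr0n (negbTE mi) mul0r.
Qed.

Let kill_coef S f m : part_deg S m = 0%N -> (f \mPo kill S)@_m = f@_m.
Proof.
move=> m0; rewrite comp_mpolyEX [in RHS](mpolyE f) !raddf_sum /=.
apply: eq_bigr => m' _; rewrite killX !mcoeffZ.
case: ifPn => // h; rewrite mcoeff0 mcoeffX; case: eqP => [e|_] //.
by rewrite e m0 in h.
Qed.

Let kill_eq0 S f : f \mPo kill S = 0 <-> q S f.
Proof.
split=> [f0 m mf|hf].
  rewrite lt0n; apply: contraTneq mf => m0.
  by rewrite -mcoeff_eq0 -(kill_coef f m0) f0 mcoeff0.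
rewrite comp_mpolyEX big_seq big1 // => m /hf.
by rewrite killX lt0n => /negbTE ->; rewrite scaler0.
Qed.

Lemma coord_ideal_prime S : prime_ideal (q S).
Proof.
split; first exact: ord_ideal_is_ideal.
  by move=> /(_ 0%MM); rewrite msupp1 inE eqxx /part_deg big1 => [/(_ isT)|i _] //; rewrite mnm0E.
move=> f g /kill_eq0; rewrite rmorphM /= => /eqP; rewrite mulf_eq0.
by case/orP => /eqP /kill_eq0; [left|right].
Qed.

Lemma prime_ideal_X Q m : prime_ideal Q -> Q 'X_[m] -> exists2 i, m i != 0%N & Q 'X_i.
Proof.
move=> [_ Q1 QM]; rewrite mpolyXE_id => QX.
have hprod (s : seq 'I_n) : Q (\prod_(i <- s) 'X_i ^+ m i) -> exists i, Q ('X_i ^+ m i).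
  elim: s => [|i s IH]; first by rewrite big_nil => /Q1.
  by rewrite big_cons => /QM[h|/IH//]; exists i.
have hexp i e : Q ('X_i ^+ e) -> e != 0%N /\ Q 'X_i.
  elim: e => [/Q1//|e IH]; rewrite exprS => /QM[//|/IH[_]//].
by have [i /hexp[]] := hprod _ QX; exists i.
Qed.

(** A prime containing a monomial contains one of its variables, so the variables lying in [Q] form
    a cover. *)
Lemma prime_above Q (I : set R) : monomial_ideal I -> prime_ideal Q ->
  (I `<=` Q)%classic -> exists2 S, covers I S & (q S `<=` Q)%classic.
Proof.
move=> mI pQ IQ; have [Qi _ _] := pQ.
exists [set i | `[< Q 'X_i >]]%SET; last first.
  by apply: coord_ideal_min => // i; rewrite inE => /asboolP.
apply: contraT => /(coversPn mI)[m /IQ QX m0].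
have [i mi Qi'] := prime_ideal_X pQ QX.
by case/eqP: mi; apply: m0; rewrite inE; apply/asboolP.
Qed.

Local Notation Z S := (zero_locus (q S)).

Lemma zero_locus_coordP S Q : Z S Q <-> prime_ideal Q /\ forall i, i \in S -> Q 'X_i.
Proof.
split=> -[pQ SQ]; split=> //; first by move=> i iS; apply/SQ/coord_idealX.
by apply: coord_ideal_min => //; case: pQ.
Qed.

(** Inclusion is tested at the generic point [q S]; the same point yields irreducibility and the
    vanishing ideal. *)
Lemma zero_locus_coord_sub S T : (Z S `<=` Z T)%classic <-> T \subset S.
Proof.
split=> [ST|/subsetP TS Q /zero_locus_coordP[pQ SQ]]; last first.
  by apply/zero_locus_coordP; split=> // i /TS /SQ.
have /ST[_ TS] : Z S (q S) by split=> //; exact: coord_ideal_prime.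
by apply/subsetP => i iT; apply/coord_idealX/TS/coord_idealX.
Qed.

Lemma zero_locus_coord_inj S T : Z S = Z T -> S = T.
Proof.
by move=> e; apply/eqP; rewrite eqEsubset; apply/andP; split;
  apply/zero_locus_coord_sub; rewrite e.
Qed.

Lemma irreducible_coord S : irreducible (Z S).
Proof.
have ZS : Z S (q S) by split=> //; exact: coord_ideal_prime.
split; first by exists (q S).
by move=> _ _ [J1 ->] [J2 ->] /(_ _ ZS) [[_ J]|[_ J]]; [left|right];
  move=> Q [pQ SQ]; split=> // f /J /SQ.
Qed.

Let meet (ss : seq {set 'I_n}) : set R := fun f => forall S, S \in ss -> q S f.

(** If some f in [q S] is outside [Q], then f g lies in the larger intersection for every g in
    [meet ss], and primality puts g in [Q]. *)
Let zero_locus_meet S ss : (zero_locus (meet (S :: ss)) `<=` Z S `|` zero_locus (meet ss))%classic.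
Proof.
move=> Q [pQ mQ]; have [[_ _ QM'] _ QM] := pQ.
have [SQ|/existsNP[f /not_implyP[Sf nQf]]] := pselect (q S `<=` Q)%classic; [by left|right].
split=> // g mg.
have /mQ/QM[] // : meet (S :: ss) (f * g).
move=> T; have [_ _ TM] := @ord_ideal_is_ideal k n T 1.
rewrite inE => /predU1P[TS|/mg Tg]; last exact: TM.
by rewrite mulrC; apply: TM; rewrite TS.
Qed.

Lemma irreducible_sub_coord (I : set R) (C : set (set R)) : monomial_ideal I ->
  irreducible C -> (C `<=` zero_locus I)%classic ->
  exists2 S, covers I S & (C `<=` Z S)%classic.
Proof.
move=> mI [[Q0 CQ0] Cirr] CI.
suff key ss : (C `<=` zero_locus (meet ss))%classic -> exists2 S, S \in ss & (C `<=` Z S)%classic.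
  have [|S] := key (enum (covers I)); last by rewrite mem_enum; exists S.
  move=> Q /CI[pQ IQ]; split=> // f mf.
  by have [S cS SQ] := prime_above mI pQ IQ; apply/SQ/mf; rewrite mem_enum.
(* The empty intersection is the whole ring, whose locus is empty, whereas [C] is not. *)
elim: ss => [/(_ _ CQ0)[[_ Q1 _] h]|S ss IH h]; first by case: Q1; apply: h.
have [||h1|/IH[T Tss CT]] := Cirr (Z S) (zero_locus (meet ss)) _ _
  (fun Q CQ => zero_locus_meet (h Q CQ)).
- by exists (q S).
- by exists (meet ss).
- by exists S => //; rewrite inE eqxx.
- by exists T => //; rewrite inE Tss orbT.
Qed.

Definition min_cover (I : set R) S := minset (covers I) S.

Lemma irreducible_component_coord (I : set R) C : monomial_ideal I ->
  irreducible_component (zero_locus I) C <-> exists2 S, min_cover I S & C = Z S.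
Proof.
move=> mI.
have Zsub S : covers I S -> (Z S `<=` zero_locus I)%classic.
  by move=> /asboolP IS Q [pQ SQ]; split=> // f /IS /SQ.
split=> [[CI Cirr Cmax]|[S /minsetP[cS Smin] ->]].
  have [S cS CS] := irreducible_sub_coord mI Cirr CI.
  have [T mT TS] := minset_exists cS; exists T => //.
  have [cT _] := minsetP mT.
  apply/esym/Cmax; [exact: irreducible_coord|exact: Zsub|].
  by apply: classical_sets.subset_trans CS _; apply/zero_locus_coord_sub.
split; [exact: Zsub|exact: irreducible_coord|].
move=> C' C'irr C'I SC'; apply/seteqP; split=> //.
have [T cT C'T] := irreducible_sub_coord mI C'irr C'I.
have TS : T \subset S by apply/zero_locus_coord_sub; apply: classical_sets.subset_trans SC' C'T.
by rewrite -(Smin T cT TS).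
Qed.

Lemma component_intersection_coord (I : set R) Y : monomial_ideal I ->
  component_intersection (zero_locus I) Y <->
  exists fam : {set {set 'I_n}}, [/\ fam != set0%SET,
    forall S, S \in fam -> min_cover I S & Y = Z (\bigcup_(S in fam) S)%SET].
Proof.
move=> mI; split=> [[F [[C0 FC0] FI YE]]|[fam [/set0Pn[S0 S0fam] famI ->]]].
  pose fam := [set S | min_cover I S && `[< F (Z S) >]]%SET.
  have famP S : S \in fam <-> min_cover I S /\ F (Z S).
    by rewrite inE; split=> [/andP[h /asboolP]|[-> h]] //; apply/asboolP.
  have FE C : F C -> exists2 S, S \in fam & C = Z S.
    move=> FC; have [S mS CE] := (irreducible_component_coord C mI).1 (FI _ FC).
    by exists S => //; apply/famP; rewrite -CE.
  exists fam; split.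
  - by have [S Sfam _] := FE _ FC0; apply/set0Pn; exists S.
  - by move=> S /famP[].
  rewrite YE; apply/seteqP; split=> Q.
    move=> QF; apply/zero_locus_coordP; split.
      by have [S _ SE] := FE _ FC0; have := QF _ FC0; rewrite SE => -[].
    by move=> i /bigcupP[S /famP[_ /QF/zero_locus_coordP[_ h]] /h].
  move=> /zero_locus_coordP[pQ hQ] C /FE[S Sfam ->]; apply/zero_locus_coordP.
  by split=> // i iS; apply: hQ; apply/bigcupP; exists S.
exists (fun C => exists2 S, S \in fam & C = Z S); split.
- by exists (Z S0), S0.
- move=> C [S Sfam ->]; apply/irreducible_component_coord => //.
  by exists S => //; apply: famI.
apply/seteqP; split=> Q.
  move=> /zero_locus_coordP[pQ hQ] C [S Sfam ->]; apply/zero_locus_coordP.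
  by split=> // i iS; apply: hQ; apply/bigcupP; exists S.
move=> QF; have QZ S : S \in fam -> Z S Q by move=> Sfam; apply: QF; exists S.
apply/zero_locus_coordP; split; first by case: (QZ _ S0fam).
by move=> i /bigcupP[S /QZ/zero_locus_coordP[_ h] /h].
Qed.

Lemma vanishing_ideal_coord S : vanishing_ideal (Z S) = q S.
Proof.
apply/seteqP; split=> f; last by move=> fS Q [_]; apply.
by apply; split=> //; apply: coord_ideal_prime.
Qed.
End CoordinatePrimes.

(** * Heights of coordinate primes *)

Section Dependence.
Variables (k : fieldType) (n h : nat) (S : {set 'I_n}) (f : 'I_h -> {mpoly k[n]}).
Local Notation R := {mpoly k[n]}.

Definition free_of (g : R) := forall m, m \in msupp g -> part_deg S m = 0%N.

Let expo_le N (g : R) := forall m, m \in msupp g -> forall i, (m i <= N)%N.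

Let expo_leM N N' g g' : expo_le N g -> expo_le N' g' -> expo_le (N + N') (g * g').
Proof.
move=> hg hg' m /msuppM_le /allpairsP[[m1 m2] /= [h1 h2 ->]] i.
by rewrite mnmDE leq_add ?hg ?hg'.
Qed.

Let expo_le_prod (J : finType) (N : J -> nat) (g : J -> R) :
  (forall j, expo_le (N j) (g j)) -> expo_le (\sum_j N j) (\prod_j g j).
Proof.
move=> hg; apply: (big_rec2 (fun (N : nat) g => expo_le N g)) => [m|j N' g' _ h'].
  by rewrite msupp1 inE => /eqP -> i; rewrite mnm0E.
exact: expo_leM.
Qed.

Let expo_leX N g e : expo_le N g -> expo_le (N * e) (g ^+ e).
Proof.
move=> hg; have := expo_le_prod (J := 'I_e) (N := fun=> N) (g := fun=> g) (fun=> hg).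
by rewrite sum_nat_const prodr_const card_ord mulnC.
Qed.

Let expo_le_ex g : exists N, expo_le N g.
Proof.
exists (msize g) => m mg i; apply: leq_trans (ltnW (msize_mdeg_lt mg)).
by rewrite mdegE (bigD1 i) //= leq_addr.
Qed.

(* There are more products of powers < d of the [f i] and of the variables
   outside [S] than monomials that can occur in them, for d large. *)
Lemma algebraic_dependence : (#|S| < h)%N ->
  exists F : {mpoly R[h]}, [/\ F != 0, forall m, free_of F@_m & F.@[f] = 0].
Proof.
move=> Sh.
have [D hD] : exists D, forall i, expo_le D (f i).
  have /choice[N hN] := fun i => expo_le_ex (f i).
  by exists (\max_i N i)%N => i m mf j; apply: leq_trans (hN i m mf j) (leq_bigmax i).
(* All products have exponents at most d + h D d = d C, so at most (d C + 1)^n <= (d + 1)^n C^n = (d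
   + 1)^n d monomials occur, fewer than the (d + 1)^(h + n - |S|) products, as h > |S|. *)
pose C := (h * D).+1; pose d := (C ^ n)%N.
pose A : finType := ({ffun 'I_h -> 'I_d.+1} * {ffun {i : 'I_n | i \notin S} -> 'I_d.+1})%type.
pose B : finType := {ffun 'I_n -> 'I_(d * C).+1}.
have cAB : (#|B| < #|A|)%N.
  rewrite card_prod !card_ffun !card_ord card_sig.
  have -> : #|[pred i | i \notin S]| = (n - #|S|)%N.
    have -> : #|[pred i | i \notin S]| = #|~: S| by apply: eq_card => i; rewrite !inE.
    by have := cardsC S; rewrite card_ord; lia.
  rewrite -expnD; apply: (@leq_trans (d.+1 ^ n.+1)%N); last first.
    have hS := max_card (mem S); rewrite card_ord in hS.
    by apply: leq_pexp2l => //; lia.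
  apply: (@leq_ltn_trans ((d.+1 * C) ^ n)%N).
    have hC : ((d * C).+1 <= d.+1 * C)%N by rewrite mulSn -addn1 addnC leq_add2r.
    by case: (posnP n) => [->//|n0]; rewrite leq_exp2r.
  by rewrite expnMn expnS mulnC ltn_pmul2r ?expn_gt0 // -/d.
pose xm (b : {ffun {i : 'I_n | i \notin S} -> 'I_d.+1}) : 'X_{1..n} :=
  [multinom (if insub i is Some j then b j : nat else 0%N) | i < n].
pose ym (a : {ffun 'I_h -> 'I_d.+1}) : 'X_{1..h} := [multinom (a i : nat) | i < h].
pose pAB (ab : A) : R := 'X_[xm ab.2] * \prod_i f i ^+ ab.1 i.
have expoP ab : expo_le (d * C) (pAB ab).
  have -> : (d * C = d + \sum_(i < h) D * d)%N.
    by rewrite sum_nat_const card_ord /C mulnS; congr (_ + _)%N; rewrite mulnC mulnA.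
  apply: expo_leM => [m|].
    rewrite msuppX inE => /eqP -> i; rewrite mnmE; case: insubP => // j _ _.
    by rewrite -ltnS.
  apply: expo_le_prod => i m /(expo_leX (hD i)) hm j; apply: leq_trans (hm j) _.
  by rewrite leq_mul2l -ltnS ltn_ord orbT.
pose bm (b : B) : 'X_{1..n} := [multinom (b i : nat) | i < n].
pose M : 'M[k]_(#|A|, #|B|) := \matrix_(i, j) (pAB (enum_val i))@_(bm (enum_val j)).
have [v v0 vM] : exists2 v : 'rV_#|A|, v != 0 & v *m M = 0.
  have : kermx M != 0.
    rewrite kermx_eq0 /row_free; apply/eqP => e.
    by have := rank_leq_col M; rewrite e leqNgt cAB.
  by case/rowV0Pn => v /sub_kermxP vM v0; exists v.
have sum0 : \sum_(ab : A) v 0 (enum_rank ab) *: pAB ab = 0.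
  apply/mpolyP => m; rewrite mcoeff0 raddf_sum /=.
  have [hm|/forallPn[i hi]] := boolP [forall i, (m i < (d * C).+1)%N]; last first.
    apply: big1 => ab _; rewrite mcoeffZ memN_msupp_eq0 ?mulr0 //.
    by apply: contra hi => /expoP; rewrite ltnS.
  pose b : B := [ffun i => inord (m i)].
  have bE : bm b = m by apply/mnmP => i; rewrite mnmE ffunE inordK // (forallP hm).
  have := congr1 (fun w : 'rV_#|B| => w 0 (enum_rank b)) vM; rewrite !mxE => e.
  rewrite -[RHS]e (reindex (@enum_val _ A)) /=; last first.
    by exists enum_rank => x _; [apply: enum_valK|apply: enum_rankK].
  by apply: eq_bigr => i _; rewrite mcoeffZ !mxE enum_valK enum_rankK bE.
pose F : {mpoly R[h]} := \sum_(ab : A) (v 0 (enum_rank ab) *: 'X_[xm ab.2]) *: 'X_[ym ab.1].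
have FE m : F@_m = \sum_(ab : A | ym ab.1 == m) v 0 (enum_rank ab) *: 'X_[xm ab.2].
  rewrite raddf_sum /= [RHS]big_mkcond; apply: eq_bigr => ab _.
  by rewrite mcoeffZ mcoeffX; case: eqP; rewrite ?mulr1 ?mulr0.
exists F; split.
(* Distinct pairs of exponents give distinct monomials, so each entry of [v] is a coefficient of
   [F]. *)
- have /rV0Pn[i vi] := v0; pose ab0 := enum_val i.
  apply/eqP => F0; case/eqP: vi.
  have := congr1 (fun G : {mpoly R[h]} => (G@_(ym ab0.1))@_(xm ab0.2)) F0.
  rewrite !mcoeff0 FE raddf_sum /= (bigD1 ab0) //= mcoeffZ mcoeffX eqxx mulr1 enum_valK.
  rewrite big1 ?addr0 // => ab /andP[/eqP e1 ne]; rewrite mcoeffZ mcoeffX.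
  case: eqP => [e2|]; last by rewrite mulr0.
  case/eqP: ne; rewrite [ab]surjective_pairing [ab0]surjective_pairing; congr (_, _).
    by apply/ffunP => j; apply: val_inj; have /mnmP/(_ j) := e1; rewrite !mnmE.
  apply/ffunP => j; apply: val_inj; have /mnmP/(_ (val j)) := e2.
  by rewrite !mnmE !valK.
- move=> m m'; rewrite FE => /msupp_sum_le /flatten_mapP[ab _].
  move=> /msuppZ_le; rewrite msuppX inE => /eqP ->.
  by rewrite /part_deg big1 // => i iS; rewrite mnmE insubN // negbK.
- rewrite raddf_sum /= -[RHS]sum0; apply: eq_bigr => ab _.
  rewrite mevalZ mevalX -scalerAl; congr (_ *: (_ * _)).
  by apply: eq_bigr => i _; rewrite mnmE.
Qed.
End Dependence.

Lemma mpoly_split (A : comNzRingType) (h : nat) (i : 'I_h) (F : {mpoly A[h]}) :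
  exists F0 F1 : {mpoly A[h]}, [/\ F = F0 + F1 * 'X_i,
    forall m, F0@_m = if m i == 0%N then F@_m else 0
    & forall m, F1@_m = F@_(U_(i) + m)].
Proof.
pose F0 : {mpoly A[h]} := \sum_(m <- msupp F | m i == 0%N) F@_m *: 'X_[m].
pose F1 : {mpoly A[h]} := \sum_(m <- msupp F | m i != 0%N) F@_m *: 'X_[m - U_(i)].
have FE : F = F0 + F1 * 'X_i.
  rewrite [LHS]mpolyE (bigID (fun m : 'X_{1..h} => m i == 0%N)) /=; congr (_ + _).
  rewrite mulr_suml; apply: eq_bigr => m mi.
  rewrite -scalerAl -mpolyXD submK //; apply/mnm_lepP => j.
  by rewrite mnm1E; case: eqP => // <-; rewrite lt0n.
have F0E m : F0@_m = if m i == 0%N then F@_m else 0.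
  rewrite raddf_sum big_mkcond /=.
  transitivity (\sum_(m' <- msupp F) if m i == 0%N then (F@_m' *: 'X_[m'])@_m else 0).
    apply: eq_bigr => m' _; rewrite mcoeffZ mcoeffX; case: (eqVneq m' m) => [->//|_].
    by rewrite mulr0 !if_same.
  by case: ifP => _; [rewrite [in RHS](mpolyE F) raddf_sum|rewrite big1].
exists F0, F1; split=> // m; rewrite [in RHS]FE mcoeffD F0E mcoeffMX.
by rewrite mnmDE mnm1E eqxx add0r.
Qed.

Section Height.
Variables (k : fieldType) (n : nat) (S : {set 'I_n}).
Local Notation R := {mpoly k[n]}.
Local Notation q S := (@ord_ideal k n S 1).

Lemma idealB (J : set R) f g : is_ideal J -> J f -> J g -> J (f - g).
Proof. by move=> [_ JD JM] hf hg; apply: JD => //; rewrite -mulN1r; apply: JM. Qed.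

Section ChainBound.
Variables (h : nat) (Q : nat -> set R).
Hypotheses (Q_prime : forall i, (i <= h)%N -> prime_ideal (Q i))
  (Q_sub : forall i, (i < h)%N -> (Q i `<` Q i.+1)%classic).
Variable f : 'I_h -> R.
Hypotheses (fQ : forall i : 'I_h, Q i.+1 (f i)) (fnQ : forall i : 'I_h, ~ Q i (f i)).

(** At l = 0 this is implied by an algebraic dependence of the [f i] over the variables outside [S];
    at l = h it forces [F] to be a constant. *)
Let relation l (F : {mpoly R[h]}) := [/\ F != 0, forall m, free_of S F@_m,
  forall m, F@_m != 0 -> forall i : 'I_h, (i < l)%N -> m i = 0%N & Q l F.@[f]].

(* Split [F = F0 + F1 X_l] with [F0] free of the variable [X_l]: either
   [F0] is a relation for [l + 1], or [f_l] can be divided out of [F]. *)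
Let relation_next l : (l < h)%N -> (exists F, relation l F) -> exists F, relation l.+1 F.
Proof.
move=> lh [F relF]; pose i0 := Ordinal lh.
(* The exponent of X_l in one monomial of [F] is the induction measure; passing to [F1] lowers it by
   one. *)
have [N [m0 mF e0]] : exists N, exists2 m, F@_m != 0 & m i0 = N.
  have [Fn0 _ _ _] := relF; exists (mlead F i0), (mlead F) => //.
  by rewrite -mcoeff_msupp mlead_supp.
have [Qi _ QM] := Q_prime (ltnW lh); have [Qi' _ _] := Q_prime lh.
elim: N F relF m0 mF e0 => [|N IH] F [Fn0 Ffree Fvar FQ] m0 mF e0;
  have [F0 [F1 [FE F0E F1E]]] := mpoly_split i0 F;
  have FfE : F.@[f] = F0.@[f] + f i0 * F1.@[f] by rewrite FE mevalD mevalM mevalXU mulrC.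
all: have rel0 : F0 != 0 -> relation l.+1 F0.
1,3: move=> F0n0; split=> //.
- move=> m; rewrite F0E; case: ifP => // _; by move=> m'; rewrite msupp0.
- move=> m; rewrite F0E; case: ifP => [mi /Fvar h'|]; last by rewrite eqxx.
  move=> i; rewrite ltnS leq_eqVlt => /predU1P[il|/h' //].
  by rewrite (_ : i = i0) ?(eqP mi) //; apply: val_inj.
- rewrite (_ : F0.@[f] = F.@[f] - F1.@[f] * f i0); last by rewrite FfE mulrC addrK.
  apply: idealB => //; first by have [h' _] := Q_sub lh; apply: h'.
  by case: Qi' => _ _; apply; apply: (fQ i0).
- move=> m; rewrite F0E; case: ifP => // _; by move=> m'; rewrite msupp0.
- move=> m; rewrite F0E; case: ifP => [mi /Fvar h'|]; last by rewrite eqxx.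
  move=> i; rewrite ltnS leq_eqVlt => /predU1P[il|/h' //].
  by rewrite (_ : i = i0) ?(eqP mi) //; apply: val_inj.
- rewrite (_ : F0.@[f] = F.@[f] - F1.@[f] * f i0); last by rewrite FfE mulrC addrK.
  apply: idealB => //; first by have [h' _] := Q_sub lh; apply: h'.
  by case: Qi' => _ _; apply; apply: (fQ i0).
- exists F0; apply: rel0; apply: contraNneq mF => F00.
  by have := F0E m0; rewrite F00 mcoeff0 e0 eqxx => <-.
have [F00|F0n0] := eqVneq F0 0; last by exists F0; apply: rel0.
have mE : m0 = (U_(i0) + (m0 - U_(i0)))%MM.
  rewrite addmC submK //; apply/mnm_lepP => j.
  by rewrite mnm1E; case: eqP => // <-; rewrite e0.
apply: (IH F1 _ (m0 - U_(i0))%MM); last 2 first.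
- by rewrite F1E -mE.
- by have := e0; rewrite {1}mE mnmDE mnm1E eqxx add1n => -[].
split.
- by apply: contraNneq Fn0 => F10; rewrite FE F00 F10 mul0r addr0.
- by move=> m; rewrite F1E; apply: Ffree.
- move=> m; rewrite F1E => /Fvar h' i /h'; rewrite mnmDE => /eqP.
  by rewrite addn_eq0 => /andP[_ /eqP].
- by move: FQ; rewrite FfE F00 meval0 add0r => /QM[/(fnQ (i := i0))|].
Qed.

(** Otherwise the dependence, carried up the chain, becomes a nonzero element of [q S] without any
    variable of [S], which is absurd. *)
Lemma chain_bound : Q h = q S -> (h <= #|S|)%N.
Proof.
move=> Qh; rewrite leqNgt; apply/negP => Sh.
have [F [Fn0 Ffree F0]] := algebraic_dependence f Sh.
have rel l : (l <= h)%N -> exists F, relation l F.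
  elim: l => [_|l IH lh]; last by apply: relation_next => //; apply/IH/ltnW.
  exists F; split=> //; rewrite F0.
  by have [[]] := Q_prime (leq0n h).
have [G [Gn0 Gfree Gvar GQ]] := rel h (leqnn h).
have GC : G = (G@_0%MM)%:MP.
  apply/mpolyP => m; rewrite mcoeffC; case: (eqVneq 0%MM m) => [<-|m0]; rewrite ?mulr1 ?mulr0 //.
  apply/eqP; apply: contraNT m0 => /Gvar h0; apply/eqP/mnmP => i.
  by rewrite mnm0E h0.
move: GQ; rewrite GC mevalC Qh => hG.
have : G@_0%MM != 0 by apply: contraNneq Gn0 => e; rewrite GC e mpolyC0.
rewrite -msupp_eq0; case e : (msupp _) => [//|m ms] _.
have mG : m \in msupp (G@_0%MM) by rewrite e inE eqxx.
by have := hG m mG; rewrite (Gfree _ _ mG).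
Qed.
End ChainBound.

Lemma prime_chain_bound h : has_prime_chain (q S) h -> (h <= #|S|)%N.
Proof.
move=> [Q [Qp Qs Qh]].
have /choice[f hf] : forall i : 'I_h, exists f, Q i.+1 f /\ ~ Q i f.
  move=> i; have [_ /existsNP[f /not_implyP[h1 h2]]] := Qs i (ltn_ord i).
  by exists f.
by apply: (chain_bound Qp Qs (f := f)) => // i; case: (hf i).
Qed.

Lemma prime_chain_coord : has_prime_chain (q S) #|S|.
Proof.
pose V i : {set 'I_n} := [set x in take i (enum S)]%SET.
have sz : size (enum S) = #|S| by rewrite -cardE.
exists (fun i => q (V i)); split=> [i _|i iS|]; first exact: coord_ideal_prime.
  have sub : V i \subset V i.+1.
    apply/subsetP => x; rewrite !inE => /(nthP x)[j]; rewrite size_take sz iS => ji <-.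
    rewrite nth_take // -(nth_take x (n0 := i.+1)) ?ltnS 1?ltnW // mem_nth //.
    by rewrite size_take sz; case: ifP => _; [apply: ltnW|apply: ltn_trans ji iS].
  split; first exact: ord_idealS.
  have [x0 _] : exists x, x \in S by apply/card_gt0P; apply: leq_ltn_trans iS.
  pose x := nth x0 (enum S) i => VV.
  have xV : x \in V i.+1.
    rewrite inE /x -(nth_take x0 (ltnSn i)) mem_nth // size_take sz.
    by case: ifP => // _.
  have /(coord_idealX k) := VV _ ((coord_idealX k _ _).2 xV).
  rewrite inE => /(nthP x0)[j]; rewrite size_take sz iS => ji.
  rewrite nth_take // => /eqP; rewrite nth_uniq ?enum_uniq ?sz //.
    by move=> /eqP e; rewrite e ltnn in ji.
  exact: ltn_trans ji iS.
congr (ord_ideal _); apply/setP => x; rewrite inE -sz take_size mem_enum //.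
Qed.

Lemma height_coord : height (q S) = #|S|.
Proof.
have hS : prime_height (q S) #|S|.
  by split; [exact: prime_chain_coord|exact: prime_chain_bound].
have up P h : prime_ideal P -> (q S `<=` P)%classic -> prime_height P h -> (#|S| <= h)%N.
  move=> Pp SP [_ Pmax]; have [PS|PS] := pselect (P = q S).
    by apply: Pmax; rewrite PS; exact: prime_chain_coord.
  have [Q [Qp Qs Qh]] := prime_chain_coord; apply: ltnW; apply: Pmax.
  (* A prime strictly above [q S] prolongs the chain by one, so the least height is attained at
     [q S] itself. *)
  exists (fun i => if (i <= #|S|)%N then Q i else P); split=> [i _|i|].
  - by case: ifP => // /Qp.
  - rewrite ltnS => iS; rewrite iS; case: ifPn => [/Qs //|]; rewrite -leqNgt => Si.
    have -> : i = #|S| by apply/eqP; rewrite eqn_leq iS.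
    by rewrite Qh; split=> // PS'; apply: PS; apply/seteqP.
  - by rewrite ltnn.
apply: xget_unique => [|h [[P [Pp SP Ph]] hmin]].
  by split=> [|P h]; [exists (q S); split=> //; exact: coord_ideal_prime|exact: up].
apply/eqP; rewrite eqn_leq (up P) // andbT; apply: (hmin (q S)) => //.
exact: coord_ideal_prime.
Qed.
End Height.

Section IntersectionPoset.
Variables (k : fieldType) (n : nat) (I : set {mpoly k[n]}).
Hypothesis I_monomial : monomial_ideal I.
Variables (d : Order.disp_t) (P : finPOrderType d) (Xp : P -> set (set {mpoly k[n]})).
Hypothesis PX : intersection_poset (zero_locus I) Xp.

Lemma intersection_poset_covers : exists Tp : P -> {set 'I_n}, [/\
  forall p, Xp p = zero_locus (ord_ideal (k := k) (Tp p) 1),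
  forall p, covers I (Tp p),
  forall p q, (p <= q)%O = (Tp q \subset Tp p)
  & forall F, covers I F -> exists2 p, Tp p \subset F &
      forall q, Tp q \subset F -> Tp q \subset Tp p].
Proof.
have [Xint Xsurj Xle] := PX.
have /choice[fam hfam] := fun p => (component_intersection_coord (Xp p) I_monomial).1 (Xint p).
pose Tp p := (\bigcup_(S in fam p) S)%SET.
have XE p : Xp p = zero_locus (ord_ideal (k := k) (Tp p) 1) by case: (hfam p).
exists Tp; split=> // [p|p q|F cF].
- have [/set0Pn[S Sfam] mS _] := hfam p; have /minsetP[cS _] := mS S Sfam.
  exact: coversS cS (bigcup_sup S Sfam).
- apply/idP/idP => [/Xle|h]; first by rewrite !XE => /zero_locus_coord_sub.
  by apply/Xle; rewrite !XE; apply/zero_locus_coord_sub.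
- pose famF := [set S | minset (covers I) S && (S \subset F)]%SET.
  have [S mS SF] := minset_exists cF.
  have Sfam : S \in famF by rewrite inE mS.
  have [|p pE] := Xsurj (zero_locus (ord_ideal (k := k) (\bigcup_(S in famF) S)%SET 1)).
    apply/component_intersection_coord => //; exists famF; split=> //.
      by apply/set0Pn; exists S.
    by move=> S'; rewrite inE => /andP[].
  (* The family chosen for [p] may differ from [famF], but the locus determines its set of
     variables. *)
  have TpE : Tp p = (\bigcup_(S in famF) S)%SET.
    by apply: (@zero_locus_coord_inj k); rewrite -XE.
  exists p; rewrite TpE.
    by apply/bigcupsP => S'; rewrite inE => /andP[].
  move=> q /bigcupsP qF; apply/bigcupsP => S' S'q; apply: bigcup_sup.
  by rewrite inE qF // andbT; case: (hfam q) => _ h _; apply: h.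
Qed.
End IntersectionPoset.

Theorem proposition2p1 (k : fieldType) (n : nat) (I : set {mpoly k[n]})
  (I_monomial : monomial_ideal I)
  (d : Order.disp_t) (P : finPOrderType d) (Xp : P -> set (set {mpoly k[n]}))
  (PX : intersection_poset (zero_locus I) Xp)
  (E : injective_resolution (poly_gmod k n))
  (r : nat) (alpha : 'rV[int]_n)
  (alpha_Omega : forall i, alpha 0 i = -1 \/ alpha 0 i = 0) :
  local_cohomology_dim I E r alpha (mult_deg Xp r alpha).
Proof.
apply: (local_cohomology_dim_unique (E := cousin_resolution k (@neg_first_inj n alpha))).
have [Tp [XE Tp_cov Tp_le Tp_core]] := intersection_poset_covers I_monomial PX.
set T := [set i | alpha 0 i < 0]%SET.
have TE : coord_prime alpha = @ord_ideal k n T 1.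
  rewrite coord_primeE; congr (ord_ideal _); apply/setP => i; rewrite !inE.
  by case: (alpha_Omega i) => ->.
have VE p : vanishing_ideal (Xp p) = @ord_ideal k n (Tp p) 1.
  by rewrite XE vanishing_ideal_coord.
have TpT p : coord_prime alpha = vanishing_ideal (Xp p) <-> Tp p = T.
  rewrite TE VE; split=> [e|->//].
  by apply: (@zero_locus_coord_inj k); rewrite e.
rewrite /mult_deg; case: (leqP r #|T|) => [rT|Tr].
  apply/local_cohomology_dim_cousin => //; case: pickP => [p /asboolP/TpT pT|none].
    rewrite -/T -pT; apply/(homology_dim_upper_chains k _ Tp_cov Tp_le Tp_core).
      exact: coversS.
    apply: reduced_homology_dimP; first exact: upper_chains_complex.
    (* As h(p) = |T|, homology in degree h(p) - r - 1 is carried by faces with |T| - r vertices. *)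
    by rewrite VE height_coord pT subrK subzn.
  (* [T] is not of the form [Tp p], and the multiplicity 0 is matched by acyclicity. *)
  apply: (cover_complex_acyclic _ (Tp := Tp)) => // [S F|p].
    exact: coversS.
  by apply/eqP => /TpT e; have := none p; rewrite asboolT.
case: pickP => [p /asboolP/TpT pT|_]; last exact: local_cohomology_dim_cousin_large.
rewrite (_ : mult Xp r p = 0%N); first exact: local_cohomology_dim_cousin_large.
(* For r > |T| the homological degree is below -1, where [reduced_homology_dim] takes its default
   value 0. *)
rewrite /mult /reduced_homology_dim VE height_coord pT subrK.
have : #|T|%:Z - r%:Z < 0 by rewrite subr_lt0 ltz_nat.
by case: (_ - _).
Qed.
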